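(* For all $z,y\in\mathcal Z$, the Gâteaux derivative of $j$ at $z$ in the direction $y$ is $$\langle j'(z),y\rangle=\int_0^T\langle R(Sz-\mathbf u_d)(t),y(t)\rangle_\Gamma\,\mathrm dt+\alpha\int_0^T\langle\dot z(t),\dot y(t)\rangle_\Gamma\,\mathrm dt.$$
   Context: Setting. $\Omega\subset\mathbb R^d$ is a bounded Lipschitz domain with boundary $\Gamma$ and outward unit normal $\boldsymbol\nu$, $\Gamma$ being partitioned into two non-overlapping relatively open sets $\Gamma_D,\Gamma_N$ ($\Gamma_D=\emptyset$ is allowed), and $T>0$. $A:B$ is the Frobenius product of matrices and $\mathbb R^{d\times d}_{\mathrm{sym}}$ the symmetric matrices. The coefficients $\mathcal C\in L^\infty(\Omega;\mathbb R^{(d\times d)\times(d\times d)})$, $\mathcal E\in L^\infty(\Omega;\mathbb R^{(d\times d)\times d})$, $\boldsymbol\kappa\in L^\infty(\Omega;\mathbb R^{d\times d}_{\mathrm{sym}})$ satisfy, a.e. in $\Omega$ and with constants $c_0,k_0>0$: $\mathcal CA\in\mathbb R^{d\times d}_{\mathrm{sym}}$ and $(\mathcal CA):B=A:(\mathcal CB)$ for all $A,B\in\mathbb R^{d\times d}$; $(\mathcal CA):A\ge c_0A:A$ for $A\in\mathbb R^{d\times d}_{\mathrm{sym}}$; $\mathcal E\mathbf b\in\mathbb R^{d\times d}_{\mathrm{sym}}$ and $(\boldsymbol\kappa\mathbf b)\cdot\mathbf b\ge k_0|\mathbf b|^2$ for $\mathbf b\in\mathbb R^d$. $\mathcal E^\top$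 is defined by $(\mathcal E^\top A)\cdot\mathbf b=A:(\mathcal E\mathbf b)$. The density $\rho\in L^\infty(\Omega)$ is strictly positive ($\rho\ge\rho_0>0$ a.e.). $\boldsymbol\varepsilon(\mathbf u)=\frac12(\nabla\mathbf u+\nabla\mathbf u^\top)$, $\sigma(\mathbf u,\psi)=\mathcal C\boldsymbol\varepsilon(\mathbf u)+\mathcal E\nabla\psi$, $\mathbf d(\mathbf u,\psi)=\mathcal E^\top\boldsymbol\varepsilon(\mathbf u)-\boldsymbol\kappa\nabla\psi$. Spaces. $(\cdot,\cdot)_\Omega$, $\|\cdot\|_\Omega$, $\|\cdot\|_\Gamma$ are $L^2$ inner product/norms on $\Omega$, $\Gamma$; $\|\cdot\|_{1,\Omega}$ is the $H^1(\Omega)$ norm; $\gamma$ is the trace operator to $\Gamma$, $\gamma_D$ its restriction to $\Gamma_D$; $\langle\cdot,\cdot\rangle_\Gamma$ is the $H^{-1/2}(\Gamma)\times H^{1/2}(\Gamma)$ duality, equal to the $L^2(\Gamma)$ product on $L^2(\Gamma)$ functions. $\mathbf H^1_D(\Omega)=\{\mathbf u\in H^1(\Omega)^d:\gamma_D\mathbf u=\mathbf 0\}$ (all of $H^1(\Omega)^d$ if $\Gamma_D=\emptyset$). For symmetric matrix fields $\mathrm S\in L^2$ with row-wise divergence $\mathrm{div}\,\mathrm S\in L^2(\Omega)^d$, the normal trace $\gamma_N\mathrm S$ on $\Gamma_N$ is the functional on $\{\gamma\mathbf v:\mathbf v\in\mathbf H^1_D(\Omega)\}$ given by $\langle\gamma_N\mathrm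 S,\gamma\mathbf v\rangle_N=(\mathrm S,\boldsymbol\varepsilon(\mathbf v))_\Omega+(\mathrm{div}\,\mathrm S,\mathbf v)_\Omega$; $\mathbf q\cdot\boldsymbol\nu$ is the usual normal trace of $\mathbf q\in\mathbf H(\mathrm{div},\Omega)$. $\mathbf L^2_\rho(\Omega)$ is $L^2(\Omega)^d$ with inner product $(\cdot,\cdot)_\rho=(\rho\,\cdot,\cdot)_\Omega$ and norm $\|\cdot\|_\rho$; $\mathbf H^{-1}_D(\Omega)$ is the dual of $\mathbf H^1_D(\Omega)$ when $\mathbf L^2_\rho(\Omega)$ is identified with its dual, and $\langle\cdot,\cdot\rangle_\rho$ is the corresponding duality product. $G:H^1(\Omega)\to\mathbb R$ is linear, bounded, with $G1\ne0$; $H^1_G(\Omega)=\{\psi\in H^1(\Omega):G\psi=0\}$. $L^2_0(\Gamma)=\{z\in L^2(\Gamma):\int_\Gamma z=0\}$. $\mathcal Z=\{z\in H^1(0,T;L^2_0(\Gamma)):z(0)=0\}$ with norm $\left(\int_0^T\|\dot z(\tau)\|_\Gamma^2\,\mathrm d\tau\right)^{1/2}$. $\mathcal U=C^0([0,T];\mathbf H^1_D(\Omega))$ with norm $\left(\int_0^T\|\mathbf u(\tau)\|_{1,\Omega}^2\,\mathrm d\tau\right)^{1/2}$. $\mathcal X=L^2(0,T;L^2(\Gamma))$. State equation and $S$. With $a((\mathbf u,\psi),(\mathbf w,\varphi))=(\sigma(\mathbf u,\psi),\boldsymbol\varepsilon(\mathbf w))_\Omega-(\mathbf d(\mathbf u,\psi),\nabla\varphi)_\Omega$,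 the solution with data $z\in\mathcal Z$ is the unique pair $\mathbf u\in C^0([0,T];\mathbf H^1_D(\Omega))\cap C^1([0,T];\mathbf L^2_\rho(\Omega))\cap C^2([0,T];\mathbf H^{-1}_D(\Omega))$, $\psi\in C^0([0,T];H^1_G(\Omega))$ such that for all $t\in[0,T]$ $$\langle\ddot{\mathbf u}(t),\mathbf w\rangle_\rho+a((\mathbf u(t),\psi(t)),(\mathbf w,\varphi))=-\langle z(t),\gamma\varphi\rangle_\Gamma\quad\forall(\mathbf w,\varphi)\in\mathbf H^1_D(\Omega)\times H^1_G(\Omega),$$ and $\mathbf u(0)=\dot{\mathbf u}(0)=\mathbf 0$; $S:\mathcal Z\to\mathcal U$ is given by $Sz=\mathbf u$. Adjoint equations and $R$. Given $\mathbf f\in\mathcal U$, let $\mathbf p\in C^2([0,T];\mathbf L^2_\rho(\Omega))\cap C^1([0,T];\mathbf H^1_D(\Omega))$ and $\xi\in C^1([0,T];H^1(\Omega))$ be the unique solution of $$\rho\ddot{\mathbf p}(t)=\mathrm{div}\,\sigma(\mathbf p(t),\xi(t))+\rho\,\mathbf f(t),\qquad 0=\nabla\cdot\mathbf d(\mathbf p(t),\xi(t)),$$ $$\gamma_D\mathbf p(t)=\mathbf 0,\quad\gamma_N\sigma(\mathbf p(t),\xi(t))=\mathbf 0,\quad G\xi(t)=0,\quad\mathbf d(\mathbf p(t),\xi(t))\cdot\boldsymbol\nu=0$$ for all $t\in[0,T]$, with $\mathbf p(T)=\dot{\mathbf p}(T)=\mathbf 0$. Then $R:\mathcal U\to\mathcal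 X$ is given by $R\mathbf f=\gamma\xi$. Functional. $\mathbf u_d\in\mathcal U$ is given with $\mathbf u_d(0)=\mathbf 0$, $\alpha>0$, and $j:\mathcal Z\to\mathbb R$ is $$j(z)=\frac12\int_0^T\|Sz(t)-\mathbf u_d(t)\|_\rho^2\,\mathrm dt+\frac\alpha2\int_0^T\|\dot z(t)\|_\Gamma^2\,\mathrm dt.$$ *)

(* Defs.v *)
From HB Require Import structures.
From mathcomp Require Import all_boot all_order all_algebra.
From mathcomp Require Import all_classical all_reals all_analysis.

Set Implicit Arguments.
Unset Strict Implicit.
Unset Printing Implicit Defensive.
Import Order.TTheory GRing.Theory Num.Theory.
Import numFieldNormedType.Exports.
Local Open Scope classical_set_scope.
Local Open Scope ring_scope.

(* Conventions. Points of R^d are row vectors 'rV[R]_d, and d = n.+1 for the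
   domain.  Elements of Lebesgue, Sobolev and Bochner spaces are represented by
   functions defined everywhere; equality of such elements is written as an
   almost everywhere equality. *)

(* The Frobenius product A : B, which on row vectors is the dot product. *)
Definition frob {R : realType} {m n : nat} (A B : 'M[R]_(m, n)) : R :=
  \sum_i \sum_j A i j * B i j.

Definition enorm {R : realType} {n : nat} (v : 'rV[R]_n) : R :=
  Num.sqrt (frob v v).

Section gauge_outer.
Context {R : realType} {T : Type}.
Local Open Scope ereal_scope.

Definition gauge_outer (g : set T -> \bar R) (A : set T) : \bar R :=
  ereal_inf [set \sum_(k <oo) g (F k) |
             F in [set F : (set T)^nat | A `<=` \bigcup_k F k]].

Variable g : set T -> \bar R.
Hypotheses (g0 : g set0 = 0) (g_ge0 : forall A, 0 <= g A).

Lemma gauge_outer_ge0 A : 0 <= gauge_outer g A.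
Proof.
by apply: le_ereal_inf_tmp => _ [F _ <-]; apply: nneseries_ge0 => k *; exact: g_ge0.
Qed.

Lemma gauge_outer_le (A : set T) (F : (set T)^nat) :
  A `<=` \bigcup_k F k -> gauge_outer g A <= \sum_(k <oo) g (F k).
Proof. by move=> AF; apply: ereal_inf_lbound; exists F. Qed.

Lemma gauge_outer0 : gauge_outer g set0 = 0.
Proof.
apply/eqP; rewrite eq_le gauge_outer_ge0 andbT.
apply: (le_trans (@gauge_outer_le _ (fun=> set0) _)) => //.
by rewrite eseries0.
Qed.

Lemma gauge_outer_mono : {homo gauge_outer g : A B / A `<=` B >-> A <= B}.
Proof.
move=> A B AB; apply/ereal_inf_le_tmp => _ [F BF <-].
by exists F => //; exact: subset_trans BF.
Qed.

Lemma gauge_outer_sigma_subadditive : sigma_subadditive (gauge_outer g).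
Proof.
move=> A; have [[i ioo]|] := pselect (exists i, gauge_outer g (A i) = +oo).
  rewrite (eseries_pinfty _ _ ioo) ?leey// => k _.
  by rewrite -ltNye (lt_le_trans _ (gauge_outer_ge0 _)).
rewrite -forallNE => Aoo.
suff add2e (e : {posnum R}) : gauge_outer g (\bigcup_n A n) <=
    \sum_(i <oo) gauge_outer g (A i) + e%:num%:E.
  by apply/lee_addgt0Pr => _/posnumP[].
rewrite (le_trans _ (epsilon_trick _ _ _))//; last first.
  by move=> k; exact: gauge_outer_ge0.
pose P k (B : (set T)^nat) := A k `<=` \bigcup_i B i /\
  \sum_(i <oo) g (B i) <= gauge_outer g (A k) + (e%:num / (2 ^ k.+1)%:R)%:E.
have [G PG] : {G : ((set T)^nat)^nat & forall k, P k (G k)}.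
  apply: (@choice _ _ P) => k; rewrite /P.
  have fin : gauge_outer g (A k) \is a fin_num.
    by rewrite ge0_fin_numE ?gauge_outer_ge0// ltey; apply/eqP; exact: Aoo.
  have en1 : (0 < e%:num / (2 ^ k.+1)%:R)%R by [].
  have [_ [B AB <-] /ltW H] := lb_ereal_inf_adherent en1 fin.
  by exists B; split.
have gG_ge0 x : 0 <= (g \o uncurry G) x by exact: g_ge0.
apply: (@le_trans _ _ (\esum_(i in setT) (g \o uncurry G) i)).
  apply: ereal_inf_lbound => /=.
  have /card_esym/ppcard_eqP[f] := card_nat2.
  exists (uncurry G \o f).
    move=> t [i _ /((PG i).1) [j _ Gij]].
    by exists (f^-1%FUN (i, j)) => //=; rewrite invK ?inE.
  rewrite -(esum_pred_image (g \o uncurry G) _ xpredT) ?[fun=> _]set_true//.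
  by rewrite image_eq.
rewrite (_ : esum _ _ = \sum_(i <oo) \sum_(j <oo ) g (G i j)); last first.
  pose J : nat -> set (nat * nat) := fun i => [set (i, j) | j in setT].
  rewrite (_ : setT = \bigcup_k J k); last first.
    by rewrite predeqE => -[a b]; split => // _; exists a => //; exists b.
  rewrite esum_bigcupT /=; last 2 first.
    - apply/trivIsetP => i j _ _ ij.
      rewrite predeqE => -[k m] /=; split => //= -[] [_] _ [<-{k} _].
      by move=> [m' _] [] /esym/eqP; rewrite (negbTE ij).
    - by move=> /= [k m]; exact: g_ge0.
  rewrite -(image_id [set: nat]) -fun_true esum_pred_image//; last first.
    by move=> k _; exact: esum_ge0.
  apply: eq_eseriesr => /= j _.
  rewrite -(esum_pred_image (g \o uncurry G) (pair j) predT)//=; last first.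
    by move=> ? ? _ _; exact: (@can_inj _ _ _ snd).
  by congr esum; rewrite predeqE => -[a b]; split; move=> [i _ <-]; exists i.
apply: lee_lim.
- apply: is_cvg_nneseries => k *.
  by apply: nneseries_ge0 => m *; exact: (gG_ge0 (k, m)).
- by apply: is_cvg_nneseries => k *; apply: adde_ge0 => //; exact: gauge_outer_ge0.
- by near=> k; apply: lee_sum => i _; exact: (PG i).2.
Unshelve. all: by end_near. Qed.

End gauge_outer.

(* Lebesgue measure on R^d: the infimum of the total volumes of countable
   covers by boxes.  A covering set is charged the volume of its bounding box. *)
Section lebesgue_rV.
Context {R : realType} {d : nat}.
Local Open Scope ereal_scope.

Definition box (a b : 'rV[R]_d) : set 'rV[R]_d :=
  [set x | forall i, (a 0 i <= x 0 i <= b 0 i)%R].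

Definition box_gauge (U : set 'rV[R]_d) : \bar R :=
  if U == set0 then 0 else
  ereal_inf [set (\prod_i (ab.2 0 i - ab.1 0 i))%:E |
             ab in [set ab : 'rV[R]_d * 'rV[R]_d | U `<=` box ab.1 ab.2]].

Lemma box_gauge0 : box_gauge set0 = 0.
Proof. by rewrite /box_gauge eqxx. Qed.

Lemma box_gauge_ge0 U : 0 <= box_gauge U.
Proof.
rewrite /box_gauge; case: ifPn => // /set0P[x Ux].
apply: le_ereal_inf_tmp => _ [[a b] /= Uab <-].
rewrite lee_fin; apply: prodr_ge0 => i _; rewrite subr_ge0.
by have /andP[/le_trans] := Uab _ Ux i; apply.
Qed.

Definition leb_outer : set 'rV[R]_d -> \bar R := gauge_outer box_gauge.

HB.instance Definition _ := isOuterMeasure.Build R 'rV[R]_d leb_outer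
  (gauge_outer0 box_gauge0 box_gauge_ge0) (gauge_outer_ge0 box_gauge_ge0)
  (@gauge_outer_mono _ _ box_gauge)
  (gauge_outer_sigma_subadditive box_gauge_ge0).

Definition leb_outer_measure : {outer_measure set 'rV[R]_d -> \bar R} :=
  leb_outer.

Definition leb :
    {measure set (caratheodory_type leb_outer_measure) -> \bar R} :=
  leb_outer_measure.

End lebesgue_rV.

(* The s-dimensional Hausdorff measure for the Euclidean distance, normalized by
   |B^s| / 2^s so that for s = d - 1 it is the surface measure. *)
Section hausdorff.
Context {R : realType} {d : nat} (s : nat).
Local Open Scope ereal_scope.

Definition ediam (U : set 'rV[R]_d) : \bar R :=
  ereal_sup [set (enorm (xy.1 - xy.2))%:E | xy in U `*` U].

Definition hausdorff_const : R :=
  fine (leb_outer [set x : 'rV[R]_s | (enorm x <= 1)%R]) / 2 ^+ s.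

Definition hausdorff_gauge (delta : R) (U : set 'rV[R]_d) : \bar R :=
  if U == set0 then 0 else
  if ediam U <= delta%:E then (hausdorff_const * fine (ediam U) ^+ s)%:E
  else +oo.

Lemma hausdorff_gauge0 delta : hausdorff_gauge delta set0 = 0.
Proof. by rewrite /hausdorff_gauge eqxx. Qed.

Lemma ediam_ge0 (U : set 'rV[R]_d) : U !=set0 -> 0 <= ediam U.
Proof.
move=> [x Ux]; apply: (@le_trans _ _ (enorm (x - x))%:E).
  by rewrite lee_fin sqrtr_ge0.
by apply: ereal_sup_ubound; exists (x, x).
Qed.

Lemma hausdorff_gauge_ge0 delta U : 0 <= hausdorff_gauge delta U.
Proof.
rewrite /hausdorff_gauge; case: ifPn => // /set0P U0.
case: ifPn => _; last exact: leey.
rewrite lee_fin mulr_ge0 ?exprn_ge0 ?fine_ge0 ?ediam_ge0//.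
by rewrite divr_ge0 ?exprn_ge0// fine_ge0// outer_measure_ge0.
Qed.

Definition hausdorff_outer (A : set 'rV[R]_d) : \bar R :=
  ereal_sup [set gauge_outer (hausdorff_gauge delta) A |
             delta in [set delta : R | (0 < delta)%R]].

Lemma hausdorff_outer_ge0 A : 0 <= hausdorff_outer A.
Proof.
apply: (@le_trans _ _ (gauge_outer (hausdorff_gauge 1%R) A)).
  exact/gauge_outer_ge0/hausdorff_gauge_ge0.
by apply: ereal_sup_ubound; exists 1%R => /=.
Qed.

Lemma hausdorff_outer0 : hausdorff_outer set0 = 0.
Proof.
apply/eqP; rewrite eq_le hausdorff_outer_ge0 andbT.
apply: ge_ereal_sup => _ [delta _ <-].
by rewrite gauge_outer0//; [exact: hausdorff_gauge0|exact: hausdorff_gauge_ge0].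
Qed.

Lemma hausdorff_outer_mono :
  {homo hausdorff_outer : A B / A `<=` B >-> A <= B}.
Proof.
move=> A B AB; apply: ge_ereal_sup => _ [delta delta0 <-].
apply: (le_trans (gauge_outer_mono _ AB)).
by apply: ereal_sup_ubound; exists delta.
Qed.

Lemma hausdorff_outer_sigma_subadditive : sigma_subadditive hausdorff_outer.
Proof.
move=> F; apply: ge_ereal_sup => _ [delta delta0 <-].
apply: (le_trans (gauge_outer_sigma_subadditive (hausdorff_gauge_ge0 delta) F)).
apply: lee_nneseries => k _.
- by move=> _; exact/gauge_outer_ge0/hausdorff_gauge_ge0.
- by apply: ereal_sup_ubound; exists delta.
Qed.

HB.instance Definition _ := isOuterMeasure.Build R 'rV[R]_d hausdorff_outer
  hausdorff_outer0 hausdorff_outer_ge0 hausdorff_outer_mono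
  hausdorff_outer_sigma_subadditive.

Definition hausdorff_outer_measure :
    {outer_measure set 'rV[R]_d -> \bar R} := hausdorff_outer.

Definition hausdorff :
    {measure set (caratheodory_type hausdorff_outer_measure) -> \bar R} :=
  hausdorff_outer_measure.

End hausdorff.

Notation surface n := (@hausdorff _ n.+1 n).

Section L2.
Context {R : realType} {disp : measure_display} {T : measurableType disp}.
Variables (mu : {measure set T -> \bar R}) (D : set T).

Definition L2 (f : T -> R) : Prop :=
  measurable_fun D f /\ (\int[mu]_(x in D) ((f x) ^+ 2)%:E < +oo)%E.

Definition ip (f g : T -> R) : R := \int[mu]_(x in D) (f x * g x).

Definition L2norm (f : T -> R) : R := Num.sqrt (ip f f).

Definition L2mx {m n : nat} (f : T -> 'M[R]_(m, n)) : Prop :=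
  forall i j, L2 (fun x => f x i j).

Definition ipmx {m n : nat} (f g : T -> 'M[R]_(m, n)) : R :=
  \int[mu]_(x in D) frob (f x) (g x).

Definition L2mxnorm {m n : nat} (f : T -> 'M[R]_(m, n)) : R :=
  Num.sqrt (ipmx f f).

Definition Linfty (f : T -> R) : Prop :=
  measurable_fun D f /\
  exists M : R, {ae mu, forall x, D x -> `|f x| <= M}.

End L2.

Section sobolev.
Context {R : realType} {n : nat}.
Local Notation V := 'rV[R]_n.+1.
Local Notation M := 'M[R]_n.+1.
Variable Omega : set V.

Definition pderiv (i : 'I_n.+1) (phi : V -> R) : V -> R :=
  fun x => 'D_(delta_mx 0 i : V) phi x.

(* Test functions are of class C^1_c(Omega); by mollification they define the
   same weak derivatives as C^oo_c(Omega). *)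
Definition test_fun (phi : V -> R) : Prop :=
  [/\ forall x, differentiable phi x, forall i, continuous (pderiv i phi),
      compact (closure [set x | phi x != 0]) &
      closure [set x | phi x != 0] `<=` Omega].

Definition is_wpartial (i : 'I_n.+1) (u v : V -> R) : Prop :=
  L2 leb Omega v /\
  forall phi, test_fun phi ->
    ip leb Omega u (pderiv i phi) = - ip leb Omega v phi.

Definition wpartial (i : 'I_n.+1) (u : V -> R) : V -> R :=
  xget (fun=> 0) [set v | is_wpartial i u v].

Definition H1 (u : V -> R) : Prop :=
  L2 leb Omega u /\ forall i, exists v, is_wpartial i u v.

Definition grad (u : V -> R) : V -> V := fun x => \row_i wpartial i u x.

Definition H1norm (u : V -> R) : R :=
  Num.sqrt (L2norm leb Omega u ^+ 2 + L2mxnorm leb Omega (grad u) ^+ 2).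

Definition component (i : 'I_n.+1) (u : V -> V) : V -> R := fun x => u x 0 i.

Definition vH1 (u : V -> V) : Prop := forall i, H1 (component i u).

Definition vgrad (u : V -> V) : V -> M :=
  fun x => \matrix_(i, j) wpartial j (component i u) x.

Definition vH1norm (u : V -> V) : R :=
  Num.sqrt (L2mxnorm leb Omega u ^+ 2 + L2mxnorm leb Omega (vgrad u) ^+ 2).

Definition strain (u : V -> V) : V -> M :=
  fun x => 2^-1 *: (vgrad u x + (vgrad u x)^T).

Definition is_wdiv (q : V -> V) (w : V -> R) : Prop :=
  L2 leb Omega w /\
  forall phi, test_fun phi ->
    ipmx leb Omega q (fun x => \row_i pderiv i phi x) = - ip leb Omega w phi.

Definition wdiv (q : V -> V) : V -> R :=
  xget (fun=> 0) [set w | is_wdiv q w].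

Definition Hdiv (q : V -> V) : Prop :=
  L2mx leb Omega q /\ exists w, is_wdiv q w.

Definition mxdiv (S : V -> M) : V -> V :=
  fun x => \row_i wdiv (fun y => row i (S y)) x.

Definition mxHdiv (S : V -> M) : Prop :=
  forall i, Hdiv (fun y => row i (S y)).

End sobolev.

Section lipschitz_domain.
Context {R : realType} {n : nat}.
Local Notation V := 'rV[R]_n.+1.

Definition bdry (Omega : set V) : set V := closure Omega `\` interior Omega.

(* Near each boundary point Omega is the set above the graph of a Lipschitz
   function g over the hyperplane orthogonal to a unit vector e. *)
Definition lipschitz_domain (Omega : set V) : Prop :=
  [/\ open Omega, connected Omega, Omega !=set0, bounded_set Omega &
   forall x, bdry Omega x -> exists (e : V) (g : V -> R) (L r : R),
     [/\ frob e e = 1, 0 < r,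
         forall y y', `|g y - g y'| <= L * enorm (y - y') &
         forall y, enorm (y - x) < r ->
           (Omega y <-> g (y - frob y e *: e) < frob y e)]].

Definition boundary_partition (Omega GammaD GammaN : set V) : Prop :=
  [/\ exists2 U, open U & GammaD = U `&` bdry Omega,
      exists2 U, open U & GammaN = U `&` bdry Omega,
      GammaD `&` GammaN = set0 &
      bdry Omega = closure GammaD `|` closure GammaN].

(* The trace operator: the bounded linear map H^1(Omega) -> L^2(Gamma) that
   restricts functions continuous up to the boundary. *)
Definition is_trace (Omega : set V) (gamma : (V -> R) -> V -> R) : Prop :=
  [/\ forall u, H1 Omega u -> L2 (surface n) (bdry Omega) (gamma u),
      forall a u v, H1 Omega u -> H1 Omega v ->
        {ae surface n, forall x, bdry Omega x ->
          gamma (a *: u + v) x = a * gamma u x + gamma v x},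
      exists c, forall u, H1 Omega u ->
        L2norm (surface n) (bdry Omega) (gamma u) <= c * H1norm Omega u &
      forall u, H1 Omega u -> {within closure Omega, continuous u} ->
        {ae surface n, forall x, bdry Omega x -> gamma u x = u x}].

(* The functional G, which fixes the additive constant of potentials. *)
Definition is_gauge (Omega : set V) (G : (V -> R) -> R) : Prop :=
  [/\ forall a u v, H1 Omega u -> H1 Omega v ->
        G (a *: u + v) = a * G u + G v,
      exists c, forall u, H1 Omega u -> `|G u| <= c * H1norm Omega u &
      G (fun=> 1) != 0].

End lipschitz_domain.

Section material.
Context {R : realType} {n : nat}.
Local Notation V := 'rV[R]_n.+1.
Local Notation M := 'M[R]_n.+1.
Local Notation I := 'I_n.+1.

Record material := Material {
  stiffness : V -> I -> I -> I -> I -> R;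
  piezo : V -> I -> I -> I -> R;
  permittivity : V -> M;
  density : V -> R }.

Variable m : material.

Definition Cmul (x : V) (A : M) : M :=
  \matrix_(i, j) \sum_k \sum_l stiffness m x i j k l * A k l.

Definition Emul (x : V) (b : V) : M :=
  \matrix_(i, j) \sum_k piezo m x i j k * b 0 k.

Definition ETmul (x : V) (A : M) : V :=
  \row_k \sum_i \sum_j piezo m x i j k * A i j.

(* kappa b, for b written as a row vector *)
Definition kmul (x : V) (b : V) : V := b *m (permittivity m x)^T.

Definition is_symmx (A : M) : Prop := A^T = A.

Record admissible_material (Omega : set V) : Prop := {
  stiffness_Linfty : forall i j k l,
    Linfty leb Omega (fun x => stiffness m x i j k l);
  piezo_Linfty : forall i j k, Linfty leb Omega (fun x => piezo m x i j k);
  kappa_Linfty : forall i j, Linfty leb Omega (fun x => permittivity m x i j);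
  rho_Linfty : Linfty leb Omega (density m);
  stiffness_sym : {ae leb, forall x, Omega x ->
    forall A B, is_symmx (Cmul x A) /\ frob (Cmul x A) B = frob A (Cmul x B)};
  stiffness_coercive : exists2 c0 : R, 0 < c0 & {ae leb, forall x, Omega x ->
    forall A, is_symmx A -> c0 * frob A A <= frob (Cmul x A) A};
  piezo_sym : {ae leb, forall x, Omega x -> forall b, is_symmx (Emul x b)};
  kappa_sym : {ae leb, forall x, Omega x -> is_symmx (permittivity m x)};
  kappa_coercive : exists2 k0 : R, 0 < k0 & {ae leb, forall x, Omega x ->
    forall b, k0 * frob b b <= frob (kmul x b) b};
  rho_pos : exists2 rho0 : R, 0 < rho0 &
    {ae leb, forall x, Omega x -> rho0 <= density m x} }.

Definition stress_field (Omega : set V) (u : V -> V) (psi : V -> R) : V -> M :=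
  fun x => Cmul x (strain Omega u x) + Emul x (grad Omega psi x).

Definition disp_field (Omega : set V) (u : V -> V) (psi : V -> R) : V -> V :=
  fun x => ETmul x (strain Omega u x) - kmul x (grad Omega psi x).

End material.
Arguments material : clear implicits.

Section bochner.
Context {R : realType}.

(* A seminormed space: the members [member] of a function space with the seminorm
   [nrm].  The value of [nrm] is meaningful on [member] only. *)
Record space := Space {
  carrier : lmodType R;
  member : set carrier;
  nrm : carrier -> R }.

Arguments member : clear implicits.

Variables (T : R) (X : space).
Local Notation I := (`[0, T]%classic : set R).
Local Notation lam := (@lebesgue_measure R).

Definition C0T (u : R -> carrier X) : Prop :=
  (forall t, I t -> member X (u t)) /\
  forall t, I t -> nrm (u s - u t) @[s --> within I (nbhs t)] --> (0 : R).

Definition derivT (u du : R -> carrier X) : Prop :=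
  forall t, I t ->
    nrm ((s - t)^-1 *: (u s - u t) - du t) @[s --> within I t^'] --> (0 : R).

Definition C1T (u du : R -> carrier X) : Prop :=
  [/\ C0T u, C0T du & derivT u du].

Definition C2T (u du ddu : R -> carrier X) : Prop :=
  C1T u du /\ C1T du ddu.

(* The step function sum_i 1_(A_i) c_i is given by the list of the (A_i, c_i). *)
Definition step := seq (set R * carrier X).

Definition step_in (s : step) : Prop :=
  forall p, p \in s -> measurable p.1 /\ member X p.2.

Definition step_at (s : step) (t : R) : carrier X :=
  \sum_(p <- s) \1_(p.1) t *: p.2.

Definition step_int (s : step) : carrier X :=
  \sum_(p <- s) fine (lam (p.1 `&` I)) *: p.2.

Definition strongly_measurable (f : R -> carrier X) : Prop :=
  (forall t, I t -> member X (f t)) /\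
  exists s : nat -> step, (forall k, step_in (s k)) /\
    forall t, I t -> nrm (f t - step_at (s k) t) @[k --> \oo] --> (0 : R).

(* The Bochner integral of f over [0, T] is J. *)
Definition bochner (f : R -> carrier X) (J : carrier X) : Prop :=
  [/\ strongly_measurable f, member X J &
   exists s : nat -> step, [/\ forall k, step_in (s k),
     (\int[lam]_(t in I) (nrm (f t - step_at (s k) t))%:E)%E @[k --> \oo]
       --> (0 : \bar R)%E &
     nrm (J - step_int (s k)) @[k --> \oo] --> (0 : R)]].

Definition L2T (f : R -> carrier X) : Prop :=
  strongly_measurable f /\
  (\int[lam]_(t in I) ((nrm (f t)) ^+ 2)%:E < +oo)%E.

Definition test_time (phi : R -> R) : Prop :=
  [/\ forall t, derivable phi t 1, continuous (derive1 phi),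
      compact (closure [set t | phi t != 0]) &
      closure [set t | phi t != 0] `<=` `]0, T[%classic].

Definition is_wdot (z dz : R -> carrier X) : Prop :=
  L2T dz /\
  forall phi, test_time phi -> exists J,
    bochner (fun t => derive1 phi t *: z t) J /\
    bochner (fun t => phi t *: dz t) (- J).

Definition wdot (z : R -> carrier X) : R -> carrier X :=
  xget (fun=> 0) [set dz | is_wdot z dz].

(* H^1(0, T; X), each class being represented by its continuous member. *)
Definition H1T (z : R -> carrier X) : Prop :=
  C0T z /\ exists dz, is_wdot z dz.

End bochner.
Arguments C0T {R} T X u.
Arguments C1T {R} T X u du.
Arguments C2T {R} T X u du ddu.
Arguments H1T {R} T X z.
Arguments wdot {R} T X z.
Arguments space : clear implicits.
Arguments member {R} X _ : rename.

Section problem.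
Context {R : realType} {n : nat}.
Local Notation V := 'rV[R]_n.+1.
Local Notation M := 'M[R]_n.+1.

Record data := Data {
  domain : set V;
  GammaD : set V;
  GammaN : set V;
  horizon : R;
  mat : material R n;
  trace : (V -> R) -> V -> R;
  gauge : (V -> R) -> R }.

Variable P : data.
Local Notation Omega := (domain P).
Local Notation Gamma := (bdry Omega).
Local Notation T := (horizon P).
Local Notation I := (`[0, T]%classic : set R).
Local Notation rho := (density (mat P)).
Local Notation stress := (stress_field (mat P) Omega).
Local Notation elec_disp := (disp_field (mat P) Omega).

Record standing_assumptions : Prop := {
  Omega_lipschitz : lipschitz_domain Omega;
  Gamma_partition : boundary_partition Omega (GammaD P) (GammaN P);
  horizon_gt0 : 0 < T;
  material_ok : admissible_material (mat P) Omega;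
  trace_ok : is_trace Omega (trace P);
  gauge_ok : is_gauge Omega (gauge P) }.

Definition vtrace (u : V -> V) : V -> V := fun x => \row_i trace P (component i u) x.

Definition ip_Gamma (f g : V -> R) : R := ip (surface n) Gamma f g.

Definition norm_Gamma (f : V -> R) : R := L2norm (surface n) Gamma f.

Definition L20_Gamma : space R :=
  @Space R (V -> R)
    [set z | [/\ L2 (surface n) Gamma z,
                 (surface n).-integrable Gamma (EFin \o z) &
                 \int[surface n]_(x in Gamma) z x = 0]]
    norm_Gamma.

Definition zero_in_Omega {U : zmodType} (f : V -> U) : Prop :=
  {ae leb, forall x, Omega x -> f x = 0}.

Definition H1_space : space R := @Space R (V -> R) (H1 Omega) (H1norm Omega).

Definition H1G_space : space R :=
  @Space R (V -> R) [set psi | H1 Omega psi /\ gauge P psi = 0] (H1norm Omega).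

Definition H1D_space : space R :=
  @Space R (V -> V)
    [set u | vH1 Omega u /\
             {ae surface n, forall x, GammaD P x -> vtrace u x = 0}]
    (vH1norm Omega).

Definition ip_rho (u v : V -> V) : R :=
  ipmx leb Omega (fun x => rho x *: u x) v.

Definition norm_rho (u : V -> V) : R := Num.sqrt (ip_rho u u).

Definition L2rho_space : space R := @Space R (V -> V) (L2mx leb Omega) norm_rho.

(* Bounded linear functionals on H^1_D(Omega), with the dual norm. *)
Definition HDdual_space : space R :=
  @Space R ((V -> V) -> R)
    [set l | (forall a w w', member H1D_space w -> member H1D_space w' ->
                l (a *: w + w') = a * l w + l w') /\
             exists c, forall w, member H1D_space w -> `|l w| <= c * vH1norm Omega w]
    (fun l => sup [set `|l w| | w in [set w | member H1D_space w /\
                                              vH1norm Omega w <= 1]]).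

(* The embedding of L^2_rho(Omega) into the dual of H^1_D(Omega). *)
Definition rho_embed (v : V -> V) : (V -> V) -> R := fun w => ip_rho v w.

Definition Zspace (z : R -> V -> R) : Prop :=
  H1T T L20_Gamma z /\ {ae surface n, forall x, Gamma x -> z 0 x = 0}.

Definition Uspace (u : R -> V -> V) : Prop := C0T T H1D_space u.

Definition zdot (z : R -> V -> R) : R -> V -> R := wdot T L20_Gamma z.

Definition aform (u : V -> V) (psi : V -> R) (w : V -> V) (phi : V -> R) : R :=
  ipmx leb Omega (stress u psi) (strain Omega w)
  - ipmx leb Omega (elec_disp u psi) (grad Omega phi).

(* The H^{-1}_D(Omega)-valued derivative of u' is ddu, so that
   <u''(t), w>_rho is ddu t w. *)
Definition state_solution (z : R -> V -> R) (u : R -> V -> V)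
    (psi : R -> V -> R) : Prop :=
  exists (du : R -> V -> V) (ddu : R -> (V -> V) -> R),
    C0T T H1D_space u /\
    C1T T L2rho_space u du /\
    C2T T HDdual_space (fun t => rho_embed (u t)) (fun t => rho_embed (du t)) ddu /\
    C0T T H1G_space psi /\
    zero_in_Omega (u 0) /\ zero_in_Omega (du 0) /\
    forall t, I t -> forall w phi, member H1D_space w -> member H1G_space phi ->
      ddu t w + aform (u t) (psi t) w phi = - ip_Gamma (z t) (trace P phi).

(* S z is the first component of the unique solution with data z. *)
Definition state_operator (S : (R -> V -> R) -> R -> V -> V) : Prop :=
  forall z, Zspace z -> exists psi, state_solution z (S z) psi /\
    forall u' psi', state_solution z u' psi' -> forall t, I t ->
      zero_in_Omega (u' t - S z t) /\ zero_in_Omega (psi' t - psi t).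

(* Both normal traces are functionals, written as functions of the test field. *)
Definition ntrace_N (S : V -> M) (v : V -> V) : R :=
  ipmx leb Omega S (strain Omega v) + ipmx leb Omega (mxdiv Omega S) v.

Definition ntrace (q : V -> V) (phi : V -> R) : R :=
  ipmx leb Omega q (grad Omega phi) + ip leb Omega (wdiv Omega q) phi.

Definition adjoint_solution (f : R -> V -> V) (p : R -> V -> V)
    (xi : R -> V -> R) : Prop :=
  exists (dp ddp : R -> V -> V) (dxi : R -> V -> R),
    C2T T L2rho_space p dp ddp /\
    C1T T H1D_space p dp /\
    C1T T H1_space xi dxi /\
    zero_in_Omega (p T) /\ zero_in_Omega (dp T) /\
    forall t, I t ->
      let sigma := stress (p t) (xi t) in
      let d := elec_disp (p t) (xi t) in
      mxHdiv Omega sigma /\ Hdiv Omega d /\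
      {ae leb, forall x, Omega x ->
        rho x *: ddp t x = mxdiv Omega sigma x + rho x *: f t x} /\
      zero_in_Omega (wdiv Omega d) /\
      {ae surface n, forall x, GammaD P x -> vtrace (p t) x = 0} /\
      (forall v, member H1D_space v -> ntrace_N sigma v = 0) /\
      gauge P (xi t) = 0 /\
      (forall phi, H1 Omega phi -> ntrace d phi = 0).

(* Q f is the trace of the potential xi of the unique adjoint solution. *)
Definition adjoint_operator (Q : (R -> V -> V) -> R -> V -> R) : Prop :=
  forall f, Uspace f -> exists p xi, adjoint_solution f p xi /\
    (forall t, I t -> {ae surface n, forall x, Gamma x ->
       Q f t x = trace P (xi t) x}) /\
    forall p' xi', adjoint_solution f p' xi' -> forall t, I t ->
      zero_in_Omega (p' t - p t) /\ zero_in_Omega (xi' t - xi t).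

Definition cost (S : (R -> V -> R) -> R -> V -> V) (ud : R -> V -> V)
    (alpha : R) (z : R -> V -> R) : R :=
  2^-1 * (\int[@lebesgue_measure R]_(t in I) norm_rho (S z t - ud t) ^+ 2)
  + alpha / 2 * (\int[@lebesgue_measure R]_(t in I) norm_Gamma (zdot z t) ^+ 2).

End problem.
Arguments data : clear implicits.

(* Main.v *)
(* The solution operator S is linear, so the cost is a quadratic polynomial in
   the step h and its derivative at 0 is the coefficient of h, namely the
   integral of (Sz - ud, Sy)_rho plus alpha times that of (zdot, ydot)_Gamma.
   Write f = Sz - ud, (u, psi) for the state with data y and (p, xi) for the
   adjoint solution with source f.  Testing the state equation with (p, - xi)
   and the adjoint equation with (u, psi), and using the symmetry of the
   material law, gives at each time
     (f, u)_rho = <gamma xi, y>_Gamma + (p'', u)_rho - <u'', p>_rho.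
   The last two terms are the derivative of (p', u)_rho - (u', p)_rho, which
   vanishes at 0 by the initial conditions of u and at T by the final
   conditions of p. *)

(* Weak gradients, divergences and [zdot] are choices among almost everywhere equal representatives,
   so their linearity holds almost everywhere only, through uniqueness of weak derivatives. This
   calls for fundamental lemmas in space and in time, and the one in space first needs open sets to
   be measurable for a Lebesgue measure built from an outer measure. Linearity of [S] has a similar
   source: a combination of solutions solves the combined equation, and uniqueness identifies it
   with the value of [S]. The integration by parts in time does not fit into one Hilbert space. The
   acceleration [u''] is only a functional on [H^1_D], so [(u', p)_rho] is differentiated as a
   duality product, [p] being C^1 with values in [H^1_D], while [(p', u)_rho] is differentiated in
   [L^2_rho], where [p''] lives. Hence the calculus in time is developed for bounded bilinear
   pairings of two spaces. These remain seminormed, because functions equal almost everywhere are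
   not identified. *)
Require Import Defs.
From mathcomp Require Import all_boot all_order all_algebra.
From mathcomp Require Import all_classical all_reals all_analysis.
From mathcomp Require Import measurable_realfun.
From mathcomp Require Import ring lra zify.

Set Implicit Arguments.
Unset Strict Implicit.
Unset Printing Implicit Defensive.
Import Order.TTheory GRing.Theory Num.Theory.
Import numFieldNormedType.Exports.
Local Open Scope classical_set_scope.
Local Open Scope ring_scope.

(** * Measurability of open sets *)

Section caratheodory_levels.
Context {R : realType} {T : Type}.
Variable mu : {outer_measure set T -> \bar R}.
Local Open Scope ereal_scope.

(* Caratheodory's criterion for metric outer measures, with the level sets of a
   single function in place of the distance to a closed set. *)
Lemma caratheodory_sublevel (f : T -> R) (c : R) :
  (forall (A B : set T) (a b : R), (a < b)%R ->
     (forall x, A x -> (f x <= a)%R) -> (forall x, B x -> (b <= f x)%R) ->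
     mu A + mu B <= mu (A `|` B)) ->
  mu.-caratheodory [set x | (f x <= c)%R].
Proof.
move=> muD; set H := [set x | _].
apply: le_caratheodory_measurable => X.
have [Xoo|Xfin] := eqVneq (mu X) +oo; first by rewrite Xoo leey.
pose l (k : nat) : R := (c + k.+1%:R^-1)%R.
have lS k : (l k.+1 < l k)%R by rewrite ltrD2l ltf_pV2 ?posrE// ltr_nat.
have lc k : (c < l k)%R by rewrite ltrDl invr_gt0.
pose Xk k := X `&` [set x | (l k <= f x)%R].
pose Rk k := X `&` [set x | (l k.+2 <= f x < l k.+1)%R].
have Xk_mu k : mu (Xk k) <= mu X by apply: le_outer_measure; apply: subIsetl.
have HXk k : mu (X `&` H) + mu (Xk k) <= mu X.
  apply: (le_trans (muD _ _ c (l k) (lc k) _ _)).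
  - by move=> x [].
  - by move=> x [].
  - by apply: le_outer_measure => x [[]|[]].
(* The shell [Rk k] lies below level [l k.+1] and [Xk k] above level [l k], so a gap separates them
   and the hypothesis applies. The index on the right grows by two: neighbouring shells are not
   separated, and the induction below treats even and odd shells together, with total mass at most
   [mu X + mu X]. *)
have Rk_mu k : mu (Rk k) + mu (Xk k) <= mu (Xk k.+2).
  apply: (le_trans (muD _ _ (l k.+1) (l k) (lS k) _ _)).
  - by move=> x [_ /andP[_ /ltW]].
  - by move=> x [].
  - apply: le_outer_measure => x [[Xx /andP[h _]]//|[Xx h]]; split => //=.
    by apply: le_trans h; apply: ltW; apply: lt_trans (lS _).
have sumR N : \sum_(0 <= k < N) mu (Rk k) <= mu (Xk N) + mu (Xk N.+1).
  elim: N => [|N ih].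
    by rewrite big_geq// adde_ge0// outer_measure_ge0.
  rewrite big_nat_recr//= (le_trans (leeD2r _ ih))// -addeA addeC -addeA.
  by rewrite leeD2l.
have sumRoo : \sum_(0 <= k <oo) mu (Rk k) < +oo.
  apply: (@le_lt_trans _ _ (mu X + mu X)).
    apply: lime_le; first by apply: is_cvg_nneseries => *; exact: outer_measure_ge0.
    by apply: nearW => N; rewrite (le_trans (sumR N))// leeD.
  by apply: lte_add_pinfty; rewrite ltey.
(* Outside [H] a point has [f x > c]: either it reaches level [l k.+1], or it lies in a shell of
   index at least [k]. The shells have a finite total, so their tail is negligible for large [k]. *)
have XH k : mu (X `&` ~` H) <= mu (Xk k.+1) + \sum_(k <= j <oo) mu (Rk j).
  have : X `&` ~` H `<=` Xk k.+1 `|` \bigcup_j Rk (j + k)%N.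
    move=> x [Xx /= /negP]; rewrite -ltNge => cfx.
    have [h|h] := leP (l k.+1) (f x); first by left; split.
    right.
    have ex : exists j, (l j.+2 <= f x)%R.
      have fc : (0 < f x - c)%R by rewrite subr_gt0.
      have [j jP] := ltr_add_invr cfx.
      exists j; rewrite (le_trans _ (ltW jP))// lerD2l lef_pV2 ?posrE//.
      by rewrite ler_nat; lia.
    pose j := ex_minn ex.
    have [lj jmin] : (l j.+2 <= f x)%R /\ forall i, (l i.+2 <= f x)%R -> (j <= i)%N.
      by rewrite /j; case: ex_minnP.
    have ljlt : (f x < l j.+1)%R.
      case: (j) lj jmin => [_ _|j' _ jmin].
        apply: lt_le_trans h _.
        by rewrite lerD2l lef_pV2 ?posrE// ler_nat.
      by rewrite ltNge; apply/negP => /jmin; rewrite ltnn.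
    have kj : (k <= j)%N.
      rewrite leqNgt; apply/negP => jk.
      have : (l k.+1 <= l j.+2)%R by rewrite lerD2l lef_pV2 ?posrE// ler_nat.
      by move=> /le_trans/(_ lj); rewrite leNgt h.
    by exists (j - k)%N => //; rewrite subnK//; split => //=; rewrite lj ljlt.
  move=> /(le_outer_measure mu) /le_trans; apply.
  apply: (le_trans (outer_measureU2 _ _ _)); rewrite leeD2l//.
  apply: (le_trans (outer_measure_sigma_subadditive mu _)).
  rewrite (nneseries_addn (f := fun j => mu (Rk j)))// => j.
exact: outer_measure_ge0.
have tail0 := nneseries_tail_cvg sumRoo (fun k _ => outer_measure_ge0 mu (Rk k)).
apply/lee_addgt0Pr => e e0.
have [k kP] : exists k, \sum_(k <= j <oo) mu (Rk j) <= e%:E.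
  move/fine_cvgP : tail0 => [fin /cvgrPdist_le /(_ _ e0) near_e].
  have [k _ /(_ k (leqnn _))[h1 /=]] := filterI fin near_e.
  rewrite sub0r normrN => h2; exists k.
  rewrite -(fineK h1) lee_fin; exact: le_trans (ler_norm _) h2.
apply: (@le_trans _ _ (mu (X `&` H) + (mu (Xk k.+1) + e%:E))).
  by rewrite leeD2l// (le_trans (XH k))// leeD2l.
by rewrite addeA leeD2r.
Qed.

End caratheodory_levels.

Section halfspaces.
Context {R : realType} {d : nat}.
Local Notation V := 'rV[R]_d.

Lemma box_gauge_mono : {homo @box_gauge R d : A B / A `<=` B >-> (A <= B)%E}.
Proof.
move=> A B AB; rewrite /box_gauge; case: ifPn => [_|A0].
  by have := box_gauge_ge0 B; rewrite /box_gauge.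
rewrite ifF; last first.
  by apply/negbTE/set0P; have /set0P[x /AB] := A0; exists x.
apply/ereal_inf_le_tmp => _ [ab Bab <-].
by exists ab => //=; exact: subset_trans Bab.
Qed.

(** The hyperplane cuts a bounding box of [U] into two boxes; their sides in direction [i] add up to
    the old one and all other sides are unchanged. *)
Lemma box_gauge_halfspace (i : 'I_d) (c : R) (U : set V) :
  (box_gauge (U `&` [set x | x 0 i <= c]%R) +
   box_gauge (U `&` ~` [set x | x 0 i <= c]%R) <= box_gauge U)%E.
Proof.
pose H : set V := [set x | x 0 i <= c].
rewrite -/H; have [UH0|/set0P UH] := eqVneq (U `&` H) set0.
  by rewrite UH0 box_gauge0 add0e; apply: box_gauge_mono; apply: subIsetl.
have [UH0|/set0P UCH] := eqVneq (U `&` ~` H) set0.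
  by rewrite UH0 box_gauge0 adde0; apply: box_gauge_mono; apply: subIsetl.
have [x [Ux Hx]] := UH; have [y [Uy Hy]] := UCH.
rewrite /= in Hx; have {}Hy : c < y 0 i by rewrite ltNge; apply/negP.
rewrite [leRHS]/box_gauge ifF; last by apply/negbTE/set0P; exists x.
apply: le_ereal_inf_tmp => _ [[a b] /= Uab <-].
have := Uab _ Ux i; have := Uab _ Uy i => /andP[ay yb] /andP[ax xb].
pose b' : V := \row_j if j == i then c else b 0 j.
pose a' : V := \row_j if j == i then c else a 0 j.
apply: (@le_trans _ _ ((\prod_j (b' 0 j - a 0 j))%:E +
                        (\prod_j (b 0 j - a' 0 j))%:E)%E).
  apply: leeD; rewrite /box_gauge ifF ?(introF set0P _)//; try exact/negbTE/set0P.
    apply: ereal_inf_lbound; exists (a, b') => //= z [Uz Hz] j.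
    by have /andP[-> +] := Uab _ Uz j; rewrite mxE; case: eqP => [->|].
  apply: ereal_inf_lbound; exists (a', b) => //= z [Uz Hz] j.
  have /andP[+ ->] := Uab _ Uz j; rewrite mxE; case: eqP => [-> _|_ ->//].
  by rewrite andbT ltW// ltNge; apply/negP.
rewrite -EFinD lee_fin (bigD1 i)//= [X in _ + X <= _](bigD1 i)//=.
rewrite [leRHS](bigD1 i)//= !mxE eqxx.
rewrite (eq_bigr (fun j => b 0 j - a 0 j)); last first.
  by move=> j /negbTE ji; rewrite mxE ji.
rewrite [X in _ + _ * X](eq_bigr (fun j => b 0 j - a 0 j)); last first.
  by move=> j /negbTE ji; rewrite mxE ji.
by rewrite -mulrDl; rewrite le_eqVlt; apply/orP; left; apply/eqP; congr (_ * _); ring.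
Qed.

Lemma leb_measurable_halfspace (i : 'I_d) (c : R) :
  (@leb_outer_measure R d).-caratheodory [set x | x 0 i <= c].
Proof.
apply: le_caratheodory_measurable => X; set H := [set x | _].
apply: le_ereal_inf_tmp => _ [F XF <-].
apply: (@le_trans _ _ (\sum_(k <oo) box_gauge (F k `&` H) +
                       \sum_(k <oo) box_gauge (F k `&` ~` H))%E).
  apply: leeD; apply: gauge_outer_le => x [/XF[k _ Fx] Hx];
    by exists k => //; split.
rewrite -nneseriesD//; try by move=> *; exact: box_gauge_ge0.
apply: lee_nneseries => [k _ _|k _]; last exact: box_gauge_halfspace.
by rewrite adde_ge0// box_gauge_ge0.
Qed.

Lemma frob_ge0 m p (A : 'M[R]_(m, p)) : 0 <= frob A A.
Proof. by apply: sumr_ge0 => i _; apply: sumr_ge0 => j _; exact: sqr_ge0. Qed.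

Lemma coord_le_enorm (x : V) i : `|x 0 i| <= enorm x.
Proof.
rewrite /enorm -sqrtr_sqr ler_wsqrtr// /frob big_ord1 expr2 (bigD1 i)//=.
by rewrite lerDl sumr_ge0// => j _; exact: sqr_ge0.
Qed.

(** Two sets separated by a gap in one coordinate are at positive Euclidean distance, and covers
    finer than the gap split into a cover of each. This is the hypothesis of [caratheodory_sublevel]
    for a coordinate function. *)
Lemma hausdorff_measurable_halfspace s (i : 'I_d) (c : R) :
  (@hausdorff_outer_measure R d s).-caratheodory [set x | x 0 i <= c].
Proof.
apply: (@caratheodory_sublevel _ _ _ (fun x : V => x 0 i)).
move=> A B a b ab Aa Bb.
have g_add delta : (0 < delta)%R -> delta < b - a ->
   (gauge_outer (hausdorff_gauge s delta) A +
    gauge_outer (hausdorff_gauge s delta) B <= hausdorff_outer s (A `|` B))%E.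
  move=> delta0 deltaab; set g := hausdorff_gauge s delta.
  apply: (@le_trans _ _ (gauge_outer g (A `|` B))); last first.
    by apply: ereal_sup_ubound; exists delta.
  apply: le_ereal_inf_tmp => _ [F ABF <-].
  (* The sets of the cover that miss [A], or miss [B], are emptied. No cost is counted twice: a set
     that meets both has diameter at least [b - a], hence greater than [delta], and its gauge is
     infinite. *)
  pose FA k := if `[< exists2 x, F k x & A x >] then F k else set0.
  pose FB k := if `[< exists2 x, F k x & B x >] then F k else set0.
  have g0 U : (0 <= g U)%E by exact: hausdorff_gauge_ge0.
  apply: (@le_trans _ _ (\sum_(k <oo) g (FA k) + \sum_(k <oo) g (FB k))%E).
    apply: leeD; apply: gauge_outer_le => x ABx.
      have [k _ Fx] := ABF _ (or_introl ABx); exists k => //.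
      by rewrite /FA asboolT//; exists x.
    have [k _ Fx] := ABF _ (or_intror ABx); exists k => //.
    by rewrite /FB asboolT//; exists x.
  rewrite -nneseriesD//; apply: lee_nneseries => [k _ _|k _].
    by rewrite adde_ge0.
  rewrite /FA /FB; case: asboolP => [[x Fx Ax]|_]; last first.
    by rewrite /g hausdorff_gauge0 add0e; case: asboolP => // _; rewrite hausdorff_gauge0 g0.
  case: asboolP => [[y Fy By]|_]; last by rewrite /g hausdorff_gauge0 adde0.
  suff -> : g (F k) = +oo%E by rewrite leey.
  rewrite /g /hausdorff_gauge ifF; last by apply/negbTE/set0P; exists x.
  rewrite ifF//; apply/negbTE; rewrite -ltNge.
  apply: (@lt_le_trans _ _ (enorm (y - x))%:E); last first.
    by apply: ereal_sup_ubound; exists (y, x).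
  rewrite lte_fin (lt_le_trans deltaab)// (le_trans _ (coord_le_enorm _ i))//.
  rewrite !mxE (le_trans _ (ler_norm _))//.
  by have := Aa _ Ax; have := Bb _ By; lra.
have go_anti (C : set V) (e1 e2 : R) : 0 < e1 -> e1 <= e2 ->
    (gauge_outer (hausdorff_gauge s e2) C <=
     gauge_outer (hausdorff_gauge s e1) C)%E.
  move=> e10 e12; apply: le_ereal_inf_tmp => _ [F CF <-].
  apply: (le_trans (gauge_outer_le _ CF)).
  apply: lee_nneseries => [k _ _|k _]; first exact: hausdorff_gauge_ge0.
  rewrite /hausdorff_gauge; case: ifPn => // F0.
  case: ifPn => [d2|d2]; case: ifPn => // d1; rewrite ?leey//.
  by case/negP: d2; rewrite (le_trans d1)// lee_fin.
(* The premeasures grow as [delta] decreases, so the supremum may be restricted to sizes below the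
   gap. *)
have h_le (C : set V) (M : \bar R) : (forall delta : R, (0 < delta)%R -> (delta < b - a)%R ->
     gauge_outer (hausdorff_gauge s delta) C <= M)%E -> (hausdorff_outer s C <= M)%E.
  move=> hM; apply: ge_ereal_sup => _ [delta /= delta0 <-].
  pose e := Num.min delta ((b - a) / 2).
  have ba : 0 < b - a by rewrite subr_gt0.
  have e0 : 0 < e by rewrite lt_min delta0 divr_gt0.
  apply: (le_trans (go_anti _ e _ e0 _)); first by rewrite ge_min lexx.
  by apply: hM => //; rewrite gt_min; apply/orP; right; lra.
have [ABoo|ABfin] := eqVneq (hausdorff_outer s (A `|` B)) +oo%E.
  by rewrite [X in (_ <= X)%E](_ : _ = +oo%E) ?leey.
have fin (C : set V) : C `<=` A `|` B -> hausdorff_outer s C \is a fin_num.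
  move=> CAB; rewrite ge0_fin_numE; last exact: hausdorff_outer_ge0.
  by rewrite (le_lt_trans (hausdorff_outer_mono _ CAB))// ltey.
have finA := fin A (@subsetUl _ _ _); have finB := fin B (@subsetUr _ _ _).
have finAB := fin _ (@subset_refl _ (A `|` B)).
have gfin (C : set V) delta : 0 < delta -> hausdorff_outer s C \is a fin_num ->
   gauge_outer (hausdorff_gauge s delta) C \is a fin_num.
  move=> delta0 finC; rewrite ge0_fin_numE; last exact/gauge_outer_ge0/hausdorff_gauge_ge0.
  apply: le_lt_trans (_ : hausdorff_outer s C < +oo)%E.
    by apply: ereal_sup_ubound; exists delta.
  by rewrite ltey_eq finC.
change (hausdorff_outer s A + hausdorff_outer s B <= hausdorff_outer s (A `|` B))%E.
rewrite addeC -leeBrDr//; apply: (h_le) => e2 e20 e2ab.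
rewrite leeBrDr// addeC -leeBrDr ?gfin//; apply: (h_le) => e1 e10 e1ab.
rewrite leeBrDr ?gfin//.
(* The suprema for [A] and [B] are bounded with independent sizes; passing to the smaller one
   increases both terms and allows a single use of [g_add]. *)
pose e := Num.min e1 e2.
have e0 : 0 < e by rewrite lt_min e10.
apply: (le_trans _ (g_add e e0 _)); last by rewrite gt_min e1ab.
by apply: leeD; apply: go_anti => //; rewrite ge_min lexx ?orbT.
Qed.

End halfspaces.

Section open_sets.
Context {R : realType} {d : nat}.
Local Notation V := 'rV[R]_d.

Definition open_box (a b : V) : set V :=
  [set x | forall i, a 0 i < x 0 i < b 0 i].

Definition rat_rV (a : 'rV[rat]_d) : V := map_mx ratr a.

(** Rational corners keep the family of boxes countable. The closed box inside [U] leaves room for a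
    bump function with compact support in [U]. *)
Lemma open_rat_box (U : set V) (x : V) : open U -> U x ->
  exists a b : 'rV[rat]_d, open_box (rat_rV a) (rat_rV b) x /\
                           box (rat_rV a) (rat_rV b) `<=` U.
Proof.
move=> oU Ux; have /nbhs_ballP[e /= e0 xeU] : nbhs x U by exact: open_nbhs_nbhs.
have lo (i : 'I_d) : exists q : rat, ratr q \in `](x 0 i - e), (x 0 i)[.
  by apply: rat_in_itvoo; rewrite ltrBlDr ltrDl.
have hi (i : 'I_d) : exists q : rat, ratr q \in `](x 0 i), (x 0 i + e)[.
  by apply: rat_in_itvoo; rewrite ltrDl.
have [a aP] := choice lo; have [b bP] := choice hi.
exists (\row_i a i), (\row_i b i); split => [i|y yab].
  rewrite !mxE; have := aP i; have := bP i; rewrite !in_itv/=.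
  by move=> /andP[-> _] /andP[_ ->].
apply: xeU; split => // i j; rewrite ord1.
have := yab j; have := aP j; have := bP j; rewrite !in_itv/= !mxE.
by rewrite /ball/= ltr_norml => /andP[? ?] /andP[? ?] /andP[? ?]; lra.
Qed.

Variable mu : {outer_measure set V -> \bar R}.
Hypothesis mu_halfspace :
  forall i c, mu.-caratheodory [set x : V | x 0 i <= c].
Local Notation mT := (caratheodory_type mu).

Lemma measurable_coord (i : 'I_d) :
  measurable_fun setT (fun x : mT => (x : V) 0 i : R).
Proof.
move=> mT0; apply: (measurability _ (RGenOInfty.measurableE R)) => // _ [_ [c ->] <-].
rewrite setTI; have -> : (fun x : mT => (x : V) 0 i) @^-1` `]c, +oo[%classic =
   ~` [set x : V | x 0 i <= c] :> set V.
  apply/seteqP; split=> y /=; rewrite in_itv/= andbT; first by rewrite leNgt => ->.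
  by move=> /negP; rewrite -ltNge.
by apply: measurableC; exact: mu_halfspace.
Qed.

Lemma measurable_open_box (a b : V) : measurable (open_box a b : set mT).
Proof.
have -> : open_box a b = \bigcap_(i in [set: 'I_d])
    ((fun x : mT => (x : V) 0 i) @^-1` `](a 0 i), (b 0 i)[).
  apply/seteqP; split => [x abx i _|x abx i]; first by rewrite /= in_itv/= abx.
  by have := abx i Logic.I; rewrite /= in_itv.
apply: fin_bigcap_measurable => //= i _.
rewrite -[X in measurable X]setTI; apply: measurable_coord => //.
Qed.

Lemma measurable_box (a b : V) : measurable (box a b : set mT).
Proof.
have -> : box a b = \bigcap_(i in [set: 'I_d])
    ((fun x : mT => (x : V) 0 i) @^-1` `[(a 0 i), (b 0 i)]).
  apply/seteqP; split => [x abx i _|x abx i]; first by rewrite /= in_itv/= abx.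
  by have := abx i Logic.I; rewrite /= in_itv.
apply: fin_bigcap_measurable => //= i _.
rewrite -[X in measurable X]setTI; apply: measurable_coord => //.
Qed.

Lemma measurable_open (U : set V) : open U -> measurable (U : set mT).
Proof.
move=> oU; pose F (ab : 'rV[rat]_d * 'rV[rat]_d) : set V :=
  if `[< box (rat_rV ab.1) (rat_rV ab.2) `<=` U >]
  then open_box (rat_rV ab.1) (rat_rV ab.2) else set0.
have -> : U = \bigcup_ab F ab.
  apply/seteqP; split=> x.
    move=> /(open_rat_box oU)[a [b [abx abU]]].
    by exists (a, b) => //; rewrite /F asboolT.
  move=> [[a b] _]; rewrite /F; case: asboolP => // abU abx; apply: abU => i.
  by have /andP[/ltW -> /ltW ->] := abx i.
apply: countable_bigcupT_measurable; first exact: countableP.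
move=> ab; rewrite /F; case: asboolP => _ //; exact: measurable_open_box.
Qed.

Lemma measurable_closed (C : set V) : closed C -> measurable (C : set mT).
Proof.
move=> cC; rewrite -[C]setCK; apply: measurableC.
by apply: measurable_open; exact: closed_openC.
Qed.

End open_sets.

Lemma leb_measurable_open {R : realType} {d : nat} (U : set 'rV[R]_d) :
  open U -> measurable (U : set (caratheodory_type leb_outer_measure)).
Proof. by apply: measurable_open; exact: leb_measurable_halfspace. Qed.

Lemma measurable_bdry {R : realType} {n : nat} (U : set 'rV[R]_n.+1) :
  measurable (bdry U :
    set (caratheodory_type (@hausdorff_outer_measure R n.+1 n))).
Proof.
apply: measurable_closed.
  by move=> i c; exact: hausdorff_measurable_halfspace.
rewrite /bdry setDE; apply: closedI; first exact: closed_closure.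
by apply: open_closedC; exact: open_interior.
Qed.

(** * Square integrable functions and pairings *)

Section almost_everywhere_rules.
Context {R : realType} {disp : measure_display} {T : measurableType disp}.
Variable mu : {measure set T -> \bar R}.

Lemma aeS (P Q : T -> Prop) : (forall x, P x -> Q x) ->
  {ae mu, forall x, P x} -> {ae mu, forall x, Q x}.
Proof. by move=> PQ; apply: filterS. Qed.

Lemma aeS2 (P P' Q : T -> Prop) : (forall x, P x -> P' x -> Q x) ->
  {ae mu, forall x, P x} -> {ae mu, forall x, P' x} -> {ae mu, forall x, Q x}.
Proof. by move=> PQ; apply: filterS2. Qed.

Lemma aeS3 (P P' P'' Q : T -> Prop) : (forall x, P x -> P' x -> P'' x -> Q x) ->
  {ae mu, forall x, P x} -> {ae mu, forall x, P' x} -> {ae mu, forall x, P'' x} ->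
  {ae mu, forall x, Q x}.
Proof. by move=> PQ; apply: filterS3. Qed.

Lemma ae_forall_fin (I : finType) (P : I -> T -> Prop) :
  (forall i, {ae mu, forall x, P i x}) -> {ae mu, forall x, forall i, P i x}.
Proof.
move=> aeP; have : {ae mu, forall x (k : nat) i, pickle i = k -> P i x}.
  apply: ae_foralln => k.
  have [[i ik]|nk] := pselect (exists i : I, pickle i = k); last first.
    by apply: aeW => x i ik; case: nk; exists i.
  move: ik => <-; apply: aeS (aeP i) => x Pix j /(pcan_inj (@pickleK I)) ->.
  exact: Pix.
by apply: aeS => x h i; exact: h.
Qed.

End almost_everywhere_rules.

Section real_integrable.
Context {R : realType} {disp : measure_display} {T : measurableType disp}.
Variables (mu : {measure set T -> \bar R}) (D : set T).
Hypothesis mD : measurable D.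
Local Notation intg f := (mu.-integrable D (EFin \o f)).

Lemma intgD (f g : T -> R) : intg f -> intg g -> intg (fun x => f x + g x).
Proof. by move=> intf intg; have := integrableD mD intf intg. Qed.

Lemma intgZ (c : R) (f : T -> R) : intg f -> intg (fun x => c * f x).
Proof. by move=> intf; have := integrableZl mD c intf. Qed.

Lemma intgB (f g : T -> R) : intg f -> intg g -> intg (fun x => f x - g x).
Proof. by move=> intf intg; have := integrableB mD intf intg. Qed.

Lemma Rintegral_ae_ge0 (f : T -> R) : measurable_fun D f ->
  {ae mu, forall x, D x -> 0 <= f x} -> 0 <= \int[mu]_(x in D) f x.
Proof.
move=> mf f0; rewrite /Rintegral (@ae_eq_integral _ _ _ mu D (fun x => `|f x|%:E))//.
- by apply: fine_ge0; apply: integral_ge0.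
- exact/measurable_EFinP.
- by apply/measurable_EFinP; exact: measurableT_comp.
- by apply: filterS f0 => x /[apply] fx0; rewrite ger0_norm.
Qed.

Lemma ae_eq_Rintegral (f g : T -> R) : measurable_fun D f -> measurable_fun D g ->
  {ae mu, forall x, D x -> f x = g x} ->
  \int[mu]_(x in D) f x = \int[mu]_(x in D) g x.
Proof.
move=> mf mg fg; congr fine; apply: ae_eq_integral => //; try exact/measurable_EFinP.
by apply: filterS fg => x /[apply] ->.
Qed.

End real_integrable.

Section square_integrable.
Context {R : realType} {disp : measure_display} {T : measurableType disp}.
Variables (mu : {measure set T -> \bar R}) (D : set T).
Hypothesis mD : measurable D.
Local Notation L2 := (L2 mu D).
Local Notation ip := (ip mu D).
Local Notation intg f := (mu.-integrable D (EFin \o f)).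

Lemma L2_sqr_integrable (f : T -> R) : L2 f -> intg (fun x => f x ^+ 2).
Proof.
move=> [mf foo]; apply/integrableP; split.
  by apply/measurable_EFinP; exact: measurable_funX.
rewrite (eq_integral (fun x => ((f x) ^+ 2)%:E))// => x _ /=.
by rewrite ger0_norm// sqr_ge0.
Qed.

Lemma L2_mul_integrable (f g : T -> R) : L2 f -> L2 g ->
  intg (fun x => f x * g x).
Proof.
move=> Lf Lg; have mf := Lf.1; have mg := Lg.1.
apply: (@le_integrable _ _ _ mu D mD _
          (EFin \o (fun x => f x ^+ 2 + g x ^+ 2))).
- by apply/measurable_EFinP; exact: measurable_funM.
- move=> x _ /=; rewrite lee_fin [leRHS]ger0_norm ?addr_ge0 ?sqr_ge0//.
  by rewrite ler_norml; apply/andP; split; nra.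
- rewrite (_ : _ \o _ = (EFin \o (fun x => f x ^+ 2)) \+
                        (EFin \o (fun x => g x ^+ 2)))//.
  by apply: integrableD => //; exact: L2_sqr_integrable.
Qed.

Lemma L2_integrableP (f : T -> R) : measurable_fun D f ->
  intg (fun x => f x ^+ 2) -> L2 f.
Proof.
move=> mf /integrableP[_ foo]; split => //; apply: le_lt_trans foo.
rewrite le_eqVlt; apply/orP; left; apply/eqP; apply: eq_integral => x _ /=.
by rewrite ger0_norm// sqr_ge0.
Qed.

Lemma L2_lin (a : R) (f g : T -> R) : L2 f -> L2 g ->
  L2 (fun x => a * f x + g x).
Proof.
move=> Lf Lg; have mf := Lf.1; have mg := Lg.1.
have mafg : measurable_fun D (fun x => a * f x + g x).
  by apply: measurable_funD => //; exact: measurable_funM.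
apply: L2_integrableP => //.
apply: (@le_integrable _ _ _ mu D mD _
          (EFin \o (fun x => (2 * a ^+ 2) * f x ^+ 2 + 2 * g x ^+ 2))).
- by apply/measurable_EFinP; exact: measurable_funX.
- move=> x _ /=; rewrite lee_fin ger0_norm ?sqr_ge0// (le_trans _ (ler_norm _))//.
  have := sqr_ge0 (a * f x - g x); nra.
- apply: (@integrableD _ _ _ _ D mD (fun x => (2 * a ^+ 2)%:E * (f x ^+ 2)%:E)%E
                        (fun x => 2%:E * (g x ^+ 2)%:E)%E);
    by apply: integrableZl => //; exact: L2_sqr_integrable.
Qed.

Lemma L2_0 : L2 (fun=> 0).
Proof.
split; first exact: measurable_cst.
by under eq_integral do rewrite expr0n; rewrite integral0.
Qed.

Lemma L2_ae_measurable (f g : T -> R) : measurable_fun D g -> L2 f ->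
  {ae mu, forall x, D x -> f x = g x} -> L2 g.
Proof.
move=> mg [mf foo] fg; split => //; rewrite (le_lt_trans _ foo)//.
rewrite le_eqVlt; apply/orP; left; apply/eqP; apply/esym/ae_eq_integral => //.
- by apply/measurable_EFinP; exact: measurable_funX.
- by apply/measurable_EFinP; exact: measurable_funX.
- by apply: filterS fg => x /[apply] ->.
Qed.

Lemma L2_Linfty_mul (c f : T -> R) : Linfty mu D c -> L2 f ->
  L2 (fun x => c x * f x).
Proof.
move=> [mc [M cM]] Lf; have mf := Lf.1.
have mcf : measurable_fun D (fun x => c x * f x) by exact: measurable_funM.
split=> //.
apply: (@le_lt_trans _ _ (\int[mu]_(x in D) (M ^+ 2 * f x ^+ 2)%:E)%E); last first.
  under eq_integral do rewrite EFinM.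
  have /integrableP[_] := integrableZl mD (M ^+ 2) (L2_sqr_integrable Lf).
  apply: le_lt_trans; apply: ge0_le_integral => //.
  - by move=> x _; rewrite -EFinM lee_fin mulr_ge0// sqr_ge0.
  - apply: emeasurable_funM => //; apply/measurable_EFinP.
    exact: measurable_funX.
  - apply: measurableT_comp => //; apply: emeasurable_funM => //.
    by apply/measurable_EFinP; exact: measurable_funX.
  - by move=> x _ /=; rewrite -EFinM lee_fin ler_norm.
apply: ae_ge0_le_integral => //.
- by move=> x _; rewrite lee_fin sqr_ge0.
- by apply/measurable_EFinP; exact: measurable_funX.
- by move=> x _; rewrite lee_fin mulr_ge0// sqr_ge0.
- by apply/measurable_EFinP/measurable_funM => //; exact: measurable_funX.
apply: filterS cM => x /[apply] cM; rewrite lee_fin exprMn ler_wpM2r ?sqr_ge0//.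
by rewrite -(real_normK (num_real (c x))) lerXn2r ?nnegrE// (le_trans _ cM).
Qed.

Lemma ipC (f g : T -> R) : ip f g = ip g f.
Proof. by apply: eq_Rintegral => x _; rewrite mulrC. Qed.

Lemma ip_ge0 (f : T -> R) : 0 <= ip f f.
Proof. by apply: Rintegral_ge0 => x _; rewrite -expr2 sqr_ge0. Qed.

Lemma ip_lin (a : R) (f g h : T -> R) : L2 f -> L2 g -> L2 h ->
  ip (fun x => a * f x + g x) h = a * ip f h + ip g h.
Proof.
move=> Lf Lg Lh; rewrite /Defs.ip -RintegralZl//; last exact: L2_mul_integrable.
rewrite -RintegralD//; last 2 first.
- rewrite (_ : _ \o _ = fun x => a%:E * (f x * h x)%:E)%E//.
  by apply: integrableZl => //; exact: L2_mul_integrable.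
- exact: L2_mul_integrable.
by apply: eq_Rintegral => x _; rewrite mulrDl mulrA.
Qed.

Lemma ae_eq_ip (f f' g : T -> R) : L2 f -> L2 f' -> L2 g ->
  {ae mu, forall x, D x -> f x = f' x} -> ip f g = ip f' g.
Proof.
move=> Lf Lf' Lg ff'; rewrite /Defs.ip /Rintegral; congr fine.
apply: ae_eq_integral => //; try apply/measurable_EFinP/measurable_funM.
- exact: Lf.1.
- exact: Lg.1.
- exact: Lf'.1.
- exact: Lg.1.
- by apply: filterS ff' => x /[apply] ->.
Qed.

Lemma L2_sum (I : Type) (s : seq I) (f : I -> T -> R) : (forall i, L2 (f i)) ->
  L2 (fun x => \sum_(i <- s) f i x).
Proof.
move=> Lf; elim: s => [|i s ih].
  by under eq_fun do rewrite big_nil; exact: L2_0.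
have := L2_lin 1 (Lf i) ih; congr Defs.L2.
by apply/funext => x; rewrite big_cons mul1r.
Qed.

Section matrix_valued.
Context {m n : nat}.
Local Notation L2mx := (@L2mx R disp T mu D m n).
Local Notation ipmx := (@ipmx R disp T mu D m n).

Lemma L2mx_lin (a : R) (f g : T -> 'M[R]_(m, n)) : L2mx f -> L2mx g ->
  L2mx (fun x => a *: f x + g x).
Proof.
move=> Lf Lg i j; have := L2_lin a (Lf i j) (Lg i j).
by congr (Defs.L2 _ _ _); apply/funext => x; rewrite !mxE.
Qed.

Lemma L2mx_0 : L2mx (fun=> 0).
Proof.
by move=> i j; have := L2_0; congr (Defs.L2 _ _ _); apply/funext => x; rewrite mxE.
Qed.

Lemma ipmxE (f g : T -> 'M[R]_(m, n)) : L2mx f -> L2mx g ->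
  ipmx f g = \sum_i \sum_j ip (fun x => f x i j) (fun x => g x i j).
Proof.
move=> Lf Lg; rewrite /Defs.ipmx /Defs.ip /Rintegral /frob.
under eq_integral do rewrite -sumEFin.
rewrite integral_sum//; last first.
  move=> i; under eq_fun do rewrite -sumEFin.
  by apply: integrable_sum => // j _; exact: L2_mul_integrable.
rewrite -sum_fine; last first.
  move=> i _; under eq_integral do rewrite -sumEFin.
  rewrite integral_sum//; last by move=> j; exact: L2_mul_integrable.
  apply/sum_fin_numP => j _ _; apply: integrable_fin_num => //.
  exact: L2_mul_integrable.
apply: eq_bigr => i _; under eq_integral do rewrite -sumEFin.
rewrite integral_sum//; last by move=> j; exact: L2_mul_integrable.
rewrite -sum_fine// => j _; apply: integrable_fin_num => //.
exact: L2_mul_integrable.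
Qed.

Lemma frobC (A B : 'M[R]_(m, n)) : frob A B = frob B A.
Proof. by apply: eq_bigr => i _; apply: eq_bigr => j _; rewrite mulrC. Qed.

Lemma ipmxC (f g : T -> 'M[R]_(m, n)) : ipmx f g = ipmx g f.
Proof. by apply: eq_Rintegral => x _; rewrite frobC. Qed.

Lemma ipmx_ge0 (f : T -> 'M[R]_(m, n)) : 0 <= ipmx f f.
Proof. by apply: Rintegral_ge0 => x _; exact: frob_ge0. Qed.

Lemma ipmx_lin (a : R) (f g h : T -> 'M[R]_(m, n)) : L2mx f -> L2mx g -> L2mx h ->
  ipmx (fun x => a *: f x + g x) h = a * ipmx f h + ipmx g h.
Proof.
move=> Lf Lg Lh; rewrite !ipmxE//; last exact: L2mx_lin.
rewrite mulr_sumr -big_split; apply: eq_bigr => i _ /=.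
rewrite mulr_sumr -big_split; apply: eq_bigr => j _ /=.
rewrite -ip_lin//; congr (Defs.ip _ _ _); apply/funext => x; by rewrite !mxE.
Qed.

Lemma ae_eq_ipmx (f f' g : T -> 'M[R]_(m, n)) : L2mx f -> L2mx f' -> L2mx g ->
  {ae mu, forall x, D x -> f x = f' x} -> ipmx f g = ipmx f' g.
Proof.
move=> Lf Lf' Lg ff'; rewrite !ipmxE//.
apply: eq_bigr => i _; apply: eq_bigr => j _; apply: ae_eq_ip => //.
by apply: filterS ff' => x /[apply] ->.
Qed.

Lemma frob_integrable (f g : T -> 'M[R]_(m, n)) : L2mx f -> L2mx g ->
  intg (fun x => frob (f x) (g x)).
Proof.
move=> Lf Lg; rewrite /frob (_ : _ \o _ =
  fun x => (\sum_i \sum_j (f x i j * g x i j)%:E)%E); last first.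
  by apply/funext => x /=; rewrite -sumEFin; apply: eq_bigr => i _; rewrite -sumEFin.
apply: integrable_sum => // i _; apply: integrable_sum => // j _.
exact: L2_mul_integrable.
Qed.

End matrix_valued.

Section matrix_forms.
Context {m n p q : nat}.

Lemma ipmx_form_lin (a : R) (s s1 s2 w : T -> 'M[R]_(m, n)) (e e1 e2 g : T -> 'M[R]_(p, q)) :
  L2mx mu D s -> L2mx mu D s1 -> L2mx mu D s2 -> L2mx mu D w ->
  L2mx mu D e -> L2mx mu D e1 -> L2mx mu D e2 -> L2mx mu D g ->
  {ae mu, forall x, D x -> s x = a *: s1 x + s2 x} ->
  {ae mu, forall x, D x -> e x = a *: e1 x + e2 x} ->
  ipmx mu D s w - ipmx mu D e g =
  a * (ipmx mu D s1 w - ipmx mu D e1 g) + (ipmx mu D s2 w - ipmx mu D e2 g).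
Proof.
move=> Ls Ls1 Ls2 Lw Le Le1 Le2 Lg sE eE.
rewrite (ae_eq_ipmx Ls (L2mx_lin a Ls1 Ls2) Lw sE) ipmx_lin//.
by rewrite (ae_eq_ipmx Le (L2mx_lin a Le1 Le2) Lg eE) ipmx_lin//; ring.
Qed.

(** Meant for a pointwise identity that holds for the sum of two products but not for each of them,
    as happens when coupling terms move from one to the other; the integrals have to be joined
    before the integrands are compared. *)
Lemma ae_frobD_ipmx (s s' w w' : T -> 'M[R]_(m, n)) (e e' g g' : T -> 'M[R]_(p, q)) :
  L2mx mu D s -> L2mx mu D s' -> L2mx mu D w -> L2mx mu D w' ->
  L2mx mu D e -> L2mx mu D e' -> L2mx mu D g -> L2mx mu D g' ->
  {ae mu, forall x, D x -> frob (s x) (w x) + frob (e x) (g x) =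
                           frob (s' x) (w' x) + frob (e' x) (g' x)} ->
  ipmx mu D s w + ipmx mu D e g = ipmx mu D s' w' + ipmx mu D e' g'.
Proof.
move=> Ls Ls' Lw Lw' Le Le' Lg Lg' E.
have i1 := frob_integrable Ls Lw; have i2 := frob_integrable Le Lg.
have i1' := frob_integrable Ls' Lw'; have i2' := frob_integrable Le' Lg'.
rewrite /ipmx -(RintegralD mD i1 i2) -(RintegralD mD i1' i2').
apply: ae_eq_Rintegral => //; apply/measurable_EFinP.
- exact: measurable_int (intgD mD i1 i2).
- exact: measurable_int (intgD mD i1' i2').
Qed.

End matrix_forms.

End square_integrable.

(** * Seminormed spaces, semidefinite inner products and bounded pairings *)

Section seminormed_spaces.
Context {R : realType}.
Implicit Types X Y : Defs.space R.

(** The carrier consists of all functions, for most of which [nrm] has no meaning, so every law is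
    relative to [member]. *)
Record seminormed X : Prop := {
  member0 : member X 0;
  member_lin : forall (a : R) x y, member X x -> member X y -> member X (a *: x + y);
  nrm_ge0 : forall x, member X x -> 0 <= nrm x;
  nrmZ : forall (a : R) x, member X x -> nrm (a *: x) = `|a| * nrm x;
  nrmD : forall x y, member X x -> member X y -> nrm (x + y) <= nrm x + nrm y }.

Lemma memberZ X (a : R) x : seminormed X -> member X x -> member X (a *: x).
Proof. by move=> sX Xx; have := member_lin sX a Xx (member0 sX); rewrite addr0. Qed.

Lemma memberD X x y : seminormed X -> member X x -> member X y -> member X (x + y).
Proof. by move=> sX Xx Xy; have := member_lin sX 1 Xx Xy; rewrite scale1r. Qed.

Lemma memberB X x y : seminormed X -> member X x -> member X y -> member X (x - y).
Proof.
by move=> sX Xx Xy; have := member_lin sX (-1) Xy Xx; rewrite scaleN1r addrC.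
Qed.

Lemma nrm0 X : seminormed X -> nrm (0 : carrier X) = 0.
Proof.
by move=> sX; have := nrmZ sX 0 (member0 sX); rewrite scale0r normr0 mul0r.
Qed.

Lemma nrmN X x : seminormed X -> member X x -> nrm (- x) = nrm x.
Proof. by move=> sX Xx; rewrite -scaleN1r nrmZ// normrN1 mul1r. Qed.

Lemma nrmB X x y : seminormed X -> member X x -> member X y ->
  nrm (x - y) <= nrm x + nrm y.
Proof.
move=> sX Xx Xy; rewrite -[X in _ <= _ + X]nrmN//; apply: nrmD => //.
by rewrite -scaleN1r; exact: memberZ.
Qed.

Lemma ler_dist_nrm X x y : seminormed X -> member X x -> member X y ->
  `|nrm x - nrm y| <= nrm (x - y).
Proof.
move=> sX Xx Xy; have Xxy := memberB sX Xx Xy.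
have h1 := nrmD sX Xxy Xy; rewrite subrK in h1.
have h2 := nrmB sX Xx Xxy; rewrite opprB addrCA subrr addr0 in h2.
by rewrite ler_norml; apply/andP; split; lra.
Qed.

(** Two spaces are allowed so that the duality between the dual of [H^1_D] and [H^1_D] obeys the
    same calculus as the inner products. *)
Record pairing X Y (b : carrier X -> carrier Y -> R) : Prop := {
  pair_linl : forall a x x' y, member X x -> member X x' -> member Y y ->
    b (a *: x + x') y = a * b x y + b x' y;
  pair_linr : forall a x y y', member X x -> member Y y -> member Y y' ->
    b x (a *: y + y') = a * b x y + b x y';
  pair_bound : exists2 c, 0 <= c & forall x y, member X x -> member Y y ->
    `|b x y| <= c * nrm x * nrm y }.

(** Semidefinite only, since functions that vanish almost everywhere have norm zero. [seminormed] is
    derived from it for the Hilbert spaces of the problem; the dual of [H^1_D], normed by a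
    supremum, is treated directly. *)
Record inner_product X (b : carrier X -> carrier X -> R) : Prop := {
  inner0 : member X 0;
  inner_closed : forall (a : R) x y, member X x -> member X y -> member X (a *: x + y);
  inner_lin : forall a x x' y, member X x -> member X x' -> member X y ->
    b (a *: x + x') y = a * b x y + b x' y;
  innerC : forall x y, member X x -> member X y -> b x y = b y x;
  inner_ge0 : forall x, member X x -> 0 <= b x x;
  inner_nrm : forall x, nrm x = Num.sqrt (b x x) }.

Section inner_product_theory.
Variables (X : Defs.space R) (b : carrier X -> carrier X -> R).
Hypothesis bX : inner_product b.

Lemma inner_nrm2 x : member X x -> nrm x ^+ 2 = b x x.
Proof. by move=> Xx; rewrite (inner_nrm bX) sqr_sqrtr// (inner_ge0 bX). Qed.

Lemma inner_quad (t : R) x y : member X x -> member X y ->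
  b (t *: x + y) (t *: x + y) = t ^+ 2 * b x x + 2 * t * b y x + b y y.
Proof.
move=> Xx Xy; have Xtxy := inner_closed bX t Xx Xy.
rewrite (inner_lin bX)// ![b _ (t *: x + y)](innerC bX)// !(inner_lin bX)//.
by rewrite (innerC bX Xx Xy); ring.
Qed.

Lemma cauchy_schwarz x y : member X x -> member X y ->
  `|b x y| <= nrm x * nrm y.
Proof.
move=> Xx Xy; rewrite !(inner_nrm bX) -sqrtrM ?(inner_ge0 bX)//.
rewrite -sqrtr_sqr ler_wsqrtr//.
have q t : 0 <= t ^+ 2 * b x x + 2 * t * b x y + b y y.
  by rewrite (innerC bX Xx Xy) -inner_quad// (inner_ge0 bX)//; exact: (inner_closed bX).
have bx := inner_ge0 bX Xx.
have [bx0|bx0] := eqVneq (b x x) 0; last first.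
  have {}bx0 : 0 < b x x by rewrite lt_neqAle eq_sym bx0.
  (* The minimizer of the quadratic [q]. *)
  have := q (- b x y / b x x).
  have -> : (- b x y / b x x) ^+ 2 * b x x + 2 * (- b x y / b x x) * b x y + b y y =
    (b x x * b y y - b x y ^+ 2) / b x x by field; lra.
  by rewrite pmulr_lge0 ?invr_gt0// subr_ge0.
rewrite bx0 mul0r; suff -> : b x y = 0 by rewrite expr0n.
apply/eqP/contraT => bxy.
(* With [b x x = 0] the quadratic is affine in [t], and this choice of [t] would give it the value
   -1. *)
have := q (- (b y y + 1) / (2 * b x y)); rewrite bx0 mulr0 add0r.
have -> : 2 * (- (b y y + 1) / (2 * b x y)) * b x y = - (b y y + 1) by field.
lra.
Qed.

Lemma inner_seminormed : seminormed X.
Proof.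
have X0 := inner0 bX; have Xl := inner_closed bX.
have b0 y : member X y -> b 0 y = 0.
  move=> Xy; have := inner_lin bX 1 X0 X0 Xy.
  by rewrite scale1r addr0 mul1r => /eqP; rewrite eq_sym -subr_eq0 addrK => /eqP.
have XZ a x : member X x -> member X (a *: x).
  by move=> Xx; have := Xl a x 0 Xx X0; rewrite addr0.
have bZ a x y : member X x -> member X y -> b (a *: x) y = a * b x y.
  by move=> Xx Xy; have := inner_lin bX a Xx X0 Xy; rewrite addr0 b0// addr0.
split => //.
- by move=> x _; rewrite (inner_nrm bX) sqrtr_ge0.
- move=> a x Xx; rewrite !(inner_nrm bX) bZ//; last exact: XZ.
  rewrite (innerC bX) ?bZ//; last exact: XZ.
  by rewrite mulrA -expr2 sqrtrM ?sqr_ge0// sqrtr_sqr.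
- move=> x y Xx Xy; have cs := cauchy_schwarz Xx Xy.
  have nx : 0 <= nrm x by rewrite (inner_nrm bX) sqrtr_ge0.
  have ny : 0 <= nrm y by rewrite (inner_nrm bX) sqrtr_ge0.
  rewrite -ler_sqr ?nnegrE ?addr_ge0//; last by rewrite (inner_nrm bX) sqrtr_ge0.
  have Xxy : member X (x + y) by have := Xl 1 _ _ Xx Xy; rewrite scale1r.
  rewrite inner_nrm2// -[x + y]/(x + y) -{1 2}[x]scale1r inner_quad// (innerC bX Xy Xx).
  rewrite -!inner_nrm2// sqrrD; have := ler_norm (b x y); nra.
Qed.

Lemma inner_pairing : pairing b.
Proof.
split => [a x x' y|a x y y'|]; first exact: (inner_lin bX).
- move=> Xx Xy Xy'; rewrite (innerC bX)//; last exact: (inner_closed bX).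
  by rewrite (inner_lin bX)// ![b _ x](innerC bX).
- by exists 1 => // x y Xx Xy; rewrite mul1r; exact: cauchy_schwarz.
Qed.

End inner_product_theory.

Section pairing_theory.
Variables (X Y : Defs.space R) (b : carrier X -> carrier Y -> R).
Hypotheses (sX : seminormed X) (sY : seminormed Y) (bP : pairing b).

Lemma pair0l y : member Y y -> b 0 y = 0.
Proof.
move=> Yy; have := pair_linl bP 1 (member0 sX) (member0 sX) Yy.
by rewrite scale1r addr0 mul1r => /eqP; rewrite eq_sym -subr_eq0 addrK => /eqP.
Qed.

Lemma pair0r x : member X x -> b x 0 = 0.
Proof.
move=> Xx; have := pair_linr bP 1 Xx (member0 sY) (member0 sY).
by rewrite scale1r addr0 mul1r => /eqP; rewrite eq_sym -subr_eq0 addrK => /eqP.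
Qed.

Lemma pairZl a x y : member X x -> member Y y -> b (a *: x) y = a * b x y.
Proof.
by move=> Xx Yy; have := pair_linl bP a Xx (member0 sX) Yy; rewrite addr0 pair0l// addr0.
Qed.

Lemma pairZr a x y : member X x -> member Y y -> b x (a *: y) = a * b x y.
Proof.
by move=> Xx Yy; have := pair_linr bP a Xx Yy (member0 sY); rewrite addr0 pair0r// addr0.
Qed.

Lemma pairBl x x' y : member X x -> member X x' -> member Y y ->
  b (x - x') y = b x y - b x' y.
Proof.
move=> Xx Xx' Yy; rewrite addrC -scaleN1r (pair_linl bP)// mulN1r addrC //.
Qed.

Lemma pairBr x y y' : member X x -> member Y y -> member Y y' ->
  b x (y - y') = b x y - b x y'.
Proof.
move=> Xx Yy Yy'; rewrite addrC -scaleN1r (pair_linr bP)// mulN1r addrC //.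
Qed.

End pairing_theory.

End seminormed_spaces.

(** * Fundamental lemmas of the calculus of variations *)

Section vanishing_integrals.
Context {R : realType} {disp : measure_display} {T : measurableType disp}.
Variables (mu : {measure set T -> \bar R}) (v : T -> R).
Hypothesis iv : mu.-integrable setT (EFin \o v).
Local Notation vanish E := ((\int[mu]_(x in E) (v x)%:E)%E = 0%E).

(** The measurable sets over which the integrable [v] has integral zero form a Dynkin system, so the
    pi-lambda theorem applies. *)
Lemma vanish_sigma (G : set (set T)) : setI_closed G -> G `<=` measurable ->
  G setT -> (forall E, G E -> vanish E) ->
  forall E, <<s G >> E -> measurable E /\ vanish E.
Proof.
move=> GI Gm GT G0 E; rewrite -setI_closed_g_dynkin_g_sigma_algebra//.
suff : <<d G >> `<=` [set E | measurable E /\ vanish E] by exact.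
apply: smallest_sub; last by move=> A GA; split; [exact: Gm|exact: G0].
have ivS A : measurable A -> mu.-integrable A (EFin \o v).
  by move=> mA; apply: integrableS iv.
split => [|A [mA A0]|F tF FL]; first by split => //; exact: G0.
- split; first exact: measurableC.
  have : (\int[mu]_(x in A `|` ~` A) (v x)%:E)%E = 0%E by rewrite setUv G0.
  rewrite integral_setU ?A0 ?add0e//; first exact: measurableC.
    by rewrite setUv; exact: (measurable_int mu).
  by rewrite disj_set2E setICr.
- have mF k : measurable (F k) by exact: (FL k).1.
  split; first exact: bigcupT_measurable.
  rewrite integral_bigcup//; last by apply: ivS; exact: bigcupT_measurable.
  by rewrite eseries0// => k _ _; exact: (FL k).2.
Qed.

Lemma measurable_support (chi : T -> R) : measurable_fun setT chi ->
  measurable [set x | (chi x != 0)%R].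
Proof.
move=> mchi; have := mchi measurableT _ (measurableC (measurable_set1 0%R)).
rewrite setTI; congr measurable.
by apply/seteqP; split => x /= /eqP.
Qed.

(* The functions 1 - exp(- k chi) increase to the indicator of [chi != 0]. *)
Lemma vanish_support (chi : T -> R) : measurable_fun setT chi ->
  (forall x, 0 <= chi x) ->
  (forall k : nat,
     \int[mu]_x (v x * (1 - expR (- (k%:R * chi x)))) = 0) ->
  vanish [set x | (chi x != 0)%R].
Proof.
move=> mchi chi0 vchi; set E := [set x | _].
pose e (k : nat) x : R := 1 - expR (- (k%:R * chi x)).
have e01 k x : 0 <= e k x <= 1.
  rewrite subr_ge0 gerBl expR_ge0 andbT -expR0 ler_expR lerNl oppr0.
  by rewrite mulr_ge0.
have me k : measurable_fun setT (e k).
  apply: measurable_funB => //; apply: measurableT_comp => //.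
  by apply: measurableT_comp => //; exact: measurable_funM.
have mv : measurable_fun setT v by apply/measurable_EFinP/(measurable_int mu iv).
have ive k : mu.-integrable setT (EFin \o (fun x => v x * e k x)).
  apply: le_integrable iv => //.
    by apply/measurable_EFinP; exact: measurable_funM.
  move=> x _ /=; rewrite lee_fin normrM ler_piMr//.
  by have /andP[? ?] := e01 k x; rewrite ger0_norm.
have mE : measurable E.
  exact: measurable_support.
have le_e x : forall k, setT x -> (`|(v x * e k x)%:E| <= `|(v x)%:E|)%E.
  move=> k _ /=; rewrite lee_fin normrM ler_piMr//.
  by have /andP[? ?] := e01 k x; rewrite ger0_norm.
have cvg_e x : setT x ->
    (v x * e k x)%:E @[k --> \oo] --> ((EFin \o v) \_ E) x.
  move=> _; rewrite patchE; case: ifPn => [/set_mem xE|]; last first.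
    rewrite notin_setE /E /= => /negP; rewrite negbK => /eqP chix.
    rewrite /e chix; under eq_fun do rewrite mulr0 oppr0 expR0 subrr mulr0.
    exact: cvg_cst.
  apply: cvg_EFin; first exact: nearW.
  change (v x * e k x @[k --> \oo] --> v x).
  rewrite -[X in _ --> X]mulr1; apply: cvgMr; rewrite -[X in _ --> X]subr0.
  apply: cvgB; first exact: cvg_cst.
  under eq_fun do rewrite -mulrN expRM_natl.
  apply: cvg_expr; rewrite ger0_norm ?expR_ge0// -expR0 ltr_expR oppr_lt0.
  by rewrite lt_neqAle eq_sym xE/=.
have iE k : (\int[mu]_x (v x * e k x)%:E)%E = 0%E.
  by rewrite -[LHS]fineK ?(integrable_fin_num _ (ive k))//; congr EFin; exact: vchi.
have [_ _] := @dominated_convergence _ _ _ mu setT measurableT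
  (fun k => EFin \o (fun x => v x * e k x)) ((EFin \o v) \_ E)
  (abse \o (EFin \o v)) (fun k => measurable_int _ (ive k))
  ((measurable_restrictT _ mE).1 (measurable_funTS (measurable_int _ iv)))
  (aeW _ cvg_e) (integrable_abse iv) (aeW _ le_e).
rewrite (_ : [sequence _]_n = fun=> 0%E); last exact/funext.
rewrite [LHS]integral_mkcond => lim.
exact: (cvg_unique _ lim (cvg_cst _)).
Qed.

(** The set where a product is nonzero is the intersection of the sets for its factors. Closure of
    [A] under products therefore makes these sets a pi-system, and the constant 1 contributes the
    whole space. *)
Lemma vanish_support_sigma (A : set (T -> R)) :
  (forall chi, A chi -> measurable_fun setT chi /\ forall x, 0 <= chi x) ->
  A (fun=> 1) -> (forall f g, A f -> A g -> A (f \* g)) ->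
  (forall chi, A chi -> forall k : nat,
     \int[mu]_x (v x * (1 - expR (- (k%:R * chi x)))) = 0) ->
  forall E, <<s [set [set x | chi x != 0] | chi in A] >> E ->
    measurable E /\ vanish E.
Proof.
move=> A0 A1 AM Av; apply: vanish_sigma.
- move=> _ _ [f Af <-] [g Ag <-]; exists (f \* g); first exact: AM.
  apply/seteqP; split => x /=; first by rewrite mulf_eq0 negb_or => /andP[].
  by move=> [f0 g0]; rewrite mulf_neq0.
- move=> _ [f Af <-]; have [mf _] := A0 _ Af.
  exact: measurable_support.
- by exists (fun=> 1) => //; apply/seteqP; split => x //= _; exact: oner_neq0.
- by move=> _ [f Af <-]; have [mf f0] := A0 _ Af; apply: vanish_support => //; exact: Av.
Qed.

Lemma vanish_ae : (forall E, measurable E -> vanish E) ->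
  {ae mu, forall x, v x = 0}.
Proof.
move=> v0.
have : ae_eq mu setT (EFin \o v) (cst 0%E).
  apply: integral_ae_eq => // E _ mE.
  by rewrite integral_cst// mul0e; exact: v0.
by apply: filterS => x /(_ Logic.I) [].
Qed.

End vanishing_integrals.

(** * Functions of class C^1 and the elementary bump *)

Section continuously_differentiable.
Context {R : realType}.

(** One notion for the line and for row vectors, so that test functions in time and in space are
    built by the same closure rules. *)
Definition C1 {E : normedModType R} (f : E -> R) : Prop :=
  (forall x, differentiable f x) /\ forall v, continuous (fun x => 'D_v f x).

Lemma C1_continuous {E : normedModType R} (f : E -> R) : C1 f -> continuous f.
Proof. by move=> [df _] x; exact: differentiable_continuous. Qed.

Lemma C1_cst {E : normedModType R} (a : R) : C1 (fun _ : E => a).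
Proof.
split => [x|v x]; first exact: differentiable_cst.
have -> : (fun x : E => 'D_v (fun=> a) x) = fun=> 0.
  by apply/funext => y; rewrite derive_cst.
exact: cvg_cst.
Qed.

Lemma C1_D {E : normedModType R} (f g : E -> R) : C1 f -> C1 g -> C1 (f \+ g).
Proof.
move=> [df cf] [dg cg]; split => [x|v x].
  exact: (differentiableD (df x) (dg x)).
have -> : (fun x => 'D_v (f \+ g) x) = (fun x => 'D_v f x + 'D_v g x).
  by apply/funext => y; apply: deriveD; exact: diff_derivable.
by apply: cvgD; [exact: cf|exact: cg].
Qed.

Lemma C1_M {E : normedModType R} (f g : E -> R) : C1 f -> C1 g -> C1 (f \* g).
Proof.
move=> Cf Cg; have [df cf] := Cf; have [dg cg] := Cg; split => [x|v x].
  exact: (differentiableM (df x) (dg x)).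
have -> : (fun x => 'D_v (f \* g) x) = (fun x => f x * 'D_v g x + g x * 'D_v f x).
  by apply/funext => y; apply: deriveM; exact: diff_derivable.
apply: cvgD; apply: cvgM.
- exact: C1_continuous.
- exact: cg.
- exact: C1_continuous.
- exact: cf.
Qed.

Lemma C1_comp {E : normedModType R} (f : R -> R) (g : E -> R) :
  C1 f -> C1 g -> C1 (f \o g).
Proof.
move=> Cf Cg; have [df cf] := Cf; have [dg cg] := Cg; split => [x|v x].
  exact: differentiable_comp.
have -> : (fun x => 'D_v (f \o g) x) = (fun x => 'D_v g x * 'D_1 f (g x)).
  apply/funext => y; rewrite deriveE; last exact: differentiable_comp.
  by rewrite (diff_comp (dg y) (df (g y)))/= (diff1E (df (g y))) (deriveE _ (dg y)) derive1E.
apply: cvgM; first exact: cg.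
apply: (@continuous_comp _ _ _ g (fun y => 'D_1 f y)); last exact: cf.
exact: C1_continuous.
Qed.

Lemma C1_is_derive (f df : R -> R) : (forall x : R, is_derive x 1 f (df x)) ->
  continuous df -> C1 f.
Proof.
move=> dfP cdf; have fdiff x : differentiable f x by apply/derivable1_diffP.
split => // v.
have -> : (fun x => 'D_v f x) = (fun x => v * df x).
  apply/funext => x; rewrite deriveE// diff1E//; congr (_ * _).
  by rewrite derive1E; exact: derive_val.
by move=> x; apply: cvgM; [exact: cst_continuous|exact: cdf].
Qed.

(** Squaring smooths the corner of the positive part just enough for class C^1. The function is
    nonzero exactly on the positive half-line, so its translates and reflections encode half-spaces,
    and products of them encode open boxes. *)
Definition sqr_pos (s : R) : R := Num.max 0 s ^+ 2.

Lemma sqr_pos_ge0 s : 0 <= sqr_pos s. Proof. exact: sqr_ge0. Qed.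

Lemma sqr_pos_neq0 s : (sqr_pos s != 0) = (0 < s).
Proof.
rewrite sqrf_eq0; have [s0|s0] := ltP 0 s; last by rewrite eqxx.
by rewrite gt_eqF.
Qed.

Lemma is_derive_sqr_pos (s : R) : is_derive s 1 sqr_pos (2 * Num.max 0 s).
Proof.
have lim : (h^-1 *: (sqr_pos (h *: 1 + s) - sqr_pos s)) @[h --> 0^'] --> 2 * Num.max 0 s.
  apply/cvgrPdist_le => e e0; near=> h.
  have h0 : h != 0 by near: h; exact: nbhs_dnbhs_neq.
  have he : `|h| <= e.
    near: h; apply: dnbhs0_le => //.
  apply: le_trans he.
  (* The error of the linear approximation is at most the square of [h], whatever the signs of [s]
     and [h + s]; after division by [h] it is at most the absolute value of [h]. *)
  have : `|2 * Num.max 0 s * h - (sqr_pos (h * 1 + s) - sqr_pos s)| <= `|h| * `|h|.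
    rewrite -normrM -expr2 [leRHS]ger0_norm ?sqr_ge0// mulr1 /sqr_pos.
    by rewrite ler_norml; case: (ltP 0 s) => ?; case: (ltP 0 (h + s)) => ?;
      apply/andP; split; nra.
  have -> : 2 * Num.max 0 s * h - (sqr_pos (h * 1 + s) - sqr_pos s) =
    h * (2 * Num.max 0 s - h^-1 *: (sqr_pos (h *: 1 + s) - sqr_pos s)).
    by rewrite /GRing.scale/= mulrBr mulVKf// mulrC.
  by rewrite normrM ler_pM2l// normr_gt0.
split; first by apply/cvg_ex; exists (2 * Num.max 0 s).
exact/cvg_lim.
Unshelve. all: by end_near. Qed.

Lemma C1_sqr_pos : C1 sqr_pos.
Proof.
apply: C1_is_derive is_derive_sqr_pos _ => s.
apply: cvgM; first exact: cst_continuous.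
by apply: continuous_max; [exact: cst_continuous|exact: cvg_id].
Qed.

Lemma C1_coord {d : nat} (i : 'I_d) : C1 (fun x : 'rV[R]_d => x 0 i).
Proof.
split => [x|v x]; first exact: differentiable_coord.
have -> : (fun x : 'rV[R]_d => 'D_v (fun y : 'rV[R]_d => y 0 i) x) = fun=> v 0 i.
  apply/funext => y; apply/cvg_lim => //; apply: cvg_near_cst.
  near=> h; rewrite /= !mxE addrK /GRing.scale/= mulKf//.
  near: h; exact: nbhs_dnbhs_neq.
exact: cst_continuous.
Unshelve. all: by end_near. Qed.

Lemma C1_id : C1 (@id R).
Proof.
apply: (@C1_is_derive _ (fun=> 1)) => x; exact: cst_continuous.
Qed.

Lemma C1_onem_expR (k : R) : C1 (fun s : R => 1 - expR (- (k * s))).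
Proof.
have -> : (fun s : R => 1 - expR (- (k * s))) =
    (fun=> 1) \+ (fun=> -1) \* (expR \o ((fun=> - k) \* id)).
  by apply/funext => s /=; rewrite mulN1r mulNr.
apply: C1_D; first exact: C1_cst; apply: C1_M; first exact: C1_cst.
apply: C1_comp; last by apply: C1_M; [exact: C1_cst|exact: C1_id].
by apply: C1_is_derive => x; exact: continuous_expR.
Qed.

Lemma C1_gt (a : R) : C1 (fun s : R => sqr_pos (s - a)).
Proof.
apply: (C1_comp C1_sqr_pos); apply: (C1_D C1_id); exact: C1_cst.
Qed.

Lemma C1_lt (a : R) : C1 (fun s : R => sqr_pos (a - s)).
Proof.
apply: (C1_comp C1_sqr_pos).
have -> : (fun s : R => a - s) = (fun=> a) \+ (fun=> -1) \* id.
  by apply/funext => s /=; rewrite mulN1r.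
by apply: C1_D; [exact: C1_cst|apply: C1_M; [exact: C1_cst|exact: C1_id]].
Qed.

End continuously_differentiable.

(** * The fundamental lemma of the calculus of variations in space *)

Section fundamental_lemma_space.
Context {R : realType} {n : nat}.
Local Notation V := 'rV[R]_n.+1.
Local Notation mT := (caratheodory_type (@leb_outer_measure R n.+1)).

Definition boxes : set (set V) := [set box ab.1 ab.2 | ab in setT].

Lemma leb_outer_le_gauge (U : set V) : (leb_outer U <= box_gauge U)%E.
Proof.
apply: (le_trans (@gauge_outer_le _ _ _ _ (fun k => if k is 0%N then U else set0) _)).
  by move=> x Ux; exists 0%N.
rewrite nneseries_recl//; last by move=> k _; exact: box_gauge_ge0.
rewrite eseries0 ?adde0// => -[|k]// _ _; exact: box_gauge0.
Qed.

Lemma box_gauge_prod (a b : V) : box a b !=set0 ->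
  (box_gauge (box a b) <= (\prod_i (b 0 i - a 0 i))%:E)%E.
Proof.
move=> /set0P ab0; rewrite /box_gauge (negbTE ab0).
by apply: ereal_inf_lbound; exists (a, b).
Qed.

Lemma box_approx (U : set V) (e : R) : 0 < e -> box_gauge U \is a fin_num ->
  exists2 B, boxes B & U `<=` B /\ (leb_outer B <= box_gauge U + e%:E)%E.
Proof.
move=> e0 Ufin; have [U0|U0] := eqVneq U set0.
  (* Corners in the wrong order: this box is empty, because the dimension is positive. *)
  exists (box (const_mx 1) (const_mx 0)).
    by exists (const_mx 1, const_mx 0).
  split; first by rewrite U0.
  have -> : box (const_mx 1) (const_mx 0) = set0 :> set V.
    apply/seteqP; split => // x /(_ ord0); rewrite !mxE => /andP[h1 h2].
    by have := le_trans h1 h2; rewrite ler10.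
  have -> : leb_outer (set0 : set V) = 0%E by exact: (outer_measure0 leb_outer_measure).
  by rewrite adde_ge0 ?box_gauge_ge0// lee_fin ltW.
move: (Ufin); rewrite {1}/box_gauge (negbTE U0) => Ufin'.
have [_ [[a b] /= Uab <-] abe] := lb_ereal_inf_adherent e0 Ufin'.
exists (box a b); first by exists (a, b).
split => //; apply: (le_trans (leb_outer_le_gauge _)).
apply: (le_trans (box_gauge_prod _)); last by rewrite {1}/box_gauge (negbTE U0) ltW.
by have /set0P[x /Uab] := U0; exists x.
Qed.

(** Near-optimal covers can be taken to consist of boxes, and intersecting the unions of better and
    better covers loses no measure. The hull links Caratheodory measurable sets, about which test
    functions say nothing directly, to the sigma-algebra generated by boxes. *)
Lemma leb_hull (E : set V) : (leb_outer E < +oo)%E ->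
  exists2 H, <<s boxes >> H & E `<=` H /\ (leb_outer H <= leb_outer E)%E.
Proof.
move=> Eoo; have Efin : leb_outer E \is a fin_num.
  by rewrite ge0_fin_numE//; exact: (outer_measure_ge0 leb_outer_measure).
(* The factor 2: one error [k.+1%:R^-1] comes from the choice of a near-optimal cover, a second one
   from replacing its sets by boxes, with the error of the j-th set weighted by [2 ^ j.+1]. *)
have cover (k : nat) : exists H, <<s boxes >> H /\
    E `<=` H /\ (leb_outer H <= leb_outer E + (2 * k.+1%:R^-1)%:E)%E.
  have k0 : 0 < k.+1%:R^-1 :> R by rewrite invr_gt0.
  have [_ [F EF <-] Fe] := lb_ereal_inf_adherent k0 Efin.
  have sFfin : (\sum_(j <oo) box_gauge (F j) < +oo)%E.
    by apply: (lt_le_trans Fe); rewrite leey.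
  have Ffin j : box_gauge (F j) \is a fin_num.
    rewrite ge0_fin_numE ?box_gauge_ge0//; apply: le_lt_trans sFfin.
    rewrite (@nneseriesD1 _ _ j)//; last by move=> i _; exact: box_gauge_ge0.
    by rewrite leeDl// nneseries_ge0// => i _ _; exact: box_gauge_ge0.
  have ex j : exists B, boxes B /\ F j `<=` B /\
      (leb_outer B <= box_gauge (F j) + (k.+1%:R^-1 / (2 ^ j.+1)%:R)%:E)%E.
    have e0 : 0 < k.+1%:R^-1 / (2 ^ j.+1)%:R :> R.
      by rewrite divr_gt0// ltr0n expn_gt0.
    by have [B bB [FB lB]] := box_approx e0 (Ffin j); exists B.
  have [B BP] := choice ex; exists (\bigcup_j B j); split.
    change (measurable (\bigcup_j B j : set (g_sigma_algebraType boxes))).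
    apply: bigcupT_measurable => j.
    by apply: sub_sigma_algebra; exact: (BP j).1.
  split.
    by move=> x /EF[j _ Fx]; exists j => //; apply: (BP j).2.1.
  apply: (le_trans (outer_measure_sigma_subadditive leb_outer_measure B)).
  apply: (@le_trans _ _ (\sum_(j <oo) (box_gauge (F j) +
      (k.+1%:R^-1 / (2 ^ j.+1)%:R)%:E))%E).
    apply: lee_nneseries => [j _ _|j _]; last exact: (BP j).2.2.
    exact: (outer_measure_ge0 leb_outer_measure).
  apply: (le_trans (epsilon_trick _ _ (ltW k0))).
    by move=> j; exact: box_gauge_ge0.
  by rewrite mulr_natl mulr2n EFinD addeA leeD2r// ltW.
have [H HP] := choice cover; exists (\bigcap_k H k).
  change (measurable (\bigcap_k H k : set (g_sigma_algebraType boxes))).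
  by apply: bigcapT_measurable => k; exact: (HP k).1.
split; first by move=> x Ex k _; exact: (HP k).2.1.
apply/lee_addgt0Pr => e e0.
have [k ke] := ltr_add_invr (divr_gt0 e0 (ltr0Sn R 1)); rewrite add0r in ke.
apply: (@le_trans _ _ (leb_outer (H k))).
  by apply: (le_outer_measure leb_outer_measure); exact: bigcap_inf.
apply: (le_trans (HP k).2.2); rewrite leeD2l// lee_fin mulrC.
by rewrite -ler_pdivlMr// ltW.
Qed.

Lemma measurable_sigma_boxes (H : set V) : <<s boxes >> H ->
  measurable (H : set mT).
Proof.
apply: smallest_sub; first exact: sigma_algebra_measurable.
move=> _ [[a b] _ <-]; apply: measurable_box; exact: leb_measurable_halfspace.
Qed.

(** Since [v] vanishes outside a box, a measurable set may be cut down to finite measure. It then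
    differs from its hull in [<<s boxes >>] by a null set, which does not affect the integral. *)
Lemma leb_vanish_ae (v : mT -> R) (a b : V) :
  leb.-integrable setT (EFin \o v) -> (forall x, ~ box a b x -> v x = 0) ->
  (forall H, <<s boxes >> H -> (\int[leb]_(x in H) (v x)%:E)%E = 0%E) ->
  {ae leb, forall x, v x = 0}.
Proof.
move=> iv vB v0; apply: vanish_ae => // E mE.
have mB : measurable (box a b : set mT).
  by apply: measurable_box; exact: leb_measurable_halfspace.
have -> : (\int[leb]_(x in E) (v x)%:E)%E =
          (\int[leb]_(x in E `&` box a b) (v x)%:E)%E.
  rewrite integral_mkcondr; apply: eq_integral => x _; rewrite patchE.
  by case: ifPn => // /negP xB; rewrite vB// => xB'; apply: xB; rewrite inE.
set F := E `&` box a b.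
have mF : measurable (F : set mT) by exact: measurableI.
have Foo : (leb_outer F < +oo)%E.
  apply: (@le_lt_trans _ _ (leb_outer (box a b))).
    by apply: (le_outer_measure leb_outer_measure); exact: subIsetr.
  have [->|/set0P B0] := eqVneq (box a b) set0.
    by rewrite (outer_measure0 leb_outer_measure).
  apply: (le_lt_trans (leb_outer_le_gauge _)).
  by rewrite (le_lt_trans (box_gauge_prod B0))// ltry.
have [H Hb [FH HF]] := leb_hull Foo.
have mH := measurable_sigma_boxes Hb.
have mHF : measurable (H `\` F : set mT) by exact: measurableD.
have HF0 : leb (H `\` F) = 0%E.
  rewrite measureD//; last by rewrite (le_lt_trans HF).
  rewrite setIidr//; apply/eqP; rewrite eq_le; apply/andP; split.
    by rewrite leeBlDr ?add0e// ge0_fin_numE.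
  by rewrite leeBrDr ?add0e ?ge0_fin_numE//; apply: le_measure; rewrite ?inE.
have := negligible_integral mHF mH (integrableS measurableT mH (@subsetT _ _) iv) HF0.
by rewrite setDD setIidr// => <-; exact: v0.
Qed.

Lemma leb_measurable_continuous (f : V -> R) : continuous f ->
  measurable_fun setT (f : mT -> R).
Proof.
move=> /continuousP cf mT0; apply: (measurability _ (RGenOpens.measurableE R)) => //.
move=> _ [_ [a [b ->]] <-]; rewrite setTI; apply: leb_measurable_open.
by apply: cf; exact: interval_open.
Qed.

Lemma C1_prod (I : Type) (s : seq I) (f : I -> V -> R) : (forall i, C1 (f i)) ->
  C1 (fun x => \prod_(i <- s) f i x).
Proof.
move=> Cf; elim: s => [|i s ih].
  by under eq_fun do rewrite big_nil; exact: C1_cst.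
by under eq_fun do rewrite big_cons; apply: (C1_M (Cf i) ih).
Qed.

Definition box_bump (a b : V) : V -> R :=
  fun x => \prod_i (sqr_pos (x 0 i - a 0 i) * sqr_pos (b 0 i - x 0 i)).

Lemma C1_box_bump a b : C1 (box_bump a b).
Proof.
apply: C1_prod => i; apply: C1_M.
- exact: (C1_comp (C1_gt (a 0 i)) (C1_coord i)).
- exact: (C1_comp (C1_lt (b 0 i)) (C1_coord i)).
Qed.

Lemma box_bump_ge0 a b x : 0 <= box_bump a b x.
Proof. by apply: prodr_ge0 => i _; rewrite mulr_ge0// sqr_pos_ge0. Qed.

Lemma box_bump_neq0 a b x : (box_bump a b x != 0) <-> open_box a b x.
Proof.
rewrite /box_bump; split => [/prodf_neq0 h i|h].
  have := h i isT; rewrite mulf_eq0 negb_or !sqr_pos_neq0 !subr_gt0.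
  by move=> /andP[-> ->].
apply/prodf_neq0 => i _; have /andP[ax xb] := h i.
by rewrite mulf_neq0// sqr_pos_neq0 subr_gt0.
Qed.

Lemma closed_box (a b : V) : closed (box a b).
Proof.
have -> : box a b = \bigcap_(i in [set: 'I_n.+1])
    ((fun x : V => x 0 i) @^-1` `[(a 0 i), (b 0 i)]).
  apply/seteqP; split => [x abx i _|x abx i]; first by rewrite /= in_itv/= abx.
  by have := abx i Logic.I; rewrite /= in_itv.
apply: closed_bigI => i _; apply: closed_comp; last exact: interval_closed.
by move=> x _; exact: coord_continuous.
Qed.

Lemma compact_box (a b : V) : compact (box a b).
Proof.
have -> : box a b = [set x : V | forall i, `[(a 0 i), (b 0 i)]%classic (x ord0 i)].
  by apply/seteqP; split => x h i; have := h i; rewrite /= in_itv.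
by apply: (@rV_compact _ _ (fun i => `[(a 0 i), (b 0 i)]%classic)) => i; exact: segment_compact.
Qed.

(** The cutoff [1 - exp(- bump)] is nonzero exactly where the bump is, but takes values in [0, 1],
    so that multiplying by it preserves integrability. *)
Lemma test_fun_box_bump (Omega : set V) (a b : V) (phi : V -> R) :
  box a b `<=` Omega -> C1 phi ->
  test_fun Omega (fun x => (1 - expR (- box_bump a b x)) * phi x).
Proof.
move=> abO Cphi.
have C : C1 (fun x => (1 - expR (- box_bump a b x)) * phi x).
  apply: C1_M Cphi; have := C1_comp (C1_onem_expR 1) (C1_box_bump a b).
  by congr C1; apply/funext => x /=; rewrite mul1r.
have supp : closure [set x | (1 - expR (- box_bump a b x)) * phi x != 0] `<=` box a b.
  rewrite [X in _ `<=` X](closure_id _).1; last exact: closed_box.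
  apply: closureS => x /=; rewrite mulf_eq0 negb_or => /andP[+ _].
  have [->|/box_bump_neq0 abx _ i] := eqVneq (box_bump a b x) 0.
    by rewrite oppr0 expR0 subrr eqxx.
  by have /andP[/ltW -> /ltW ->] := abx i.
split.
- exact: C.1.
- by move=> i; exact: C.2.
- apply: (subclosed_compact _ (@compact_box a b)) => //; exact: closed_closure.
- exact: subset_trans supp abO.
Qed.

Lemma bounded_subset_box (Omega : set V) : bounded_set Omega ->
  exists a b : V, Omega `<=` box a b.
Proof.
move=> [M [_ hM]]; exists (const_mx (- (M + 1))), (const_mx (M + 1)) => x Ox i.
rewrite !mxE -ler_norml.
have := hM (M + 1) _ x Ox; rewrite ltrDl ltr01 => /(_ isT); apply: le_trans.
rewrite /Num.norm/= mx_normrE.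
by apply: (le_bigmax _ (fun ij : 'I_1 * 'I_n.+1 => `|x ij.1 ij.2|) (0, i)).
Qed.

Lemma leb_fin (Omega : set V) : bounded_set Omega -> (leb Omega < +oo)%E.
Proof.
move=> /bounded_subset_box[a [b Oab]].
apply: (@le_lt_trans _ _ (leb_outer (box a b))).
  exact: (le_outer_measure leb_outer_measure).
have [->|/set0P B0] := eqVneq (box a b) set0.
  by rewrite (outer_measure0 leb_outer_measure).
apply: (le_lt_trans (leb_outer_le_gauge _)).
by rewrite (le_lt_trans (box_gauge_prod B0))// ltry.
Qed.

(** The complement of a closed box is a finite union of open half-spaces, and each of them is the
    set where a shifted [sqr_pos] of a coordinate is nonzero. *)
Lemma sigma_boxes_support (H : set V) : <<s boxes >> H ->
  <<s [set [set x | chi x != 0] |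
         chi in [set chi : V -> R | C1 chi /\ forall x, 0 <= chi x]] >> H.
Proof.
set G := [set _ | _ in _].
apply: smallest_sub; first exact: smallest_sigma_algebra.
move=> _ [[a b] _ <-]; change (measurable (box a b : set (g_sigma_algebraType G))).
have -> : box a b = \bigcap_(i in [set: 'I_n.+1])
    (~` [set x | sqr_pos (a 0 i - x 0 i) != 0] `&`
     ~` [set x | sqr_pos (x 0 i - b 0 i) != 0]).
  apply/seteqP; split => [x abx i _|x abx i] /=.
    rewrite !sqr_pos_neq0 !subr_gt0; have /andP[? ?] := abx i.
    by split; apply/negP; rewrite -leNgt.
  have [] := abx i Logic.I; rewrite /= !sqr_pos_neq0 !subr_gt0.
  by move=> /negP; rewrite -leNgt => -> /negP; rewrite -leNgt => ->.
apply: fin_bigcap_measurable => // i _.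
apply: measurableI; apply: measurableC; apply: sub_sigma_algebra.
- exists (fun x => sqr_pos (a 0 i - x 0 i)) => //; split; last by move=> x; exact: sqr_pos_ge0.
  exact: (C1_comp (C1_lt (a 0 i)) (C1_coord i)).
- exists (fun x => sqr_pos (x 0 i - b 0 i)) => //; split; last by move=> x; exact: sqr_pos_ge0.
  exact: (C1_comp (C1_gt (b 0 i)) (C1_coord i)).
Qed.

Lemma L2_leb_integrable (Omega : set V) (w : mT -> R) :
  open Omega -> bounded_set Omega ->
  L2 leb Omega w -> leb.-integrable Omega (EFin \o w).
Proof.
move=> oO bO Lw; have mO := leb_measurable_open oO.
have L1 : L2 leb Omega (fun=> 1).
  split => //; under eq_integral do rewrite expr1n.
  by rewrite integral_cst// mul1e; exact: leb_fin.
have := L2_mul_integrable mO Lw L1; congr (integrable _ _ _).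
by apply/funext => x /=; rewrite mulr1.
Qed.

(** No mollification: on a box inside [Omega] the function [w] is multiplied by the cutoff of the
    box, and the product integrates to zero against every [1 - exp(- k chi)] with [chi] nonnegative
    of class C^1. By [vanish_support_sigma] it has integral zero over all sets generated by boxes.
    Countably many rational boxes cover [Omega]. *)
Lemma fundamental_lemma (Omega : set V) (w : mT -> R) :
  open Omega -> bounded_set Omega -> L2 leb Omega w ->
  (forall phi, test_fun Omega phi -> ip leb Omega w phi = 0) ->
  {ae leb, forall x, Omega x -> w x = 0}.
Proof.
move=> oO bO Lw w0; have mO := leb_measurable_open oO.
have iw := L2_leb_integrable oO bO Lw.
have [A [B OAB]] := bounded_subset_box bO.
have local_ae (a b : V) : box a b `<=` Omega ->
    {ae leb, forall x, open_box a b x -> w x = 0}.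
  move=> abO; pose t x : R := 1 - expR (- box_bump a b x).
  have t01 x : 0 <= t x <= 1.
    rewrite subr_ge0 gerBl expR_ge0 andbT -expR0 ler_expR lerNl oppr0.
    exact: box_bump_ge0.
  have mt : measurable_fun setT (t : mT -> R).
    apply: leb_measurable_continuous; apply: C1_continuous.
    have := C1_comp (C1_onem_expR 1) (C1_box_bump a b).
    by congr C1; apply/funext => x /=; rewrite mul1r.
  have iwt : leb.-integrable Omega (EFin \o (fun x => w x * t x)).
    apply: le_integrable iw => //.
      by apply/measurable_EFinP/measurable_funM; [exact: Lw.1|exact: measurable_funTS].
    move=> x _ /=; rewrite lee_fin normrM ler_piMr//.
    by have /andP[? ?] := t01 x; rewrite ger0_norm.
  pose v := (fun x => w x * t x) \_ Omega.
  have iv : leb.-integrable setT (EFin \o v).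
    by rewrite /v -restrict_EFin; apply/(integrable_mkcond _ mO).
  have : {ae leb, forall x, v x = 0}.
    apply: (@leb_vanish_ae v A B iv) => [x nx|H bH].
      by rewrite /v patchE ifF//; apply/negP => /set_mem/OAB.
    refine (proj2 (@vanish_support_sigma R _ mT leb v iv
      [set chi | C1 (chi : V -> R) /\ forall x, 0 <= chi x] _ _ _ _ H
      (sigma_boxes_support bH))).
    - move=> chi [Cchi chi0]; split => //.
      by apply: leb_measurable_continuous; exact: C1_continuous.
    - by split; [exact: C1_cst|move=> x; exact: ler01].
    - move=> f g [Cf f0] [Cg g0]; split; first exact: C1_M.
      by move=> x; rewrite mulr_ge0.
    move=> chi [Cchi chi0] k.
    (* The factor [1 - exp(- k chi)] is C^1 but need not have compact support; the cutoff already
       contained in [v] turns it into a test function. *)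
    have Ce := C1_comp (C1_onem_expR k%:R) Cchi.
    have := w0 _ (test_fun_box_bump abO Ce); rewrite /ip Rintegral_mkcond => <-.
    apply: eq_Rintegral => x _; rewrite /v !patchE; case: ifPn => _; last by rewrite mul0r.
    by rewrite -mulrA.
  apply: aeS => x vx abx; have Ox : Omega x.
    by apply: abO => i; have /andP[/ltW -> /ltW ->] := abx i.
  move: vx; rewrite /v patchE mem_set// => /eqP; rewrite mulf_eq0 => /orP[/eqP//|].
  move/box_bump_neq0 : abx => abx; rewrite subr_eq0 eq_sym -expR0 (inj_eq (@expR_inj R)) oppr_eq0.
  by rewrite (negbTE abx).
(* Quantifying over codes of pairs of rational corners merges the exceptional sets of all boxes into
   one null set. *)
have : {ae leb, forall x (k : nat), forall ab : 'rV[rat]_n.+1 * 'rV[rat]_n.+1,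
    unpickle k = Some ab -> box (rat_rV ab.1) (rat_rV ab.2) `<=` Omega ->
    open_box (rat_rV ab.1) (rat_rV ab.2) x -> w x = 0}.
  apply: ae_foralln => k; case: (unpickle k) => [ab|]; last exact: aeW.
  have [abO|abO] := pselect (box (rat_rV ab.1) (rat_rV ab.2) `<=` Omega); last first.
    by apply: aeW => x _ [<-] /abO.
  by apply: aeS (local_ae _ _ abO) => x h _ [<-] _; exact: h.
apply: aeS => x h Ox; have [a [b [abx abO]]] := open_rat_box oO Ox.
by apply: (h (pickle (a, b)) (a, b)) => //; rewrite pickleK.
Qed.

End fundamental_lemma_space.

(** * The fundamental lemma of the calculus of variations in time *)

Section fundamental_lemma_time.
Context {R : realType}.
Local Notation lam := (@lebesgue_measure R).

Lemma ae_neq (a : R) : {ae lam, forall x, x != a}.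
Proof.
exists [set a]; split; [exact: measurable_set1|exact: lebesgue_measure_set1|].
by move=> x /= /negP; rewrite negbK => /eqP.
Qed.

Definition itv_bump (a b : R) : R -> R :=
  fun x => sqr_pos (x - a) * sqr_pos (b - x).

Lemma itv_bump_ge0 a b x : 0 <= itv_bump a b x.
Proof. by rewrite mulr_ge0// sqr_pos_ge0. Qed.

Lemma itv_bump_neq0 a b x : (itv_bump a b x != 0) = (a < x < b).
Proof. by rewrite mulf_eq0 negb_or !sqr_pos_neq0 !subr_gt0. Qed.

Lemma C1_itv_bump a b : C1 (fun x => 1 - expR (- itv_bump a b x)).
Proof.
have := C1_comp (C1_onem_expR 1) (C1_M (C1_gt a) (C1_lt b)).
by congr C1; apply/funext => x /=; rewrite mul1r.
Qed.

Lemma test_time_itv_bump (T a b : R) (phi : R -> R) : 0 < a -> b < T -> C1 phi ->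
  test_time T (fun x => (1 - expR (- itv_bump a b x)) * phi x).
Proof.
move=> a0 bT Cphi; have C := C1_M (C1_itv_bump a b) Cphi.
have supp : closure [set x | (1 - expR (- itv_bump a b x)) * phi x != 0] `<=` `[a, b].
  rewrite [X in _ `<=` X](closure_id _).1; last exact: interval_closed.
  apply: closureS => x /=; rewrite mulf_eq0 negb_or => /andP[+ _].
  have [->|] := eqVneq (itv_bump a b x) 0.
    by rewrite oppr0 expR0 subrr eqxx.
  by rewrite itv_bump_neq0 in_itv/= => /andP[/ltW -> /ltW ->].
split.
- by move=> t; apply/derivable1_diffP; exact: C.1.
- by rewrite [X in continuous X](_ : _ =
      fun t => 'D_1 (fun x => (1 - expR (- itv_bump a b x)) * phi x) t);
    [exact: C.2|apply/funext => t; rewrite derive1E].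
- apply: (subclosed_compact _ (@segment_compact R a b)) => //; exact: closed_closure.
- apply: (subset_trans supp) => t; rewrite /= !in_itv/= => /andP[at_ tb].
  by rewrite (lt_le_trans a0 at_) (le_lt_trans tb bT).
Qed.

Lemma measurable_support_sigma (H : set R) : measurable H ->
  <<s [set [set x | chi x != 0] |
         chi in [set chi : R -> R | C1 chi /\ forall x, 0 <= chi x]] >> H.
Proof.
set G := [set _ | _ in _]; rewrite [measurable](RGenOInfty.measurableE R).
apply: smallest_sub; first exact: smallest_sigma_algebra.
move=> _ [a ->]; apply: sub_sigma_algebra; exists (fun x => sqr_pos (x - a)).
  by split; [exact: C1_gt|move=> x; exact: sqr_pos_ge0].
by apply/seteqP; split => x /=; rewrite in_itv/= andbT sqr_pos_neq0 subr_gt0.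
Qed.

Lemma fundamental_lemma_time (T : R) (w : R -> R) : 0 < T ->
  lam.-integrable `[0, T] (EFin \o w) ->
  (forall phi, test_time T phi -> \int[lam]_(t in `[0, T]) (w t * phi t) = 0) ->
  {ae lam, forall t, `[0, T]%classic t -> w t = 0}.
Proof.
move=> T0 iw w0; set I : set R := `[0, T]%classic; have mI : measurable I by exact: measurable_itv.
have local_ae (a b : R) : 0 < a -> b < T ->
    {ae lam, forall x, a < x < b -> w x = 0}.
  move=> a0 bT; pose t x : R := 1 - expR (- itv_bump a b x).
  have t01 x : 0 <= t x <= 1.
    rewrite subr_ge0 gerBl expR_ge0 andbT -expR0 ler_expR lerNl oppr0.
    exact: itv_bump_ge0.
  have mt : measurable_fun setT t.
    by apply: continuous_measurable_fun; apply: C1_continuous; exact: C1_itv_bump.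
  have mw : measurable_fun I w by apply/measurable_EFinP; exact: measurable_int iw.
  have iwt : lam.-integrable I (EFin \o (fun x => w x * t x)).
    apply: le_integrable iw => //.
      by apply/measurable_EFinP/measurable_funM => //; exact: measurable_funTS.
    move=> x _ /=; rewrite lee_fin normrM ler_piMr//.
    by have /andP[? ?] := t01 x; rewrite ger0_norm.
  pose v := (fun x => w x * t x) \_ I.
  have iv : lam.-integrable setT (EFin \o v).
    rewrite /v -restrict_EFin.
    exact: (iffLR (integrable_mkcond (mu := lam) _ mI) iwt).
  have : {ae lam, forall x, v x = 0}.
    apply: vanish_ae => // H mH.
    refine (proj2 (@vanish_support_sigma _ _ _ lam v iv
      [set chi : R -> R | C1 chi /\ forall x, 0 <= chi x] _ _ _ _ H
      (measurable_support_sigma mH))).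
    - move=> chi [Cchi chi0]; split => //.
      by apply: continuous_measurable_fun; exact: C1_continuous.
    - by split; [exact: C1_cst|move=> x; exact: ler01].
    - move=> f g [Cf f0] [Cg g0]; split; first exact: C1_M.
      by move=> x; rewrite mulr_ge0.
    move=> chi [Cchi chi0] k.
    have Ce := C1_comp (C1_onem_expR k%:R) Cchi.
    have := w0 _ (test_time_itv_bump a0 bT Ce); rewrite Rintegral_mkcond => <-.
    apply: eq_Rintegral => x _; rewrite /v !patchE; case: ifPn => _; last by rewrite mul0r.
    by rewrite -mulrA.
  apply: aeS => x vx abx; have Ix : I x.
    have /andP[ax xb] := abx; rewrite /I/= in_itv/=.
    by rewrite (ltW (lt_trans a0 ax)) (ltW (lt_trans xb bT)).
  move: vx; rewrite /v patchE mem_set// => /eqP; rewrite mulf_eq0 => /orP[/eqP//|].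
  rewrite subr_eq0 eq_sym -expR0 (inj_eq (@expR_inj R)) oppr_eq0.
  by move/negPn; rewrite itv_bump_neq0 abx.
(* Test functions live in the open interval, which is exhausted by intervals with margin
   [k.+1%:R^-1]; the two endpoints form a null set. *)
have ae_k : {ae lam, forall x (k : nat), k.+1%:R^-1 < x < T - k.+1%:R^-1 -> w x = 0}.
  apply: ae_foralln => k; apply: local_ae; first by rewrite invr_gt0.
  by rewrite ltrBlDr ltrDl invr_gt0.
apply: aeS3 ae_k (ae_neq 0) (ae_neq T) => x h x0 xT.
rewrite /I/= in_itv/= => /andP[x0' xT'].
have {}x0 : 0 < x by rewrite lt_neqAle eq_sym x0.
have {}xT : x < T by rewrite lt_neqAle xT.
have m0 : 0 < Num.min x (T - x) by rewrite lt_min x0 subr_gt0.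
have [k] := ltr_add_invr m0; rewrite add0r lt_min => /andP[k1 k2].
by apply: (h k); rewrite k1/= ltrBrDr addrC -ltrBrDr.
Qed.

End fundamental_lemma_time.

(** * Continuously differentiable functions of time *)

Lemma cvg_dist_bound {R : realType} {U : Type} (F : set_system U) (f g : U -> R)
    (l : R) : Filter F -> (\forall s \near F, `|f s - l| <= g s) ->
  g @ F --> 0 -> f @ F --> l.
Proof.
move=> FF fg g0; apply/cvgrPdist_le => e e0.
have /cvgrPdist_le/(_ _ e0) := g0.
apply: filterS2 fg => s fs; rewrite sub0r normrN distrC => gs.
by apply: (le_trans fs); apply: le_trans gs; exact: ler_norm.
Qed.

Section time_regularity.
Context {R : realType}.
Variable T : R.
Local Notation I := (`[0, T]%classic : set R).

Section one_space.
Variable X : Defs.space R.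
Hypothesis sX : seminormed X.

Lemma C0T_lin (a : R) (u v : R -> carrier X) : C0T T X u -> C0T T X v ->
  C0T T X (a *: u + v).
Proof.
move=> [Xu cu] [Xv cv].
split => [t It|t It]; first exact: (member_lin sX a (Xu _ It) (Xv _ It)).
apply: (@squeeze_cvgr _ _ _ _ (fun=> 0)
    (fun s => `|a| * nrm (u s - u t) + nrm (v s - v t))).
- near=> s; have Is : I s by near: s; exact: withinT.
  have Xus := memberB sX (Xu _ Is) (Xu _ It).
  have Xvs := memberB sX (Xv _ Is) (Xv _ It).
  have -> : (a *: u + v) s - (a *: u + v) t = a *: (u s - u t) + (v s - v t).
    by rewrite scalerBr opprD addrACA.
  rewrite nrm_ge0//=; last exact: member_lin.
  rewrite -nrmZ//; apply: nrmD => //; exact: memberZ.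
- exact: cvg_cst.
- rewrite -[X in _ --> X]addr0 -[X in _ --> X + _](mulr0 `|a|).
  by apply: cvgD; [apply: cvgMr; exact: cu|exact: cv].
Unshelve. all: by end_near. Qed.

Lemma derivT_lin (a : R) (u du v dv : R -> carrier X) :
  (forall t, I t -> member X (u t)) -> (forall t, I t -> member X (du t)) ->
  (forall t, I t -> member X (v t)) -> (forall t, I t -> member X (dv t)) ->
  derivT T u du -> derivT T v dv -> derivT T (a *: u + v) (a *: du + dv).
Proof.
move=> Xu Xdu Xv Xdv du_ dv_ t It.
apply: (@squeeze_cvgr _ _ _ _ (fun=> 0)
    (fun s => `|a| * nrm ((s - t)^-1 *: (u s - u t) - du t) +
              nrm ((s - t)^-1 *: (v s - v t) - dv t))).
- near=> s; have Is : I s by near: s; exact: withinT.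
  have Xus := memberB sX (memberZ (s - t)^-1 sX (memberB sX (Xu _ Is) (Xu _ It))) (Xdu _ It).
  have Xvs := memberB sX (memberZ (s - t)^-1 sX (memberB sX (Xv _ Is) (Xv _ It))) (Xdv _ It).
  have -> : (s - t)^-1 *: ((a *: u + v) s - (a *: u + v) t) - (a *: du + dv) t =
     a *: ((s - t)^-1 *: (u s - u t) - du t) + ((s - t)^-1 *: (v s - v t) - dv t).
    have -> : (a *: u + v) s - (a *: u + v) t = a *: (u s - u t) + (v s - v t).
      by rewrite scalerBr opprD addrACA.
    rewrite scalerDr scalerA [_ * a]mulrC -scalerA.
    by rewrite [in RHS](scalerBr a) [RHS]addrACA -opprD.
  rewrite nrm_ge0//=; last exact: member_lin.
  rewrite -nrmZ//; apply: nrmD => //; exact: memberZ.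
- exact: cvg_cst.
- rewrite -[X in _ --> X]addr0 -[X in _ --> X + _](mulr0 `|a|).
  by apply: cvgD; [apply: cvgMr; exact: du_|exact: dv_].
Unshelve. all: by end_near. Qed.

Lemma C1T_lin (a : R) (u du v dv : R -> carrier X) :
  C1T T X u du -> C1T T X v dv -> C1T T X (a *: u + v) (a *: du + dv).
Proof.
move=> [Cu Cdu du_] [Cv Cdv dv_]; split; try exact: C0T_lin.
apply: derivT_lin => //; [exact: Cu.1|exact: Cdu.1|exact: Cv.1|exact: Cdv.1].
Qed.

(** Replacing the values of a curve by others at seminorm distance zero leaves all increments
    unchanged in seminorm. This and its companions for derivatives take the place of a quotient by
    null elements. *)
Lemma C0T_congr (u u' : R -> carrier X) :
  (forall t, I t -> member X (u' t) /\ nrm (u' t - u t) = 0) ->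
  C0T T X u -> C0T T X u'.
Proof.
move=> uu' [Xu cu]; split => [t It|t It]; first exact: (uu' _ It).1.
apply: (@squeeze_cvgr _ _ _ _ (fun=> 0) (fun s => nrm (u s - u t))).
- near=> s; have Is : I s by near: s; exact: withinT.
  have [Xu's n_s] := uu' _ Is; have [Xu't n_t] := uu' _ It.
  rewrite nrm_ge0//=; last exact: memberB.
  have -> : u' s - u' t = (u' s - u s) + (u s - u t) - (u' t - u t).
    by rewrite opprB !addrA !subrK.
  apply: (le_trans (nrmB sX _ _)); rewrite ?n_t ?addr0//.
  + by apply: memberD => //; apply: memberB => //; exact: Xu.
  + by apply: memberB => //; exact: Xu.
  apply: (le_trans (nrmD sX _ _)); rewrite ?n_s ?add0r//.
  + by apply: memberB => //; exact: Xu.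
  + by apply: memberB => //; exact: Xu.
- exact: cvg_cst.
- exact: cu.
Unshelve. all: by end_near. Qed.

Lemma derivT_congr (u u' du : R -> carrier X) :
  (forall t, I t -> member X (u t)) -> (forall t, I t -> member X (du t)) ->
  (forall t, I t -> member X (u' t) /\ nrm (u' t - u t) = 0) ->
  derivT T u du -> derivT T u' du.
Proof.
move=> Xu Xdu uu' du_ t It.
apply: (@squeeze_cvgr _ _ _ _ (fun=> 0)
    (fun s => nrm ((s - t)^-1 *: (u s - u t) - du t))).
- near=> s; have Is : I s by near: s; exact: withinT.
  have [Xu's n_s] := uu' _ Is; have [Xu't n_t] := uu' _ It.
  have XD s' : I s' -> member X ((s - t)^-1 *: (u' s' - u s')).
    by move=> Is'; apply: memberZ => //; apply: memberB (Xu _ Is') => //; exact: (uu' _ Is').1.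
  have Xq : member X ((s - t)^-1 *: (u s - u t) - du t).
    by apply: memberB (Xdu _ It) => //; apply: memberZ => //; apply: memberB => //; exact: Xu.
  have -> : (s - t)^-1 *: (u' s - u' t) - du t =
     (s - t)^-1 *: (u' s - u s) + ((s - t)^-1 *: (u s - u t) - du t)
     - (s - t)^-1 *: (u' t - u t).
    rewrite addrA -scalerDr addrAC -scalerBr; congr (_ *: _ - _).
    by rewrite opprB !addrA !subrK.
  rewrite nrm_ge0//=; last by apply: memberB (XD _ It) => //; apply: memberD Xq => //; exact: XD.
  apply: (le_trans (nrmB sX _ (XD _ It))); first by apply: memberD Xq => //; exact: XD.
  rewrite [X in _ + X](nrmZ sX)// ?n_t ?mulr0 ?addr0//; last by apply: memberB (Xu _ It).
  apply: (le_trans (nrmD sX (XD _ Is) Xq)).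
  by rewrite (nrmZ sX)// ?n_s ?mulr0 ?add0r//; apply: memberB (Xu _ Is).
- exact: cvg_cst.
- exact: du_.
Unshelve. all: by end_near. Qed.

Lemma derivT_congr_r (u du du' : R -> carrier X) :
  (forall t, I t -> member X (u t)) -> (forall t, I t -> member X (du t)) ->
  (forall t, I t -> member X (du' t) /\ nrm (du' t - du t) = 0) ->
  derivT T u du -> derivT T u du'.
Proof.
move=> Xu Xdu duu' du_ t It.
apply: (@squeeze_cvgr _ _ _ _ (fun=> 0)
    (fun s => nrm ((s - t)^-1 *: (u s - u t) - du t))).
- near=> s; have Is : I s by near: s; exact: withinT.
  have [Xdu' n0] := duu' _ It.
  have Xq : member X ((s - t)^-1 *: (u s - u t)).
    by apply: memberZ => //; apply: memberB => //; exact: Xu.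
  rewrite (nrm_ge0 sX (memberB sX Xq Xdu'))/=.
  have -> : (s - t)^-1 *: (u s - u t) - du' t =
     ((s - t)^-1 *: (u s - u t) - du t) - (du' t - du t).
    by rewrite opprB addrA subrK.
  apply: (le_trans (nrmB sX (memberB sX Xq (Xdu _ It)) (memberB sX Xdu' (Xdu _ It)))).
  by rewrite n0 addr0.
- exact: cvg_cst.
- exact: du_.
Unshelve. all: by end_near. Qed.

Lemma C1T_congr (u u' du du' : R -> carrier X) :
  (forall t, I t -> member X (u' t) /\ nrm (u' t - u t) = 0) ->
  (forall t, I t -> member X (du' t) /\ nrm (du' t - du t) = 0) ->
  C1T T X u du -> C1T T X u' du'.
Proof.
move=> uu' duu' [Cu Cdu du_]; split; [exact: C0T_congr uu' Cu|exact: C0T_congr duu' Cdu|].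
apply: (derivT_congr_r (fun t It => (uu' t It).1) Cdu.1 duu').
exact: derivT_congr Cu.1 Cdu.1 uu' du_.
Qed.

Lemma C0T_nrm_cvg (u : R -> carrier X) t : C0T T X u -> I t ->
  nrm (u s) @[s --> within I (nbhs t)] --> nrm (u t).
Proof.
move=> [Xu cu] It; apply: cvg_dist_bound (cu t It); near=> s.
have Is : I s by near: s; exact: withinT.
by apply: ler_dist_nrm => //; exact: Xu.
Unshelve. all: by end_near. Qed.

End one_space.

Section two_spaces.
Variables (X Y : Defs.space R) (b : carrier X -> carrier Y -> R).
Hypotheses (sX : seminormed X) (sY : seminormed Y) (bP : pairing b).

Lemma pairing_continuous (u : R -> carrier X) (v : R -> carrier Y) :
  C0T T X u -> C0T T Y v -> {within I, continuous (fun t => b (u t) (v t))}.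
Proof.
move=> Cu Cv; have [Xu cu] := Cu; have [Yv cv] := Cv.
apply/subspace_continuousP => t It.
have [c c0 bc] := pair_bound bP.
apply: (@cvg_dist_bound _ _ _ _
  (fun s => c * nrm (u s - u t) * nrm (v s) + c * nrm (u t) * nrm (v s - v t))).
- near=> s; have Is : I s by near: s; exact: withinT.
  have Xus := memberB sX (Xu _ Is) (Xu _ It).
  have Yvs := memberB sY (Yv _ Is) (Yv _ It).
  rewrite /from_subspace/=.
  have -> : b (u s) (v s) - b (u t) (v t) =
     b (u s - u t) (v s) + b (u t) (v s - v t).
    rewrite (pairBl bP (Xu _ Is) (Xu _ It) (Yv _ Is)).
    by rewrite (pairBr bP (Xu _ It) (Yv _ Is) (Yv _ It)) addrA subrK.
  apply: (le_trans (ler_normD _ _)); apply: lerD.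
    exact: bc Xus (Yv _ Is).
  exact: bc (Xu _ It) Yvs.
- rewrite [X in _ --> X](_ : 0 = c * 0 * nrm (v t) + c * nrm (u t) * 0); last first.
    by rewrite !mulr0 mul0r addr0.
  apply: cvgD; last by apply: cvgMr; exact: cv.
  by apply: cvgM; [apply: cvgMr; exact: cu|exact: C0T_nrm_cvg].
Unshelve. all: by end_near. Qed.

(** The quotient of the product minus its limit splits into three terms: the defect of the quotient
    of [u] against [v s], the increment of [v] against [du t], and the defect of the quotient of [v]
    against [u t]. The bound of the pairing makes each tend to zero. *)
Lemma pairing_derivative (u du : R -> carrier X) (v dv : R -> carrier Y) t :
  (forall t, I t -> member X (u t)) -> (forall t, I t -> member X (du t)) ->
  (forall t, I t -> member Y (dv t)) -> C0T T Y v ->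
  derivT T u du -> derivT T v dv -> I t ->
  (s - t)^-1 * (b (u s) (v s) - b (u t) (v t)) @[s --> within I t^'] -->
    b (du t) (v t) + b (u t) (dv t).
Proof.
move=> Xu Xdu Ydv Cv du_ dv_ It; have [Yv cv] := Cv.
have [c c0 bc] := pair_bound bP.
have wI : within I t^' --> within I (nbhs t).
  move=> A hA; exact: (@filterS R (nbhs t) _ (fun s => I s -> A s) _ (fun s h _ => h) hA).
apply: (@cvg_dist_bound _ _ _ _
  (fun s => c * nrm ((s - t)^-1 *: (u s - u t) - du t) * nrm (v s) +
            c * nrm (du t) * nrm (v s - v t) +
            c * nrm (u t) * nrm ((s - t)^-1 *: (v s - v t) - dv t))).
- near=> s; have Is : I s by near: s; exact: withinT.
  have Xus := memberB sX (Xu _ Is) (Xu _ It).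
  have Yvs := memberB sY (Yv _ Is) (Yv _ It).
  have Xq := memberB sX (memberZ (s - t)^-1 sX Xus) (Xdu _ It).
  have Yq := memberB sY (memberZ (s - t)^-1 sY Yvs) (Ydv _ It).
  have -> : (s - t)^-1 * (b (u s) (v s) - b (u t) (v t)) -
     (b (du t) (v t) + b (u t) (dv t)) =
     b ((s - t)^-1 *: (u s - u t) - du t) (v s) + b (du t) (v s - v t) +
     b (u t) ((s - t)^-1 *: (v s - v t) - dv t).
    rewrite (pairBl bP (memberZ _ sX Xus) (Xdu _ It) (Yv _ Is)).
    rewrite (pairBr bP (Xdu _ It) (Yv _ Is) (Yv _ It)).
    rewrite (pairBr bP (Xu _ It) (memberZ _ sY Yvs) (Ydv _ It)).
    rewrite (pairZl sX bP _ Xus (Yv _ Is)) (pairZr sY bP _ (Xu _ It) Yvs).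
    rewrite (pairBl bP (Xu _ Is) (Xu _ It) (Yv _ Is)).
    rewrite (pairBr bP (Xu _ It) (Yv _ Is) (Yv _ It)); ring.
  apply: (le_trans (ler_normD _ _)); apply: lerD; last exact: bc (Xu _ It) Yq.
  apply: (le_trans (ler_normD _ _)); apply: lerD; first exact: bc Xq (Yv _ Is).
  exact: bc (Xdu _ It) Yvs.
- rewrite [X in _ --> X](_ : 0 = c * 0 * nrm (v t) + c * nrm (du t) * 0 +
      c * nrm (u t) * 0); last first.
    by rewrite !mulr0 mul0r !addr0.
  apply: cvgD; last by apply: cvgMr; exact: dv_.
  apply: cvgD; last by apply: cvgMr; exact: (cvg_trans (cvg_app _ wI) (cv _ It)).
  apply: cvgM; first by apply: cvgMr; exact: du_.
  exact: (cvg_trans (cvg_app _ wI) (C0T_nrm_cvg sY Cv It)).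
Unshelve. all: by end_near. Qed.

End two_spaces.

Lemma within_derivable (g : R -> R) (t l : R) : t \in `]0, T[ ->
  (s - t)^-1 * (g s - g t) @[s --> within I t^'] --> l -> is_derive t 1 g l.
Proof.
move=> tI gl.
have lim : (h^-1 *: (g (h *: 1 + t) - g t)) @[h --> 0^'] --> l.
  apply/cvgrPdist_le => e e0.
  move/cvgrPdist_le/(_ _ e0) : gl; rewrite /within /dnbhs/= => gl.
  have tI' : \forall s \near t, I s.
    near=> s; apply: subset_itv_oo_cc; near: s; exact: near_in_itvoo.
  have {}gl : \forall s \near t, s != t -> `|l - (s - t)^-1 * (g s - g t)| <= e.
    by move: tI' gl; apply: filterS2 => s Is h st; exact: h.
  move: gl; rewrite (near_shift 0 t)/= subr0 => gl.
  apply: filterS gl => h /= gl h0; move: gl.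
  rewrite addrK -subr_eq0 addrK => /(_ h0); rewrite /GRing.scale/= mulr1.
  by [].
by split; [apply/cvg_ex; exists l|exact/cvg_lim].
Unshelve. all: by end_near. Qed.

(** Near an interior point the restriction of the quotients to [I] is void, so [g] is differentiable
    there in the ordinary sense; at the endpoints the fundamental theorem of calculus asks only for
    one-sided continuity. *)
Lemma FTC_within (g k : R -> R) : 0 < T ->
  {within I, continuous g} -> {within I, continuous k} ->
  (forall t, I t -> (s - t)^-1 * (g s - g t) @[s --> within I t^'] --> k t) ->
  \int[lebesgue_measure]_(t in I) k t = g T - g 0.
Proof.
move=> T0 cg ck gk; have dg t : t \in `]0, T[ -> is_derive t 1 g (k t).
  by move=> tI; apply: within_derivable => //; apply: gk; exact: subset_itv_oo_cc.
rewrite /Rintegral (continuous_FTC2 T0 ck (F := g))//.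
- have /(continuous_within_itvP _ T0)[_ c0 cT] := cg; split => // t tI.
  exact: (@ex_derive _ _ _ _ _ _ _ (dg _ tI)).
- by move=> t tI; rewrite derive1E; exact: (@derive_val _ _ _ _ _ _ _ (dg _ tI)).
Qed.

Lemma within_continuous_integrable (k : R -> R) : {within I, continuous k} ->
  (@lebesgue_measure R).-integrable I (EFin \o k).
Proof.
by move=> ck; apply: continuous_compact_integrable => //; exact: segment_compact.
Qed.

End time_regularity.

(** * Bochner spaces *)

Section bochner_spaces.
Context {R : realType}.
Variables (T : R) (X : Defs.space R) (b : carrier X -> carrier X -> R).
Hypothesis bX : inner_product b.
Local Notation I := (`[0, T]%classic : set R).
Local Notation lam := (@lebesgue_measure R).
Implicit Types (s : step X) (f g z dz : R -> carrier X).

Let sX : seminormed X := inner_seminormed bX.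
Let bP : pairing b := inner_pairing bX.
Let mI : measurable I. Proof. exact: measurable_itv. Qed.

Lemma lebesgue_measure_horizon_fin : (lam I < +oo)%E.
Proof. by rewrite lebesgue_measure_itv/=; case: ifP => _; rewrite ?ltry// -EFinD ltry. Qed.

Lemma step_in_cons p s : step_in (p :: s) ->
  [/\ measurable p.1, member X p.2 & step_in s].
Proof.
move=> ps; have [mp Xp] := ps p (mem_head _ _); split => // q qs.
by apply: ps; rewrite in_cons qs orbT.
Qed.

Lemma step_at_cons p s t : step_at (p :: s) t = \1_(p.1) t *: p.2 + step_at s t.
Proof. by rewrite /step_at big_cons. Qed.

Lemma step_at_cat s s' t : step_at (s ++ s') t = step_at s t + step_at s' t.
Proof. by rewrite /step_at big_cat. Qed.

Lemma step_int_cat s s' : step_int T (s ++ s') = step_int T s + step_int T s'.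
Proof. by rewrite /step_int big_cat. Qed.

Definition step_scale (a : R) s : step X := [seq (p.1, a *: p.2) | p <- s].

Lemma step_at_scale a s t : step_at (step_scale a s) t = a *: step_at s t.
Proof.
rewrite /step_at big_map scaler_sumr; apply: eq_bigr => p _ /=.
by rewrite !scalerA mulrC.
Qed.

Lemma step_int_scale a s : step_int T (step_scale a s) = a *: step_int T s.
Proof.
rewrite /step_int big_map scaler_sumr; apply: eq_bigr => p _ /=.
by rewrite !scalerA mulrC.
Qed.

Lemma step_in_lin a s s' : step_in s -> step_in s' ->
  step_in (step_scale a s ++ s').
Proof.
move=> ss ss' p; rewrite mem_cat => /orP[/mapP[q qs ->]/=|]; last exact: ss'.
by have [mq Xq] := ss q qs; split => //; exact: memberZ.
Qed.

Lemma member_step_at s t : step_in s -> member X (step_at s t).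
Proof.
elim: s => [_|p s ih /step_in_cons[mp Xp /ih Xs]].
  by rewrite /step_at big_nil; exact: (member0 sX).
by rewrite step_at_cons; exact: member_lin.
Qed.

Lemma member_step_int s : step_in s -> member X (step_int T s).
Proof.
rewrite /step_int; elim: s => [_|p s ih /step_in_cons[mp Xp /ih Xs]].
  by rewrite big_nil; exact: (member0 sX).
by rewrite big_cons; exact: member_lin.
Qed.

Lemma measurable_pair_step g s :
  (forall c, member X c -> measurable_fun I (fun t => b (g t) c)) ->
  (forall t, I t -> member X (g t)) -> step_in s ->
  measurable_fun I (fun t => b (g t) (step_at s t)).
Proof.
move=> mg Xg; elim: s => [_|p s ih /step_in_cons[mp Xp ss]].
  by apply: eq_measurable_fun (mg 0 (member0 sX)) => t _; rewrite /step_at big_nil.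
apply: (@eq_measurable_fun _ _ _ _ _ (fun t => \1_(p.1) t * b (g t) p.2 + b (g t) (step_at s t))).
  move=> t /set_mem It; rewrite step_at_cons (pair_linr bP)//; first exact: Xg.
  exact: member_step_at.
apply: measurable_funD; last exact: ih.
by apply: measurable_funM; [exact: measurable_indic|exact: mg].
Qed.

Lemma measurable_pair_cst (g : carrier X) f : member X g -> strongly_measurable T f ->
  measurable_fun I (fun t => b g (f t)).
Proof.
move=> Xg [Xf [s [ss sf]]].
apply: (@measurable_fun_cvg _ _ _ _ (fun k t => b g (step_at (s k) t))).
  by move=> k; apply: (@measurable_pair_step (fun=> g)) => // *; exact: measurable_cst.
move=> t It; apply: (@cvg_dist_bound _ _ _ _ (fun k => nrm g * nrm (f t - step_at (s k) t))).
  apply: nearW => k; have Xs := member_step_at t (ss k).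
  rewrite -(pairBr bP)//; last exact: Xf.
  rewrite (le_trans (cauchy_schwarz bX _ _))//.
    by apply: memberB => //; exact: Xf.
  by rewrite -opprB (nrmN sX)//; apply: memberB => //; exact: Xf.
by rewrite -[X in _ --> X](mulr0 (nrm g)); apply: cvgMr; exact: sf.
Qed.

(** Two passages to the limit: [measurable_pair_cst] approximates one argument while the other is
    constant; here the second argument is approximated by steps, which at each stage take their
    values among finitely many combinations of constants. *)
Lemma measurable_pair f g : strongly_measurable T f -> strongly_measurable T g ->
  measurable_fun I (fun t => b (f t) (g t)).
Proof.
move=> mf [Xg [s [ss sg]]]; have [Xf _] := mf.
have mfc c : member X c -> measurable_fun I (fun t => b (f t) c).
  move=> Xc; have := measurable_pair_cst Xc mf.
  by apply: eq_measurable_fun => t /set_mem It; rewrite (innerC bX)//; exact: Xf.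
apply: (@measurable_fun_cvg _ _ _ _ (fun k t => b (f t) (step_at (s k) t))).
  by move=> k; exact: measurable_pair_step.
move=> t It; apply: (@cvg_dist_bound _ _ _ _ (fun k => nrm (f t) * nrm (g t - step_at (s k) t))).
  apply: nearW => k; have Xs := member_step_at t (ss k).
  have Xft := Xf _ It; have Xgt := Xg _ It.
  rewrite -(pairBr bP)// (le_trans (cauchy_schwarz bX _ _))//; first exact: memberB.
  by rewrite -opprB (nrmN sX)//; exact: memberB.
by rewrite -[X in _ --> X](mulr0 (nrm (f t))); apply: cvgMr; exact: sg.
Qed.

Lemma measurable_nrm f : strongly_measurable T f -> measurable_fun I (fun t => nrm (f t)).
Proof.
move=> mf; apply: (@eq_measurable_fun _ _ _ _ _ (fun t => Num.sqrt (b (f t) (f t)))).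
  by move=> t _; rewrite (inner_nrm bX).
apply: measurableT_comp; last exact: measurable_pair.
by apply: continuous_measurable_fun => x; exact: sqrt_continuous.
Qed.

Lemma strongly_measurable_lin a f g : strongly_measurable T f ->
  strongly_measurable T g -> strongly_measurable T (a *: f + g).
Proof.
move=> [Xf [s [ss sf]]] [Xg [s' [ss' sg]]]; split.
  by move=> t It; exact: (member_lin sX a (Xf _ It) (Xg _ It)).
exists (fun k => step_scale a (s k) ++ s' k); split.
  by move=> k; exact: step_in_lin.
move=> t It; apply: (@cvg_dist_bound _ _ _ _ (fun k =>
    `|a| * nrm (f t - step_at (s k) t) + nrm (g t - step_at (s' k) t))).
  apply: nearW => k; have Xs := member_step_at t (ss k).
  have Xs' := member_step_at t (ss' k).
  have Xfs := memberB sX (Xf _ It) Xs; have Xgs := memberB sX (Xg _ It) Xs'.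
  rewrite subr0 step_at_cat step_at_scale.
  have -> : (a *: f + g) t - (a *: step_at (s k) t + step_at (s' k) t) =
    a *: (f t - step_at (s k) t) + (g t - step_at (s' k) t).
    by rewrite scalerBr opprD addrACA.
  rewrite ger0_norm; last by apply: (nrm_ge0 sX); exact: member_lin.
  by rewrite (le_trans (nrmD sX (memberZ _ sX Xfs) Xgs))// (nrmZ sX).
rewrite -[X in _ --> X]addr0 -[X in _ --> X + _](mulr0 `|a|).
by apply: cvgD; [apply: cvgMr; exact: sf|exact: sg].
Qed.

Lemma strongly_measurable_step s : step_in s -> strongly_measurable T (step_at s).
Proof.
move=> ss; split; first by move=> t _; exact: member_step_at.
exists (fun=> s); split => // t It; rewrite subrr (nrm0 sX); exact: cvg_cst.
Qed.

Lemma strongly_measurableB f s : strongly_measurable T f -> step_in s ->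
  strongly_measurable T (fun t => f t - step_at s t).
Proof.
move=> mf /strongly_measurable_step ms.
have := strongly_measurable_lin (-1) ms mf; congr strongly_measurable.
by apply/funext => t; rewrite addrC /= -[in RHS]scaleN1r.
Qed.

Lemma pair_step_int (g : carrier X) s : member X g -> step_in s ->
  lam.-integrable I (EFin \o (fun t => b g (step_at s t))) /\
  \int[lam]_(t in I) b g (step_at s t) = b g (step_int T s).
Proof.
move=> Xg; elim: s => [_|p s ih /step_in_cons[mp Xp ss]].
  split; last first.
    rewrite /step_int big_nil (pair0r sX bP Xg).
    under eq_Rintegral do rewrite /step_at big_nil (pair0r sX bP Xg).
    by rewrite Rintegral_cst// mul0r.
  rewrite (_ : _ \o _ = cst 0%E); first exact: integrable0.
  by apply/funext => t /=; rewrite /step_at big_nil (pair0r sX bP Xg).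
have [ih1 ih2] := ih ss.
have E t : b g (step_at (p :: s) t) = \1_(p.1) t * b g p.2 + b g (step_at s t).
  by rewrite step_at_cons (pair_linr bP)//; exact: member_step_at.
have i1 : lam.-integrable I (EFin \o (fun t => (\1_(p.1) t : R))).
  apply/integrableP; split; first by apply/measurable_EFinP; exact: measurable_indic.
  apply: (@le_lt_trans _ _ (lam (p.1 `&` I))).
    rewrite -integral_indic//; apply: ge0_le_integral => //.
    - by apply: measurableT_comp => //; apply/measurable_EFinP; exact: measurable_indic.
    - by apply/measurable_EFinP; exact: measurable_indic.
    - by move=> t _ /=; rewrite ger0_norm.
  apply: le_lt_trans lebesgue_measure_horizon_fin.
  by apply: le_measure; rewrite ?inE//; exact: measurableI.
have i2 : lam.-integrable I (EFin \o (fun t => \1_(p.1) t * b g p.2)).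
  rewrite (_ : _ \o _ = EFin \o (fun t => b g p.2 * \1_(p.1) t)); first exact: intgZ.
  by apply/funext => t /=; rewrite mulrC.
split.
  rewrite (_ : _ \o _ = EFin \o (fun t => \1_(p.1) t * b g p.2 + b g (step_at s t))).
    exact: intgD.
  by apply/funext => t /=; rewrite E.
under eq_Rintegral do rewrite E.
rewrite RintegralD// ih2 RintegralZr// /step_int big_cons.
rewrite (pair_linr bP)//; last exact: member_step_int.
by rewrite /Rintegral integral_indic.
Qed.

(** Pairing with a fixed member turns a Bochner integral into a Lebesgue integral of a real
    function, the form in which the fundamental lemma in time can be applied. *)
Lemma bochner_pair (g : carrier X) f J : member X g -> bochner T f J ->
  lam.-integrable I (EFin \o (fun t => b g (f t))) /\
  \int[lam]_(t in I) b g (f t) = b g J.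
Proof.
move=> Xg [mf XJ [s [ss sf sJ]]]; have [Xf _] := mf.
have msk k := strongly_measurableB mf (ss k).
have near_k e : 0 < e -> exists k,
    (\int[lam]_(t in I) (nrm (f t - step_at (s k) t))%:E <= e%:E)%E /\
    nrm (J - step_int T (s k)) <= e.
  move=> e0; have /cvgrPdist_le/(_ _ e0) h1 := sJ.
  have /fine_cvgP[fin /cvgrPdist_le/(_ _ e0) h2] := sf.
  have [k [[k1 k2] k3]] := filter_ex (filterI (filterI h1 h2) fin).
  exists k; split.
    rewrite -(fineK k3) lee_fin; move: k2; rewrite sub0r normrN; apply: le_trans.
    exact: ler_norm.
  by move: k1; rewrite sub0r normrN; apply: le_trans; exact: ler_norm.
have nrm_int k e : (\int[lam]_(t in I) (nrm (f t - step_at (s k) t))%:E <= e%:E)%E ->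
    lam.-integrable I (EFin \o (fun t => nrm (f t - step_at (s k) t))) /\
    \int[lam]_(t in I) nrm (f t - step_at (s k) t) <= e.
  move=> le_e; have i : lam.-integrable I (EFin \o (fun t => nrm (f t - step_at (s k) t))).
    apply/integrableP; split; first by apply/measurable_EFinP; exact: (measurable_nrm (msk k)).
    apply: le_lt_trans (_ : (_ <= e%:E)%E) _; last exact: ltry.
    apply: le_trans le_e; apply: ge0_le_integral => //.
    - apply: measurableT_comp => //; apply/measurable_EFinP.
      exact: (measurable_nrm (msk k)).
    - by apply/measurable_EFinP; exact: (measurable_nrm (msk k)).
    - by move=> t It /=; rewrite ger0_norm// nrm_ge0//; exact: ((msk k).1 t It).
  by split => //; rewrite -lee_fin /Rintegral fineK//; exact: integrable_fin_num.
have mF := measurable_pair_cst Xg mf.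
have ng := nrm_ge0 sX Xg.
have bound k t : I t -> `|b g (f t) - b g (step_at (s k) t)| <=
    nrm g * nrm (f t - step_at (s k) t).
  move=> It; have Xs := member_step_at t (ss k).
  rewrite -(pairBr bP)//; last exact: Xf.
  by apply: (cauchy_schwarz bX) => //; apply: memberB => //; exact: Xf.
have iF : lam.-integrable I (EFin \o (fun t => b g (f t))).
  have [k [k1 _]] := near_k 1 ltr01; have [ik _] := nrm_int _ _ k1.
  have [is_ _] := pair_step_int Xg (ss k).
  apply: (@le_integrable _ _ _ lam I mI _ (EFin \o (fun t =>
      `|b g (step_at (s k) t)| + nrm g * nrm (f t - step_at (s k) t)))).
  - exact/measurable_EFinP.
  - move=> t It /=; rewrite lee_fin [leRHS]ger0_norm; last first.
      rewrite addr_ge0// mulr_ge0//; apply: (nrm_ge0 sX).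
      exact: ((msk k).1 t It).
    rewrite -lerBlDl (le_trans _ (bound k t It))//.
    by rewrite (le_trans (lerB_dist _ _)).
  - by apply: intgD => //; [exact: integrable_norm|exact: intgZ].
split => //; apply/eqP; rewrite -subr_eq0 -normr_le0.
apply/ler_addgt0Pr => e e0; rewrite add0r.
(* Two errors arise, from the integral and from its value, each at most [nrm g] times the chosen
   accuracy; the added 1 covers the case [nrm g = 0]. *)
have ng1 : 0 < 2 * (nrm g + 1) by rewrite mulr_gt0// ltr_wpDl.
have [k [k1 k2]] := near_k _ (divr_gt0 e0 ng1); have [ik k1'] := nrm_int _ _ k1.
have [is_ is2] := pair_step_int Xg (ss k).
have XJs := memberB sX XJ (member_step_int (ss k)).
have h1 : `|\int[lam]_(t in I) b g (f t) - b g (step_int T (s k))| <=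
    nrm g * (e / (2 * (nrm g + 1))).
  rewrite -is2 -RintegralB//.
  have iB : lam.-integrable I (EFin \o (fun t => b g (f t) - b g (step_at (s k) t))).
    exact: intgB.
  apply: le_trans; first by apply: le_normr_Rintegral; [exact: mI|exact: iB].
  apply: (@le_trans _ _ (\int[lam]_(t in I) (nrm g * nrm (f t - step_at (s k) t)))).
    apply: le_Rintegral => //; [exact: integrable_norm|exact: intgZ|].
    by move=> t; exact: bound.
  by rewrite RintegralZl// ler_wpM2l.
have h2 : `|b g (step_int T (s k)) - b g J| <= nrm g * (e / (2 * (nrm g + 1))).
  rewrite distrC -(pairBr bP)//; last exact: member_step_int.
  rewrite (le_trans (cauchy_schwarz bX Xg XJs))// ler_wpM2l//.
have -> : \int[lam]_(t in I) b g (f t) - b g J =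
  (\int[lam]_(t in I) b g (f t) - b g (step_int T (s k))) +
  (b g (step_int T (s k)) - b g J) by rewrite addrA subrK.
apply: (le_trans (ler_normD _ _)); apply: (le_trans (lerD h1 h2)).
have eE : e = 2 * (nrm g + 1) * (e / (2 * (nrm g + 1))).
  by rewrite mulrC divfK// gt_eqF.
have q0 : 0 < e / (2 * (nrm g + 1)) by rewrite divr_gt0.
rewrite [leRHS]eE; move: q0; set q := e / _; nra.
Qed.

Lemma bochner_lin a f f' J J' : bochner T f J -> bochner T f' J' ->
  bochner T (a *: f + f') (a *: J + J').
Proof.
move=> [mf XJ [s [ss sf sJ]]] [mf' XJ' [s' [ss' sf' sJ']]]; split.
- exact: strongly_measurable_lin.
- exact: member_lin.
have Xf := mf.1; have Xf' := mf'.1.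
exists (fun k => step_scale a (s k) ++ s' k); split.
- by move=> k; exact: step_in_lin.
- have m1 k := measurable_nrm (strongly_measurableB mf (ss k)).
  have m2 k := measurable_nrm (strongly_measurableB mf' (ss' k)).
  have n1 k t : I t -> 0 <= nrm (f t - step_at (s k) t).
    by move=> It; apply: (nrm_ge0 sX); apply: memberB; [|exact: Xf|exact: member_step_at].
  have n2 k t : I t -> 0 <= nrm (f' t - step_at (s' k) t).
    by move=> It; apply: (nrm_ge0 sX); apply: memberB; [|exact: Xf'|exact: member_step_at].
  apply: (@squeeze_cvge _ _ _ _ (fun=> 0%E) _ (fun k =>
    `|a|%:E * \int[lam]_(t in I) (nrm (f t - step_at (s k) t))%:E +
     \int[lam]_(t in I) (nrm (f' t - step_at (s' k) t))%:E)%E).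
  + apply: nearW => k; apply/andP; split.
      apply: integral_ge0 => t It; rewrite lee_fin; apply: (nrm_ge0 sX).
      apply: memberB => //; first exact: (member_lin sX a (Xf _ It) (Xf' _ It)).
      by apply: member_step_at; exact: step_in_lin.
    rewrite -ge0_integralZl_EFin//; last 2 first.
    * by move=> t It; rewrite lee_fin; exact: n1.
    * by apply/measurable_EFinP; exact: m1.
    rewrite -ge0_integralD//; last 4 first.
    * by move=> t It; rewrite -EFinM lee_fin mulr_ge0//; exact: n1.
    * by apply: measurable_funeM; apply/measurable_EFinP; exact: m1.
    * by move=> t It; rewrite lee_fin; exact: n2.
    * by apply/measurable_EFinP; exact: m2.
    have mL := measurable_nrm (strongly_measurableB (strongly_measurable_lin a mf mf')
      (step_in_lin (a := a) (ss k) (ss' k))).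
    apply: ge0_le_integral => //.
    * move=> t It; rewrite lee_fin; apply: (nrm_ge0 sX).
      exact: ((strongly_measurableB (strongly_measurable_lin a mf mf')
        (step_in_lin (a := a) (ss k) (ss' k))).1 t It).
    * by apply/measurable_EFinP; exact: mL.
    * by apply: emeasurable_funD; [apply: measurable_funeM|]; apply/measurable_EFinP;
        [exact: m1|exact: m2].
    move=> t It; rewrite -EFinM -EFinD lee_fin step_at_cat step_at_scale.
    have -> : (a *: f + f') t - (a *: step_at (s k) t + step_at (s' k) t) =
      a *: (f t - step_at (s k) t) + (f' t - step_at (s' k) t).
      by rewrite scalerBr opprD addrACA.
    have X1 : member X (f t - step_at (s k) t).
      by apply: memberB; [|exact: Xf|exact: member_step_at].
    have X2 : member X (f' t - step_at (s' k) t).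
      by apply: memberB; [|exact: Xf'|exact: member_step_at].
    by rewrite (le_trans (nrmD sX (memberZ _ sX X1) X2))// (nrmZ sX).
  + exact: cvg_cst.
  + rewrite -[X in _ --> X](adde0 0%E) -[X in _ --> (X + _)%E](mule0 `|a|%:E).
    by apply: cvgeD => //; apply: cvgeZl.
- apply: (@cvg_dist_bound _ _ _ _ (fun k =>
    `|a| * nrm (J - step_int T (s k)) + nrm (J' - step_int T (s' k)))).
    apply: nearW => k.
    have X1 := memberB sX XJ (member_step_int (ss k)).
    have X2 := memberB sX XJ' (member_step_int (ss' k)).
    rewrite subr0 step_int_cat step_int_scale.
    have -> : a *: J + J' - (a *: step_int T (s k) + step_int T (s' k)) =
      a *: (J - step_int T (s k)) + (J' - step_int T (s' k)).
      by rewrite scalerBr opprD addrACA.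
    rewrite ger0_norm; last by apply: (nrm_ge0 sX); exact: member_lin.
    by rewrite (le_trans (nrmD sX (memberZ _ sX X1) X2))// (nrmZ sX).
  rewrite -[X in _ --> X]addr0 -[X in _ --> X + _](mulr0 `|a|).
  by apply: cvgD => //; apply: cvgMr.
Qed.

Lemma L2T_L2 f : L2T T f -> L2 lam I (fun t => nrm (f t)).
Proof. by move=> [mf foo]; split => //; exact: measurable_nrm. Qed.

Lemma L2T_pair f g : L2T T f -> L2T T g ->
  lam.-integrable I (EFin \o (fun t => b (f t) (g t))).
Proof.
move=> Lf Lg.
have i : lam.-integrable I (EFin \o (fun t => nrm (f t) * nrm (g t))).
  by apply: L2_mul_integrable => //; exact: L2T_L2.
apply: le_integrable i => //.
  by apply/measurable_EFinP; apply: measurable_pair; [exact: Lf.1|exact: Lg.1].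
move=> t It /=; rewrite lee_fin (le_trans (cauchy_schwarz bX _ _)) ?ler_norm//.
- exact: Lf.1.1.
- exact: Lg.1.1.
Qed.

Lemma L2T_lin a f g : L2T T f -> L2T T g -> L2T T (a *: f + g).
Proof.
move=> Lf Lg; have mfg := strongly_measurable_lin a Lf.1 Lg.1; split => //.
have Xf := Lf.1.1; have Xg := Lg.1.1.
have L : L2 lam I (fun t => `|a| * nrm (f t) + nrm (g t)).
  by apply: L2_lin => //; exact: L2T_L2.
apply: le_lt_trans L.2; apply: ge0_le_integral => //.
- by move=> t It; rewrite lee_fin sqr_ge0.
- by apply/measurable_EFinP/measurable_funX; exact: measurable_nrm.
- by apply/measurable_EFinP/measurable_funX; exact: L.1.
move=> t It; rewrite lee_fin lerXn2r ?nnegrE//.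
- by apply: (nrm_ge0 sX); exact: (mfg.1 t It).
- by rewrite addr_ge0 ?mulr_ge0//; apply: (nrm_ge0 sX); [exact: Xf|exact: Xg].
rewrite -(nrmZ sX); last exact: Xf.
by apply: (nrmD sX); [apply: memberZ => //; exact: Xf|exact: Xg].
Qed.

Lemma wdot_lin a z dz z' dz' : is_wdot T z dz -> is_wdot T z' dz' ->
  is_wdot T (a *: z + z') (a *: dz + dz').
Proof.
move=> [Ldz zP] [Ldz' zP']; split; first exact: L2T_lin.
move=> phi tphi; have [J [J1 J2]] := zP _ tphi; have [J' [J1' J2']] := zP' _ tphi.
exists (a *: J + J'); split.
  have := bochner_lin a J1 J1'; congr bochner; apply/funext => t.
  change (a *: (derive1 phi t *: z t) + derive1 phi t *: z' t =
          derive1 phi t *: (a *: z t + z' t)).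
  by rewrite scalerDr !scalerA mulrC.
have := bochner_lin a J2 J2'; rewrite scalerN -opprD; congr bochner.
apply/funext => t.
change (a *: (phi t *: dz t) + phi t *: dz' t = phi t *: (a *: dz t + dz' t)).
by rewrite scalerDr !scalerA mulrC.
Qed.

(** For each fixed [c] the fundamental lemma gives [b c (e t) = 0] outside a null set that depends
    on [c]. Strong measurability supplies countably many vectors whose combinations approximate
    every [e t]; one null set serves them all, and [e t] is then orthogonal to its own
    approximations. *)
Lemma wdot_ae_unique z dz dz' : 0 < T ->
  (forall t, I t -> member X (z t)) -> is_wdot T z dz -> is_wdot T z dz' ->
  {ae lam, forall t, I t -> nrm (dz t - dz' t) = 0}.
Proof.
move=> T0 Xz [Ldz zP] [Ldz' zP'].
have Xdz := Ldz.1.1; have Xdz' := Ldz'.1.1.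
have Le : L2T T (-1 *: dz' + dz) by exact: L2T_lin.
pose e t := dz t - dz' t.
have {}Le : L2T T e.
  move: Le; congr L2T; apply/funext => t.
  change (-1 *: dz' t + dz t = dz t - dz' t).
  by rewrite scaleN1r addrC.
have Xe := Le.1.1.
have pair_ae c : member X c -> {ae lam, forall t, I t -> b c (e t) = 0}.
  move=> Xc; have Lc : L2T T (fun=> c).
    split; last first.
      by rewrite integral_cst//= lte_mul_pinfty// ?lebesgue_measure_horizon_fin// lee_fin sqr_ge0.
    split=> //; exists (fun=> [:: (setT, c)]); split.
      by move=> k p; rewrite inE => /eqP ->; split => //; exact: measurableT.
    move=> t It; rewrite /step_at big_seq1 /= indicT scale1r subrr (nrm0 sX).
    exact: cvg_cst.
  apply: (fundamental_lemma_time T0); first exact: L2T_pair.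
  move=> phi tphi; have [J [J1 J2]] := zP _ tphi; have [J' [J1' J2']] := zP' _ tphi.
  have [_ i1] := bochner_pair Xc J1; have [_ i1'] := bochner_pair Xc J1'.
  have [k2 i2] := bochner_pair Xc J2; have [k2' i2'] := bochner_pair Xc J2'.
  have XJ : member X J by case: J1.
  have XJ' : member X J' by case: J1'.
  rewrite (_ : \int[lam]_(t in I) _ =
    \int[lam]_(t in I) (b c (phi t *: dz t) - b c (phi t *: dz' t))); last first.
    apply: eq_Rintegral => t /set_mem It.
    rewrite !(pairZr sX bP) ?(pairBr bP)//; try exact: Xdz; try exact: Xdz'.
    by rewrite -mulrBr mulrC.
  rewrite RintegralB// i2 i2' -(scaleN1r J) -(scaleN1r J') !(pairZr sX bP)// -i1 -i1'.
  by rewrite subrr.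
have [s [ss se]] := Le.1.2.
(* Beyond the length of the list [nth] returns the vector 0, for which the claim is trivial, so [i]
   may range over all natural numbers and a countable union of null sets suffices. *)
have step_ae : {ae lam, forall t, forall k i : nat, I t -> b (nth (set0, 0) (s k) i).2 (e t) = 0}.
  apply: ae_foralln => k; apply: ae_foralln => i; apply: pair_ae.
  have [ik|ik] := ltnP i (size (s k)); first exact: ((ss k) _ (mem_nth _ ik)).2.
  by rewrite nth_default//; exact: (member0 sX).
apply: aeS step_ae => t h It; have Xet := Xe _ It.
have e0 k : b (e t) (step_at (s k) t) = 0.
  have : forall i, b (e t) (nth (set0, 0) (s k) i).2 = 0.
    move=> i; have [ik|ik] := ltnP i (size (s k)); last first.
      by rewrite nth_default//; exact: (pair0r sX bP).
    by rewrite (innerC bX) ?h//; exact: ((ss k) _ (mem_nth _ ik)).2.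
  elim: (s k) (ss k) => [_ _|p l ih /step_in_cons[mp Xp sl] hl].
    by rewrite /step_at big_nil (pair0r sX bP).
  rewrite step_at_cons (pair_linr bP)//; last exact: member_step_at.
  by rewrite (hl 0%N) mulr0 add0r ih// => i; exact: (hl i.+1).
(* Subtracting the vanishing product with the step gives [b (e t) (e t - step_at (s k) t)], to which
   Cauchy-Schwarz applies; the right-hand side tends to zero. *)
have bound k : nrm (e t) ^+ 2 <= nrm (e t) * nrm (e t - step_at (s k) t).
  have Xs := member_step_at t (ss k).
  rewrite (inner_nrm2 bX Xet) -[leLHS]subr0 -[X in _ - X <= _](e0 k) -(pairBr bP)//.
  rewrite (le_trans (ler_norm _))// (cauchy_schwarz bX)//; exact: memberB.
apply/eqP; rewrite -sqrf_eq0 eq_le sqr_ge0 andbT.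
have lim : nrm (e t) * nrm (e t - step_at (s k) t) @[k --> \oo] --> 0.
  by rewrite -[X in _ --> X](mulr0 (nrm (e t))); apply: cvgMr; exact: se.
rewrite -(cvg_lim _ lim)//; apply: limr_ge; first by apply/cvg_ex; exists 0.
by apply: nearW => k; exact: bound.
Qed.

End bochner_spaces.

(** * Weak derivatives and the spaces of the problem *)

Section weak_derivatives.
Context {R : realType} {n : nat}.
Local Notation V := 'rV[R]_n.+1.
Local Notation mT := (caratheodory_type (@leb_outer_measure R n.+1)).
Variable Omega : set V.
Hypotheses (oO : open Omega) (bO : bounded_set Omega).

Let mO : measurable (Omega : set mT) := leb_measurable_open oO.
Local Notation L2O := (L2 leb Omega).
Local Notation ae_eqO f g := {ae leb, forall x, Omega x -> f x = g x}.

Lemma L2_bounded_continuous (f : V -> R) (K : set V) : continuous f ->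
  compact K -> (forall x, ~ K x -> f x = 0) -> L2O f.
Proof.
move=> cf cK f0.
have mf : measurable_fun (Omega : set mT) (f : mT -> R).
  by apply: measurable_funTS; exact: leb_measurable_continuous.
have : compact (f @` K).
  by apply: continuous_compact => //; exact: continuous_subspaceT.
move=> /compact_bounded[M [_ /(_ (`|M| + 1))]].
rewrite (le_lt_trans (ler_norm M)) ?ltrDl// => /(_ isT) fM.
split=> //; apply: (@le_lt_trans _ _ (\int[leb]_(x in Omega) ((`|M| + 1) ^+ 2)%:E)%E).
  apply: ge0_le_integral => //.
  - by move=> x _; rewrite lee_fin sqr_ge0.
  - by apply/measurable_EFinP; exact: measurable_funX.
  move=> x _; rewrite lee_fin -[leLHS]real_normK ?num_real// lerXn2r ?nnegrE//.
  have [Kx|nK] := pselect (K x); first by apply: fM; exists x.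
  by rewrite f0// normr0 addr_ge0.
by rewrite integral_cst// lte_mul_pinfty// ?lee_fin ?sqr_ge0//; exact: leb_fin.
Qed.

Lemma L2_test_fun phi : test_fun Omega phi -> L2O phi.
Proof.
move=> [dphi _ cK _]; apply: (L2_bounded_continuous _ cK).
  by move=> x; exact: differentiable_continuous.
by move=> x nK; apply/eqP/negPn/negP => phix; apply: nK; exact: subset_closure.
Qed.

Lemma L2_pderiv i phi : test_fun Omega phi -> L2O (pderiv i phi).
Proof.
move=> [dphi cphi cK _]; apply: (L2_bounded_continuous (cphi i) cK) => x nK.
have near0 : \forall y \near x, phi y = (fun=> 0) y.
  have : open_nbhs x (~` closure [set x | phi x != 0]).
    by split => //; apply: closed_openC; exact: closed_closure.
  move=> /open_nbhs_nbhs; apply: filterS => y nKy.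
  by apply/eqP/negPn/negP => phiy; apply: nKy; exact: subset_closure.
by rewrite /pderiv (near_eq_derive _ near0) ?derive_cst.
Qed.

Lemma is_wpartial_unique i u v v' : is_wpartial Omega i u v ->
  is_wpartial Omega i u v' -> ae_eqO v v'.
Proof.
move=> [Lv vP] [Lv' vP'].
have := @fundamental_lemma _ _ Omega (fun x => -1 * v' x + v x) oO bO
  (L2_lin mO (-1) Lv' Lv).
have h phi : test_fun Omega phi -> ip leb Omega (fun x => -1 * v' x + v x) phi = 0.
  move=> tphi; have Lphi := L2_test_fun tphi; rewrite (ip_lin mO)//.
  have := vP _ tphi; have := vP' _ tphi => -> /oppr_inj ->.
  by rewrite mulN1r addNr.
move=> /(_ h); apply: aeS => x /[apply] /eqP.
by rewrite mulN1r addrC subr_eq0 => /eqP.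
Qed.

Lemma is_wpartial_lin i (a : R) (u v u' v' : V -> R) : L2O u -> L2O u' ->
  is_wpartial Omega i u v -> is_wpartial Omega i u' v' ->
  is_wpartial Omega i (a *: u + u') (fun x => a * v x + v' x).
Proof.
move=> Lu Lu' [Lv vP] [Lv' vP']; split; first exact: L2_lin.
move=> phi tphi; have Lphi := L2_test_fun tphi; have Ldphi := L2_pderiv i tphi.
rewrite (ip_lin mO a Lv Lv' Lphi).
change (ip leb Omega (fun x => a * u x + u' x) (pderiv i phi) =
        - (a * ip leb Omega v phi + ip leb Omega v' phi)).
rewrite (ip_lin mO a Lu Lu' Ldphi).
by rewrite vP// vP'// mulrN opprD.
Qed.

Lemma wpartialP i u : H1 Omega u -> is_wpartial Omega i u (wpartial Omega i u).
Proof. by move=> [_ /(_ i)] ex; exact: (xgetPex (fun=> 0) ex). Qed.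

Lemma L2_wpartial i u : H1 Omega u -> L2O (wpartial Omega i u).
Proof. by move=> /(wpartialP i)[]. Qed.

Lemma H1_lin (a : R) u v : H1 Omega u -> H1 Omega v -> H1 Omega (a *: u + v).
Proof.
move=> Hu Hv; split; first exact: (L2_lin mO a Hu.1 Hv.1).
move=> i; eexists; apply: is_wpartial_lin; [exact: Hu.1|exact: Hv.1| |]; exact: wpartialP.
Qed.

Lemma H1_0 : H1 Omega 0.
Proof.
split=> [|i]; first exact: L2_0.
exists (fun=> 0); split => [|phi tphi]; first exact: L2_0.
by rewrite /ip; under eq_Rintegral do rewrite mul0r; under [in RHS]eq_Rintegral do rewrite mul0r;
  rewrite Rintegral_cst// mul0r oppr0.
Qed.

(** The derivative of the combination is chosen independently of those of [u] and [v]. Only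
    uniqueness of weak derivatives relates the choices, hence the equality almost everywhere. *)
Lemma wpartial_lin i (a : R) u v : H1 Omega u -> H1 Omega v ->
  ae_eqO (wpartial Omega i (a *: u + v))
         (fun x => a * wpartial Omega i u x + wpartial Omega i v x).
Proof.
move=> Hu Hv; apply: (@is_wpartial_unique i (a *: u + v)).
  by apply: wpartialP; exact: H1_lin.
by apply: is_wpartial_lin; [exact: Hu.1|exact: Hv.1|exact: wpartialP|exact: wpartialP].
Qed.

Lemma L2mx_grad u : H1 Omega u -> L2mx leb Omega (grad Omega u).
Proof.
move=> Hu i j; have := L2_wpartial j Hu.
by congr L2; apply/funext => x; rewrite mxE.
Qed.

Lemma grad_lin (a : R) u v : H1 Omega u -> H1 Omega v ->
  ae_eqO (grad Omega (a *: u + v)) (fun x => a *: grad Omega u x + grad Omega v x).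
Proof.
move=> Hu Hv; apply: aeS (ae_forall_fin (fun i => wpartial_lin i a Hu Hv)) => x h Ox.
by apply/rowP => i; rewrite !mxE h.
Qed.

Lemma component_lin i (a : R) (u v : V -> V) :
  component i (a *: u + v) = a *: component i u + component i v.
Proof. by apply/funext => x; rewrite /component !mxE. Qed.

Lemma vH1_lin (a : R) u v : vH1 Omega u -> vH1 Omega v -> vH1 Omega (a *: u + v).
Proof. by move=> Hu Hv i; rewrite component_lin; exact: H1_lin. Qed.

Lemma vH1_0 : vH1 Omega 0.
Proof.
move=> i; have -> : component i (0 : V -> V) = 0 by apply/funext => x; rewrite /component mxE.
exact: H1_0.
Qed.

Lemma L2mx_vH1 u : vH1 Omega u -> L2mx leb Omega u.
Proof. by move=> Hu i j; rewrite ord1; exact: (Hu j).1. Qed.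

Lemma L2mx_vgrad u : vH1 Omega u -> L2mx leb Omega (vgrad Omega u).
Proof.
move=> Hu i j; have := L2_wpartial j (Hu i).
by congr L2; apply/funext => x; rewrite mxE.
Qed.

Lemma vgrad_lin (a : R) u v : vH1 Omega u -> vH1 Omega v ->
  ae_eqO (vgrad Omega (a *: u + v)) (fun x => a *: vgrad Omega u x + vgrad Omega v x).
Proof.
move=> Hu Hv; have h i j := wpartial_lin j a (Hu i) (Hv i).
have := ae_forall_fin (fun ij : 'I_n.+1 * 'I_n.+1 => h ij.1 ij.2).
apply: aeS => x {}h Ox; apply/matrixP => i j; rewrite !mxE component_lin.
exact: (h (i, j)).
Qed.

Lemma sympartE (A : 'M[R]_n.+1) i j :
  (2^-1 *: (A + A^T)) i j = 2^-1 * A i j + 2^-1 * A j i.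
Proof. by rewrite !mxE mulrDr. Qed.

Lemma L2mx_strain u : vH1 Omega u -> L2mx leb Omega (strain Omega u).
Proof.
move=> Hu i j; have Lg := L2mx_vgrad Hu.
have := L2_lin mO 2^-1 (Lg i j) (L2_lin mO 2^-1 (Lg j i) (L2_0 _ _)).
by congr L2; apply/funext => x; rewrite /strain sympartE addr0.
Qed.

Lemma sympart_lin (a : R) (A B : 'M[R]_n.+1) :
  2^-1 *: ((a *: A + B) + (a *: A + B)^T) =
  a *: (2^-1 *: (A + A^T)) + 2^-1 *: (B + B^T).
Proof. by apply/matrixP => i j; rewrite !mxE; ring. Qed.

Lemma strain_lin (a : R) u v : vH1 Omega u -> vH1 Omega v ->
  ae_eqO (strain Omega (a *: u + v)) (fun x => a *: strain Omega u x + strain Omega v x).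
Proof.
move=> Hu Hv; apply: aeS (vgrad_lin a Hu Hv) => x h Ox.
by rewrite /strain (h Ox) sympart_lin.
Qed.

(** The form behind [H1norm]: through it the triangle inequality and homogeneity of the norm follow
    from Cauchy-Schwarz. *)
Definition H1_inner (u v : V -> R) : R :=
  ip leb Omega u v + ipmx leb Omega (grad Omega u) (grad Omega v).

Definition vH1_inner (u v : V -> V) : R :=
  ipmx leb Omega u v + ipmx leb Omega (vgrad Omega u) (vgrad Omega v).

Lemma H1_inner_lin a u u' v : H1 Omega u -> H1 Omega u' -> H1 Omega v ->
  H1_inner (a *: u + u') v = a * H1_inner u v + H1_inner u' v.
Proof.
move=> Hu Hu' Hv; rewrite /H1_inner (ip_lin mO a Hu.1 Hu'.1 Hv.1).
have Lu := L2mx_grad Hu; have Lu' := L2mx_grad Hu'; have Lv := L2mx_grad Hv.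
have Luu' := L2mx_grad (H1_lin a Hu Hu').
rewrite (ae_eq_ipmx mO Luu' (L2mx_lin mO a Lu Lu') Lv (grad_lin a Hu Hu')).
by rewrite (ipmx_lin mO a Lu Lu' Lv) mulrDr addrACA.
Qed.

Lemma vH1_inner_lin a u u' v : vH1 Omega u -> vH1 Omega u' -> vH1 Omega v ->
  vH1_inner (a *: u + u') v = a * vH1_inner u v + vH1_inner u' v.
Proof.
move=> Hu Hu' Hv; rewrite /vH1_inner.
rewrite (ipmx_lin mO a (L2mx_vH1 Hu) (L2mx_vH1 Hu') (L2mx_vH1 Hv)).
have Lu := L2mx_vgrad Hu; have Lu' := L2mx_vgrad Hu'; have Lv := L2mx_vgrad Hv.
have Luu' := L2mx_vgrad (vH1_lin a Hu Hu').
rewrite (ae_eq_ipmx mO Luu' (L2mx_lin mO a Lu Lu') Lv (vgrad_lin a Hu Hu')).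
by rewrite (ipmx_lin mO a Lu Lu' Lv) mulrDr addrACA.
Qed.

Lemma H1normE u : H1norm Omega u = Num.sqrt (H1_inner u u).
Proof.
rewrite /H1norm /H1_inner /L2norm /L2mxnorm !sqr_sqrtr//.
- exact: ipmx_ge0.
- exact: ip_ge0.
Qed.

Lemma vH1normE u : vH1norm Omega u = Num.sqrt (vH1_inner u u).
Proof.
by rewrite /vH1norm /vH1_inner /L2mxnorm !sqr_sqrtr//; exact: ipmx_ge0.
Qed.

Lemma H1_innerC u v : H1_inner u v = H1_inner v u.
Proof. by rewrite /H1_inner ipC ipmxC. Qed.

Lemma vH1_innerC u v : vH1_inner u v = vH1_inner v u.
Proof.
rewrite /vH1_inner (@ipmxC _ _ _ leb Omega _ _ u v).
by rewrite (@ipmxC _ _ _ leb Omega _ _ (vgrad Omega u) (vgrad Omega v)).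
Qed.

Lemma H1_inner_ge0 u : 0 <= H1_inner u u.
Proof. by rewrite addr_ge0 ?ip_ge0 ?ipmx_ge0. Qed.

Lemma vH1_inner_ge0 u : 0 <= vH1_inner u u.
Proof. by rewrite addr_ge0 ?ipmx_ge0. Qed.

End weak_derivatives.

(** * The function spaces of the problem and the dual of [H^1_D] *)

Section problem_spaces.
Context {R : realType} {n : nat}.
Local Notation V := 'rV[R]_n.+1.
Variable P : Defs.data R n.
Hypothesis hP : standing_assumptions P.
Local Notation Omega := (domain P).
Local Notation Gamma := (bdry Omega).
Local Notation rho := (density (mat P)).
Local Notation surf := (@hausdorff R n.+1 n).

Lemma Omega_open : open Omega. Proof. by have [] := Omega_lipschitz hP. Qed.
Lemma Omega_bounded : bounded_set Omega. Proof. by have [] := Omega_lipschitz hP. Qed.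

Let oO := Omega_open.
Let bO := Omega_bounded.
Let mO : measurable (Omega : set (caratheodory_type leb_outer_measure)) :=
  leb_measurable_open oO.
Let mG : measurable (Gamma : set (caratheodory_type (@hausdorff_outer_measure R n.+1 n))) :=
  measurable_bdry Omega.

Lemma GammaD_bdry : GammaD P `<=` Gamma.
Proof. by have [[U _ ->] _ _ _] := Gamma_partition hP; exact: subIsetr. Qed.

Lemma trace_lin (a : R) u v : H1 Omega u -> H1 Omega v ->
  {ae surf, forall x, Gamma x ->
    Defs.trace P (a *: u + v) x = a * Defs.trace P u x + Defs.trace P v x}.
Proof. by have [_ + _ _] := trace_ok hP; apply. Qed.

Lemma L2_trace u : H1 Omega u -> L2 surf Gamma (Defs.trace P u).
Proof. by have [+ _ _ _] := trace_ok hP; apply. Qed.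

Lemma vtrace_lin (a : R) u v : vH1 Omega u -> vH1 Omega v ->
  {ae surf, forall x, Gamma x -> vtrace P (a *: u + v) x = a *: vtrace P u x + vtrace P v x}.
Proof.
move=> Hu Hv; apply: aeS (ae_forall_fin (fun i => trace_lin a (Hu i) (Hv i))) => x h Gx.
by apply/rowP => i; rewrite !mxE component_lin (h i Gx).
Qed.

Lemma trace0 : {ae surf, forall x, Gamma x -> Defs.trace P 0 x = 0}.
Proof.
have H0 := H1_0 oO.
have := trace_lin 1 H0 H0; rewrite scaler0 addr0; apply: aeS => x /[apply] /eqP.
by rewrite mul1r addrC -subr_eq subrr eq_sym => /eqP.
Qed.

Lemma vtrace0 : {ae surf, forall x, Gamma x -> vtrace P 0 x = 0}.
Proof.
apply: aeS trace0 => x h Gx; apply/rowP => i; rewrite !mxE.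
have -> : component i (0 : V -> V) = 0 by apply/funext => y; rewrite /component mxE.
exact: h.
Qed.

Lemma gauge_lin (a : R) u v : H1 Omega u -> H1 Omega v ->
  gauge P (a *: u + v) = a * gauge P u + gauge P v.
Proof. by have [+ _ _] := gauge_ok hP; apply. Qed.

Lemma H1G_inner_product :
  @inner_product _ (H1G_space P) (H1_inner Omega : carrier (H1G_space P) -> _).
Proof.
split => /=.
- split; first exact: H1_0.
  have H0 := H1_0 oO; have := gauge_lin 1 H0 H0.
  rewrite scaler0 addr0 mul1r => /eqP.
  by rewrite addrC -subr_eq subrr eq_sym => /eqP.
- move=> a x y [Hx gx] [Hy gy]; split; first exact: H1_lin.
  by rewrite gauge_lin// gx gy mulr0 addr0.
- by move=> a x x' y [Hx _] [Hx' _] [Hy _]; exact: H1_inner_lin.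
- by move=> x y _ _; exact: H1_innerC.
- by move=> x _; exact: H1_inner_ge0.
- by move=> x; exact: H1normE.
Qed.

Lemma H1D_inner_product :
  @inner_product _ (H1D_space P) (vH1_inner Omega : carrier (H1D_space P) -> _).
Proof.
split => /=.
- split; first exact: vH1_0.
  by apply: aeS vtrace0 => x h /GammaD_bdry; exact: h.
- move=> a x y [Hx tx] [Hy ty]; split; first exact: vH1_lin.
  apply: aeS3 (vtrace_lin a Hx Hy) tx ty => s h hx hy Ds.
  by rewrite (h (GammaD_bdry Ds)) (hx Ds) (hy Ds) scaler0 addr0.
- by move=> a x x' y [Hx _] [Hx' _] [Hy _]; exact: vH1_inner_lin.
- by move=> x y _ _; exact: vH1_innerC.
- by move=> x _; exact: vH1_inner_ge0.
- by move=> x; exact: vH1normE.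
Qed.

Lemma L2mx_rho (u : V -> V) : L2mx leb Omega u -> L2mx leb Omega (fun x => rho x *: u x).
Proof.
move=> Lu i j; have := L2_Linfty_mul mO (rho_Linfty (material_ok hP)) (Lu i j).
by congr L2; apply/funext => x; rewrite mxE.
Qed.

Lemma ip_rho_lin (a : R) u u' v : L2mx leb Omega u -> L2mx leb Omega u' ->
  L2mx leb Omega v -> ip_rho P (a *: u + u') v = a * ip_rho P u v + ip_rho P u' v.
Proof.
move=> Lu Lu' Lv; rewrite /ip_rho -(ipmx_lin mO a (L2mx_rho Lu) (L2mx_rho Lu') Lv).
congr ipmx; apply/funext => x.
change (rho x *: (a *: u x + u' x) = a *: (rho x *: u x) + rho x *: u' x).
by rewrite scalerDr !scalerA mulrC.
Qed.

Lemma ip_rhoC u v : ip_rho P u v = ip_rho P v u.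
Proof.
apply: eq_Rintegral => x _; apply: eq_bigr => i _; apply: eq_bigr => j _.
by rewrite !mxE; ring.
Qed.

Lemma rho_ge0 : {ae leb, forall x, Omega x -> 0 <= rho x}.
Proof.
have [rho0 rho00] := rho_pos (material_ok hP); apply: aeS => x /[apply].
by apply: le_trans; exact: ltW.
Qed.

Lemma ip_rho_ge0 u : L2mx leb Omega u -> 0 <= ip_rho P u u.
Proof.
move=> Lu; rewrite /ip_rho (ipmxE mO (L2mx_rho Lu) Lu).
apply: sumr_ge0 => i _; apply: sumr_ge0 => j _.
have Luij := Lu i j; have Lru := L2mx_rho Lu i j.
apply: (Rintegral_ae_ge0 mO); first exact: (measurable_funM Lru.1 Luij.1).
apply: aeS rho_ge0 => x /[apply] r0; rewrite mxE -mulrA mulr_ge0//.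
exact: sqr_ge0.
Qed.

Lemma L2rho_inner_product :
  @inner_product _ (L2rho_space P) (ip_rho P : carrier (L2rho_space P) -> _).
Proof.
split.
- exact: (L2mx_0 leb Omega).
- by move=> a x y Lx Ly; exact: (L2mx_lin mO a Lx Ly).
- by move=> a x x' y; exact: ip_rho_lin.
- by move=> x y _ _; exact: ip_rhoC.
- by move=> x; exact: ip_rho_ge0.
- by [].
Qed.

Lemma L20_inner_product :
  @inner_product _ (L20_Gamma P) (ip_Gamma P : carrier (L20_Gamma P) -> _).
Proof.
split.
- split; first exact: L2_0.
    change (surf.-integrable Gamma (cst 0%E)); exact: integrable0.
  by rewrite Rintegral_cst// mul0r.
- move=> a x y [Lx ix x0] [Ly iy y0]; split.
  + exact: (L2_lin mG a Lx Ly).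
  + exact: (intgD mG (intgZ mG a ix) iy).
  + change (\int[surf]_(s in Gamma) (a * x s + y s) = 0).
    rewrite RintegralD//; last exact: (intgZ mG a ix).
    by rewrite RintegralZl// x0 y0 mulr0 addr0.
- by move=> a x x' y [Lx _ _] [Lx' _ _] [Ly _ _]; exact: (ip_lin mG a Lx Lx' Ly).
- by move=> x y _ _; exact: ipC.
- by move=> x _; exact: ip_ge0.
- by [].
Qed.

Let sD : seminormed (H1D_space P) := inner_seminormed H1D_inner_product.

Definition dual_values (l : (V -> V) -> R) : set R :=
  [set `|l w| | w in [set w | member (H1D_space P) w /\ vH1norm Omega w <= 1]].

Lemma dual_has_sup l : member (HDdual_space P) l -> has_sup (dual_values l).
Proof.
move=> [_ [c lc]]; split.
  exists `|l 0|; exists 0 => //=; split; first exact: (member0 sD).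
  by rewrite [vH1norm _ _](nrm0 sD).
exists `|c| => _ [w [Dw w1] <-]; apply: (le_trans (lc _ Dw)).
have w0 : 0 <= vH1norm Omega w by exact: (nrm_ge0 sD Dw).
apply: (@le_trans _ _ (`|c| * vH1norm Omega w)); first by rewrite ler_wpM2r// ler_norm.
by rewrite ler_piMr.
Qed.

Lemma dual_le l M : member (HDdual_space P) l ->
  (forall w, member (H1D_space P) w -> vH1norm Omega w <= 1 -> `|l w| <= M) ->
  @nrm _ (HDdual_space P) l <= M.
Proof.
move=> Xl lM; apply: ge_sup; first by have [] := dual_has_sup Xl.
by move=> _ [w [Dw w1] <-]; exact: lM.
Qed.

Lemma dual_bound l w : member (HDdual_space P) l -> member (H1D_space P) w ->
  `|l w| <= @nrm _ (HDdual_space P) l * vH1norm Omega w.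
Proof.
move=> Xl Dw; have [llin [c lc]] := Xl.
have w0 : 0 <= vH1norm Omega w by exact: (nrm_ge0 sD Dw).
(* A field of norm zero cannot be normalized; for it the boundedness built into [HDdual_space]
   already forces [l w = 0]. *)
have [w00|wn0] := eqVneq (vH1norm Omega w) 0.
  by have := lc _ Dw; rewrite w00 !mulr0.
have {}w0 : 0 < vH1norm Omega w by rewrite lt_neqAle eq_sym wn0.
have D0 := member0 sD.
have l0 : l 0 = 0.
  have := llin 1 0 0 D0 D0; rewrite scaler0 addr0 mul1r => /eqP.
  by rewrite addrC -subr_eq subrr eq_sym => /eqP.
have lZ a : l (a *: w) = a * l w.
  by have := llin a w 0 Dw D0; rewrite addr0 l0 addr0.
have Dw' := memberZ (vH1norm Omega w)^-1 sD Dw.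
have n1 : vH1norm Omega ((vH1norm Omega w)^-1 *: w) <= 1.
  by rewrite [vH1norm _ _](nrmZ sD _ Dw) ger0_norm ?invr_ge0 ?(ltW w0)// mulVf.
have : `|l ((vH1norm Omega w)^-1 *: w)| <= @nrm _ (HDdual_space P) l.
  apply: ub_le_sup; first by have [] := dual_has_sup Xl.
  by exists ((vH1norm Omega w)^-1 *: w).
by rewrite lZ normrM ger0_norm ?invr_ge0 ?(ltW w0)// mulrC ler_pdivrMr.
Qed.

Lemma dual_nrm_ge0 l : member (HDdual_space P) l -> 0 <= @nrm _ (HDdual_space P) l.
Proof.
move=> Xl; apply: (le_trans (normr_ge0 (l 0))).
apply: ub_le_sup; first by have [] := dual_has_sup Xl.
exists 0 => //; split; first exact: (member0 sD).
by rewrite [vH1norm _ _](nrm0 sD).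
Qed.

(** The dual norm is a supremum over [H^1_D], while the elements of [HDdual_space] are functions of
    arbitrary fields. Agreement on [H^1_D] therefore means distance zero, not equality. *)
Lemma dual_eq_nrm0 l l' : member (HDdual_space P) l ->
  (forall w, member (H1D_space P) w -> l' w = l w) ->
  member (HDdual_space P) l' /\ @nrm _ (HDdual_space P) (l' - l) = 0.
Proof.
move=> Xl ll'; have [llin [c lc]] := Xl.
have Xl' : member (HDdual_space P) l'.
  split; last by exists c => w Dw; rewrite ll'//; exact: lc.
  by move=> a w w' Dw Dw'; rewrite !ll' ?llin//; exact: (member_lin sD a Dw Dw').
split => //.
have Xll' : member (HDdual_space P) (l' - l).
  split; last by exists 0 => w Dw; rewrite mul0r !fctE ll'// subrr normr0.
  move=> a w w' Dw Dw'; rewrite !fctE !ll'// ?subrr ?mulr0 ?addr0//.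
  exact: (member_lin sD a Dw Dw').
apply/eqP; rewrite eq_le dual_nrm_ge0// andbT; apply: dual_le => // w Dw _.
by rewrite !fctE ll'// subrr normr0.
Qed.

Lemma HDdual_seminormed : seminormed (HDdual_space P).
Proof.
have lin (a : R) l l' : member (HDdual_space P) l -> member (HDdual_space P) l' ->
    member (HDdual_space P) (a *: l + l').
  move=> [llin [c lc]] [llin' [c' lc']]; split.
    move=> k w w' Dw Dw'.
    change (a * l (k *: w + w') + l' (k *: w + w') =
            k * (a * l w + l' w) + (a * l w' + l' w')).
    by rewrite llin// llin'//; ring.
  exists (`|a| * c + c') => w Dw; change (`|a * l w + l' w| <= (`|a| * c + c') * vH1norm Omega w).
  rewrite (le_trans (ler_normD _ _))// mulrDl lerD ?lc'// normrM -mulrA.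
  by rewrite ler_wpM2l// lc.
have X0 : member (HDdual_space P) 0.
  split; last by exists 0 => w _; rewrite normr0 mul0r.
  by move=> a w w' _ _; rewrite mulr0 addr0.
have XZ a l : member (HDdual_space P) l -> member (HDdual_space P) (a *: l).
  by move=> Xl; have := lin a _ _ Xl X0; rewrite addr0.
have nZ a l : member (HDdual_space P) l ->
    @nrm _ (HDdual_space P) (a *: l) <= `|a| * @nrm _ (HDdual_space P) l.
  move=> Xl; apply: dual_le; first exact: XZ.
  move=> w Dw w1; change (`|a * l w| <= `|a| * @nrm _ (HDdual_space P) l).
  rewrite normrM ler_wpM2l// (le_trans (dual_bound Xl Dw))// ler_piMr//.
  exact: dual_nrm_ge0.
split => //.
- exact: dual_nrm_ge0.
- move=> a l Xl; apply/eqP; rewrite eq_le nZ//=.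
  have [->|a0] := eqVneq a 0; first by rewrite normr0 mul0r dual_nrm_ge0//; exact: XZ.
  have := nZ a^-1 _ (XZ a _ Xl); rewrite scalerA mulVf// scale1r normfV.
  by rewrite ler_pdivlMl ?normr_gt0.
- move=> l l' Xl Xl'; apply: dual_le.
    by have := lin 1 _ _ Xl Xl'; rewrite scale1r.
  move=> w Dw w1; change (`|l w + l' w| <= @nrm _ (HDdual_space P) l + @nrm _ (HDdual_space P) l').
  apply: (le_trans (ler_normD _ _)); apply: lerD.
    rewrite (le_trans (dual_bound Xl Dw))// ler_piMr//; exact: dual_nrm_ge0.
  rewrite (le_trans (dual_bound Xl' Dw))// ler_piMr//; exact: dual_nrm_ge0.
Qed.

Lemma dual_pairing : @pairing _ (HDdual_space P) (H1D_space P) (fun l w => l w).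
Proof.
split => //.
- by move=> a l w w' [llin _] Dw Dw'; exact: llin.
- by exists 1 => // l w Xl Dw; rewrite mul1r; exact: dual_bound.
Qed.

End problem_spaces.

(** * The material law *)

Section material_fields.
Context {R : realType} {n : nat}.
Local Notation V := 'rV[R]_n.+1.
Local Notation M := 'M[R]_n.+1.
Variable m : material R n.

Lemma Cmul_lin x (a : R) (A B : M) : Cmul m x (a *: A + B) = a *: Cmul m x A + Cmul m x B.
Proof.
apply/matrixP => i j; rewrite !mxE mulr_sumr -big_split; apply: eq_bigr => k _ /=.
rewrite mulr_sumr -big_split; apply: eq_bigr => l _ /=; rewrite !mxE; ring.
Qed.

Lemma Emul_lin x (a : R) (b c : V) : Emul m x (a *: b + c) = a *: Emul m x b + Emul m x c.
Proof.
apply/matrixP => i j; rewrite !mxE mulr_sumr -big_split; apply: eq_bigr => k _ /=.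
rewrite !mxE; ring.
Qed.

Lemma ETmul_lin x (a : R) (A B : M) : ETmul m x (a *: A + B) = a *: ETmul m x A + ETmul m x B.
Proof.
apply/rowP => k; rewrite !mxE mulr_sumr -big_split; apply: eq_bigr => i _ /=.
rewrite mulr_sumr -big_split; apply: eq_bigr => l _ /=; rewrite !mxE; ring.
Qed.

Lemma kmul_lin x (a : R) (b c : V) : kmul m x (a *: b + c) = a *: kmul m x b + kmul m x c.
Proof. by rewrite /kmul mulmxDl scalemxAl. Qed.

Lemma frobDl p q (A B C : 'M[R]_(p, q)) : frob (A + B) C = frob A C + frob B C.
Proof.
rewrite /frob -big_split; apply: eq_bigr => i _ /=; rewrite -big_split.
by apply: eq_bigr => j _ /=; rewrite mxE mulrDl.
Qed.

Lemma frobNl p q (A C : 'M[R]_(p, q)) : frob (- A) C = - frob A C.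
Proof.
rewrite /frob -sumrN; apply: eq_bigr => i _ /=; rewrite -sumrN.
by apply: eq_bigr => j _ /=; rewrite mxE mulNr.
Qed.

Lemma frob_Emul x (b : V) (A : M) : frob (Emul m x b) A = frob (ETmul m x A) b.
Proof.
rewrite /frob [RHS]big_ord1.
under eq_bigr => i _ do under eq_bigr => j _ do rewrite mxE mulr_suml.
under [RHS]eq_bigr => k _ do rewrite mxE mulr_suml.
rewrite [RHS]exchange_big; apply: eq_bigr => i _ /=.
under [RHS]eq_bigr => k _ do rewrite mulr_suml.
rewrite [RHS]exchange_big; apply: eq_bigr => j _ /=; apply: eq_bigr => k _; ring.
Qed.

Lemma frob_kmul x (b c : V) : is_symmx (permittivity m x) ->
  frob (kmul m x b) c = frob (kmul m x c) b.
Proof.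
rewrite /is_symmx => kx; rewrite /kmul kx /frob !big_ord1.
under eq_bigr => j _ do rewrite mxE mulr_suml.
under [RHS]eq_bigr => j _ do rewrite mxE mulr_suml.
rewrite exchange_big; apply: eq_bigr => i _; apply: eq_bigr => j _ /=.
by rewrite -[in LHS]kx mxE; ring.
Qed.

Variable Omega : set V.
Hypotheses (oO : open Omega) (bO : bounded_set Omega).
Hypothesis mat_ok : admissible_material m Omega.
Let mO : measurable (Omega : set (caratheodory_type leb_outer_measure)) :=
  leb_measurable_open oO.

Lemma L2mx_Cmul (A : V -> M) : L2mx leb Omega A -> L2mx leb Omega (fun x => Cmul m x (A x)).
Proof.
move=> LA i j.
have := L2_sum mO (index_enum 'I_n.+1) (fun k => L2_sum mO (index_enum 'I_n.+1)
  (fun l => L2_Linfty_mul mO (stiffness_Linfty mat_ok i j k l) (LA k l))).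
by congr L2; apply/funext => x; rewrite mxE.
Qed.

Lemma L2mx_Emul (b : V -> V) : L2mx leb Omega b -> L2mx leb Omega (fun x => Emul m x (b x)).
Proof.
move=> Lb i j; have := L2_sum mO (index_enum 'I_n.+1)
  (fun k => L2_Linfty_mul mO (piezo_Linfty mat_ok i j k) (Lb 0 k)).
by congr L2; apply/funext => x; rewrite mxE.
Qed.

Lemma L2mx_ETmul (A : V -> M) : L2mx leb Omega A -> L2mx leb Omega (fun x => ETmul m x (A x)).
Proof.
move=> LA i k.
have := L2_sum mO (index_enum 'I_n.+1) (fun i => L2_sum mO (index_enum 'I_n.+1)
  (fun j => L2_Linfty_mul mO (piezo_Linfty mat_ok i j k) (LA i j))).
by congr L2; apply/funext => x; rewrite mxE.
Qed.

Lemma L2mx_kmul (b : V -> V) : L2mx leb Omega b -> L2mx leb Omega (fun x => kmul m x (b x)).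
Proof.
move=> Lb i j; have := L2_sum mO (index_enum 'I_n.+1)
  (fun k => L2_Linfty_mul mO (kappa_Linfty mat_ok j k) (Lb i k)).
congr L2; apply/funext => x; rewrite mxE; apply: eq_bigr => k _.
by rewrite mxE mulrC.
Qed.

Local Notation stress := (stress_field m Omega).
Local Notation elec := (disp_field m Omega).

Lemma L2mxD p q (f g : V -> 'M[R]_(p, q)) : L2mx leb Omega f -> L2mx leb Omega g ->
  L2mx leb Omega (fun x => f x + g x).
Proof.
move=> Lf Lg; have := L2mx_lin mO 1 Lf Lg; congr L2mx.
by apply/funext => x; rewrite scale1r.
Qed.

Lemma L2mxN p q (f : V -> 'M[R]_(p, q)) : L2mx leb Omega f ->
  L2mx leb Omega (fun x => - f x).
Proof.
move=> Lf; have := L2mx_lin mO (-1) Lf (@L2mx_0 _ _ _ leb Omega p q).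
by congr L2mx; apply/funext => x; rewrite scaleN1r addr0.
Qed.

Lemma L2mx_stress u psi : vH1 Omega u -> H1 Omega psi -> L2mx leb Omega (stress u psi).
Proof.
move=> Hu Hpsi; apply: L2mxD; first exact/L2mx_Cmul/L2mx_strain.
exact/L2mx_Emul/L2mx_grad.
Qed.

Lemma L2mx_elec u psi : vH1 Omega u -> H1 Omega psi -> L2mx leb Omega (elec u psi).
Proof.
move=> Hu Hpsi; apply: L2mxD; first exact/L2mx_ETmul/L2mx_strain.
exact/L2mxN/L2mx_kmul/L2mx_grad.
Qed.

Lemma stress_lin (a : R) u u' psi psi' : vH1 Omega u -> vH1 Omega u' ->
  H1 Omega psi -> H1 Omega psi' -> {ae leb, forall x, Omega x ->
  stress (a *: u + u') (a *: psi + psi') x = a *: stress u psi x + stress u' psi' x}.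
Proof.
move=> Hu Hu' Hpsi Hpsi'.
apply: aeS2 (strain_lin oO bO a Hu Hu') (grad_lin oO bO a Hpsi Hpsi') => x h1 h2 Ox.
rewrite /stress_field (h1 Ox) (h2 Ox).
move: (strain Omega u x) (strain Omega u' x) (grad Omega psi x) (grad Omega psi' x).
by move=> A A' g g'; rewrite Cmul_lin Emul_lin scalerDr addrACA.
Qed.

Lemma elec_lin (a : R) u u' psi psi' : vH1 Omega u -> vH1 Omega u' ->
  H1 Omega psi -> H1 Omega psi' -> {ae leb, forall x, Omega x ->
  elec (a *: u + u') (a *: psi + psi') x = a *: elec u psi x + elec u' psi' x}.
Proof.
move=> Hu Hu' Hpsi Hpsi'.
apply: aeS2 (strain_lin oO bO a Hu Hu') (grad_lin oO bO a Hpsi Hpsi') => x h1 h2 Ox.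
rewrite /disp_field (h1 Ox) (h2 Ox).
move: (strain Omega u x) (strain Omega u' x) (grad Omega psi x) (grad Omega psi' x).
by move=> A A' g g'; rewrite ETmul_lin kmul_lin scalerBr opprD addrACA.
Qed.

(* The coupling terms enter the form [a] antisymmetrically, so that the symmetry
   holds for the sum of the two energies instead of their difference. *)
Lemma reciprocity u psi p xi : vH1 Omega u -> H1 Omega psi -> vH1 Omega p -> H1 Omega xi ->
  ipmx leb Omega (stress u psi) (strain Omega p) +
  ipmx leb Omega (elec u psi) (grad Omega xi) =
  ipmx leb Omega (stress p xi) (strain Omega u) +
  ipmx leb Omega (elec p xi) (grad Omega psi).
Proof.
move=> Hu Hpsi Hp Hxi.
have Lsu := L2mx_stress Hu Hpsi; have Lsp := L2mx_stress Hp Hxi.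
have Leu := L2mx_elec Hu Hpsi; have Lep := L2mx_elec Hp Hxi.
have Lu := L2mx_strain oO Hu; have Lp := L2mx_strain oO Hp.
have Lpsi := L2mx_grad Hpsi; have Lxi := L2mx_grad Hxi.
apply: (ae_frobD_ipmx mO Lsu Lsp Lp Lu Leu Lep Lxi Lpsi).
apply: aeS2 (stiffness_sym mat_ok) (kappa_sym mat_ok) => x hC hk Ox.
have [_ hCx] := hC Ox (strain Omega u x) (strain Omega p x).
have hkx := frob_kmul (grad Omega psi x) (grad Omega xi x) (hk Ox).
move: hCx hkx; rewrite /stress_field /disp_field.
move: (strain Omega u x) (strain Omega p x) (grad Omega psi x) (grad Omega xi x) => A B g h.
move=> hCx hkx; rewrite !frobDl !frobNl !frob_Emul hkx hCx (frobC A); ring.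
Qed.

Lemma aform_lin (P : Defs.data R n) (a : R) u u' psi psi' w phi :
  mat P = m -> domain P = Omega -> vH1 Omega u -> vH1 Omega u' ->
  H1 Omega psi -> H1 Omega psi' -> vH1 Omega w -> H1 Omega phi ->
  aform P (a *: u + u') (a *: psi + psi') w phi =
  a * aform P u psi w phi + aform P u' psi' w phi.
Proof.
move=> Pm PO Hu Hu' Hpsi Hpsi' Hw Hphi; rewrite /aform Pm PO.
have Lw := L2mx_strain oO Hw; have Lphi := L2mx_grad Hphi.
have Ls := L2mx_stress Hu Hpsi; have Ls' := L2mx_stress Hu' Hpsi'.
have Le := L2mx_elec Hu Hpsi; have Le' := L2mx_elec Hu' Hpsi'.
have HL := vH1_lin oO bO a Hu Hu'; have HL' := H1_lin oO bO a Hpsi Hpsi'.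
exact: (ipmx_form_lin mO (L2mx_stress HL HL') Ls Ls' Lw (L2mx_elec HL HL') Le Le' Lphi
  (stress_lin a Hu Hu' Hpsi Hpsi') (elec_lin a Hu Hu' Hpsi Hpsi')).
Qed.

End material_fields.

(** * State and adjoint equations *)

Section optimal_control.
Context {R : realType} {n : nat}.
Local Notation V := 'rV[R]_n.+1.
Variable P : Defs.data R n.
Hypothesis hP : standing_assumptions P.
Local Notation Omega := (domain P).
Local Notation Gamma := (bdry Omega).
Local Notation T := (horizon P).
Local Notation I := (`[0, T]%classic : set R).
Local Notation rho := (density (mat P)).
Local Notation surf := (@hausdorff R n.+1 n).
Local Notation lam := (@lebesgue_measure R).
Local Notation stress := (stress_field (mat P) Omega).
Local Notation elec_disp := (disp_field (mat P) Omega).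

Let oO := Omega_open hP.
Let bO := Omega_bounded hP.
Let mO : measurable (Omega : set (caratheodory_type leb_outer_measure)) :=
  leb_measurable_open oO.
Let mG : measurable (Gamma : set (caratheodory_type (@hausdorff_outer_measure R n.+1 n))) :=
  measurable_bdry Omega.
Let bZ := L20_inner_product P.
Let bL := L2rho_inner_product hP.
Let bD := H1D_inner_product hP.
Let bG := H1G_inner_product hP.
Let sZ := inner_seminormed bZ.
Let sL := inner_seminormed bL.
Let sD := inner_seminormed bD.
Let sG := inner_seminormed bG.
Let sH := HDdual_seminormed hP.

Lemma Zspace_lin (a : R) z y : Zspace P z -> Zspace P y -> Zspace P (a *: z + y).
Proof.
move=> [[Cz [dz zdz]] z0] [[Cy [dy ydy]] y0]; split; first split.
- exact: C0T_lin.
- by exists (a *: dz + dy); apply: (wdot_lin bZ).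
apply: aeS2 z0 y0 => x hz hy Gx.
change (a * z 0 x + y 0 x = 0).
by rewrite hz// hy// mulr0 addr0.
Qed.

Lemma zdotP z : Zspace P z -> is_wdot T (z : R -> carrier (L20_Gamma P)) (zdot P z).
Proof. by move=> [[_ ex] _]; exact: (xgetPex (fun=> 0) ex). Qed.

Lemma zdot_lin (a : R) z y : Zspace P z -> Zspace P y ->
  {ae lam, forall t, I t ->
     @nrm _ (L20_Gamma P) (zdot P (a *: z + y) t - (a *: zdot P z + zdot P y) t) = 0}.
Proof.
move=> Zz Zy; have Zzy := Zspace_lin a Zz Zy.
apply: (@wdot_ae_unique _ _ (L20_Gamma P) _ bZ (a *: z + y)).
- exact: horizon_gt0 hP.
- exact: Zzy.1.1.1.
- exact: zdotP.
- by apply: (wdot_lin bZ); exact: zdotP.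
Qed.

Lemma L2mx_H1D u : member (H1D_space P) u -> L2mx leb Omega u.
Proof. by move=> [Hu _]; exact: L2mx_vH1. Qed.

Lemma zero_in_Omega_lin (a : R) (u v : V -> V) : zero_in_Omega P u -> zero_in_Omega P v ->
  zero_in_Omega P (a *: u + v).
Proof.
move=> u0 v0; apply: aeS2 u0 v0 => x hu hv Ox.
by change (a *: u x + v x = 0); rewrite hu// hv// scaler0 addr0.
Qed.

Lemma rho_embed_lin (a : R) (u v : R -> V -> V) t :
  member (L2rho_space P) (u t) -> member (L2rho_space P) (v t) ->
  forall w, member (H1D_space P) w ->
  rho_embed P ((a *: u + v) t) w =
  ((a *: (fun s => rho_embed P (u s)) + (fun s => rho_embed P (v s))) t) w.
Proof.
move=> Lu Lv w /L2mx_H1D Lw.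
exact: (ip_rho_lin hP a Lu Lv Lw).
Qed.

(** Superposition; combined with the uniqueness clause of [state_operator] it yields linearity of
    [S]. The delicate clause is the regularity of the combined velocity and displacement as curves
    in the dual space. *)
Lemma state_solution_lin (a : R) z y u psi v phi : Zspace P z -> Zspace P y ->
  state_solution P z u psi -> state_solution P y v phi ->
  state_solution P (a *: z + y) (a *: u + v) (a *: psi + phi).
Proof.
move=> Zz Zy [du [ddu [Cu [C1u [C2u [Cpsi [u0 [du0 eqz]]]]]]]]
  [dv [ddv [Cv [C1v [C2v [Cphi [v0 [dv0 eqy]]]]]]]].
have [Lu Ldu _] := C1u; have [Lv Ldv _] := C1v.
have Cpsi' := C0T_lin sG a Cpsi Cphi.
exists (a *: du + dv), (a *: ddu + ddv); split; first exact: C0T_lin.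
split; first exact: C1T_lin.
(* Outside [H^1_D] the integral behind [rho_embed] may fail to be additive, so the embedding of a
   combination is compared with the combination of embeddings up to seminorm zero. *)
have cong (f g : R -> V -> V) : C0T T (L2rho_space P) f -> C0T T (L2rho_space P) g ->
    C0T T (HDdual_space P) (fun t => rho_embed P (f t)) ->
    C0T T (HDdual_space P) (fun t => rho_embed P (g t)) ->
    forall t, I t -> member (HDdual_space P) (rho_embed P ((a *: f + g) t)) /\
     @nrm _ (HDdual_space P) (rho_embed P ((a *: f + g) t) -
       (a *: (fun s => rho_embed P (f s)) + (fun s => rho_embed P (g s))) t) = 0.
  move=> Lf Lg Cf Cg t It; apply: (dual_eq_nrm0 hP).
    exact: (member_lin sH a (Cf.1 t It) (Cg.1 t It)).
  exact: (rho_embed_lin _ (Lf.1 t It) (Lg.1 t It)).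
have [[Cru Crdu d1u] [_ Cddu d2u]] := C2u; have [[Crv Crdv d1v] [_ Cddv d2v]] := C2v.
split.
  split.
    apply: (C1T_congr sH (cong _ _ Lu Lv Cru Crv) (cong _ _ Ldu Ldv Crdu Crdv)).
    exact: (C1T_lin sH a C2u.1 C2v.1).
  have L := C1T_lin sH a C2u.2 C2v.2; have [_ CL _] := L.
  apply: (C1T_congr sH (cong _ _ Ldu Ldv Crdu Crdv) _ L) => t It.
  by split; [exact: (CL.1 t It)|rewrite subrr (nrm0 sH)].
split; first exact: Cpsi'.
split; first exact: zero_in_Omega_lin.
split; first exact: zero_in_Omega_lin.
move=> t It w f Dw Gf; have [Hw _] := Dw; have [Hf _] := Gf.
have [Hut _] := Cu.1 t It; have [Hvt _] := Cv.1 t It.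
have [Hpt _] := Cpsi.1 t It; have [Hft _] := Cphi.1 t It.
change (a * ddu t w + ddv t w + aform P (a *: u t + v t) (a *: psi t + phi t) w f =
        - ip_Gamma P (fun x => a * z t x + y t x) (Defs.trace P f)).
rewrite (aform_lin oO bO (material_ok hP) a erefl erefl Hut Hvt Hpt Hft Hw Hf).
have [Lz _ _] := Zz.1.1.1 t It; have [Ly _ _] := Zy.1.1.1 t It.
have -> : ip_Gamma P (fun x => a * z t x + y t x) (Defs.trace P f) =
  a * ip_Gamma P (z t) (Defs.trace P f) + ip_Gamma P (y t) (Defs.trace P f).
  exact: (ip_lin mG a Lz Ly (L2_trace hP Hf)).
have E1 := eqz t It w f Dw Gf; have E2 := eqy t It w f Dw Gf.
have combine (d A c e B k : R) : d + A = - c -> e + B = - k ->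
    a * d + e + (a * A + B) = - (a * c + k).
  by move=> h1 h2; rewrite opprD -mulrN -h1 -h2; ring.
exact: combine.
Qed.

Lemma ae_eq_ip_rho u u' v : L2mx leb Omega u -> L2mx leb Omega u' -> L2mx leb Omega v ->
  {ae leb, forall x, Omega x -> u x = u' x} -> ip_rho P u v = ip_rho P u' v.
Proof.
move=> Lu Lu' Lv uu'; apply: (ae_eq_ipmx mO (L2mx_rho hP Lu) (L2mx_rho hP Lu') Lv).
by apply: aeS uu' => x /[apply] ->.
Qed.

Lemma ip_rho_zero u v : L2mx leb Omega u -> L2mx leb Omega v -> zero_in_Omega P u ->
  ip_rho P u v = 0.
Proof.
move=> Lu Lv u0; rewrite (@ae_eq_ip_rho u 0 v Lu (@L2mx_0 _ _ _ leb Omega _ _) Lv u0).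
rewrite /ip_rho /ipmx; under eq_Rintegral => x _.
  rewrite (_ : frob _ _ = 0); last first.
    by rewrite /frob big1// => i _; rewrite big1// => j _; rewrite !mxE mulr0 mul0r.
  over.
by rewrite Rintegral_cst// mul0r.
Qed.

(** An essential upper bound [M] of the density embeds [H^1_D] into [L^2_rho] with constant
    [Num.sqrt M]. The tracking term and the source of the adjoint equation are measured in the
    weaker space. *)
Lemma Uspace_L2rho u : Uspace P u -> C0T T (L2rho_space P) u.
Proof.
move=> [Du cu]; split => [t It|t It]; first exact: (L2mx_H1D (Du t It)).
have [M M0 rM] : exists2 M, 0 <= M & {ae leb, forall x, Omega x -> rho x <= M}.
  have [_ [M rM]] := rho_Linfty (material_ok hP); exists `|M| => //.
  apply: aeS rM => x /[apply] h; rewrite (le_trans (ler_norm _))//.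
  by rewrite (le_trans h)// ler_norm.
have bound w : member (H1D_space P) w -> norm_rho P w <= Num.sqrt M * vH1norm Omega w.
  move=> Dw; have Lw := L2mx_H1D Dw.
  rewrite /norm_rho vH1normE -sqrtrM// ler_wsqrtr//.
  apply: (@le_trans _ _ (M * ipmx leb Omega w w)); last first.
    by rewrite ler_wpM2l// /vH1_inner lerDl; exact: ipmx_ge0.
  have iw := frob_integrable mO Lw Lw.
  have irw := frob_integrable mO (L2mx_rho hP Lw) Lw.
  rewrite -subr_ge0 /ip_rho /ipmx -RintegralZl// -RintegralB//; last exact: intgZ.
  apply: (Rintegral_ae_ge0 mO).
    apply/measurable_EFinP.
    exact: (measurable_int _ (intgB mO (intgZ mO M iw) irw)).
  apply: aeS rM => x /[apply] rx; have w0 := frob_ge0 (w x).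
  have -> : frob (rho x *: w x) (w x) = rho x * frob (w x) (w x).
    rewrite /frob mulr_sumr; apply: eq_bigr => i _; rewrite mulr_sumr.
    by apply: eq_bigr => j _; rewrite mxE mulrA.
  by rewrite -mulrBl mulr_ge0// subr_ge0.
apply: (@cvg_dist_bound _ _ _ _ (fun s => Num.sqrt M * vH1norm Omega (u s - u t))).
  near=> s; have Is : I s by near: s; exact: withinT.
  rewrite subr0 ger0_norm; last exact: sqrtr_ge0.
  by apply: bound; apply: (memberB sD); [exact: Du|exact: Du].
rewrite -[X in _ --> X](mulr0 (Num.sqrt M)); apply: cvgMr; exact: cu.
Unshelve. all: by end_near. Qed.

(** A vanishing [ntrace_N] is Green's formula without boundary term, which trades the divergence in
    the strong equation for the strain of the test field. *)
Lemma adjoint_weak f p xi ddp w : L2mx leb Omega f -> L2mx leb Omega ddp ->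
  member (H1D_space P) w ->
  mxHdiv Omega (stress p xi) ->
  {ae leb, forall x, Omega x ->
     rho x *: ddp x = mxdiv Omega (stress p xi) x + rho x *: f x} ->
  ntrace_N P (stress p xi) w = 0 ->
  ip_rho P ddp w + ipmx leb Omega (stress p xi) (strain Omega w) = ip_rho P f w.
Proof.
move=> Lf Lddp Dw dS eq0 nt; have Lw := L2mx_H1D Dw.
have Ldiv : L2mx leb Omega (mxdiv Omega (stress p xi)).
  move=> i j; have [_ ex] := dS j; have [Lj _] := xgetPex (fun=> 0) ex.
  by move: Lj; congr L2; apply/funext => x; rewrite mxE.
have Lrf := L2mx_rho hP Lf; have Lrd := L2mx_rho hP Lddp.
have E : ip_rho P ddp w = ipmx leb Omega (mxdiv Omega (stress p xi)) w + ip_rho P f w.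
  have L := L2mx_lin mO 1 Ldiv Lrf.
  rewrite /ip_rho (ae_eq_ipmx mO Lrd L Lw); last first.
    by apply: aeS eq0 => x /[apply] ->; rewrite scale1r.
  by rewrite (ipmx_lin mO 1 Ldiv Lrf Lw) mul1r.
by move: nt; rewrite /ntrace_N E => nt; rewrite addrC addrA nt add0r.
Qed.

Lemma ntrace_weak q phi : H1 Omega phi -> Hdiv Omega q ->
  zero_in_Omega P (wdiv Omega q) -> ntrace P q phi = 0 ->
  ipmx leb Omega q (grad Omega phi) = 0.
Proof.
move=> Hphi [_ ex] w0 nt; have [Lw _] := xgetPex (fun=> 0) ex.
move: nt; rewrite /ntrace.
have -> : ip leb Omega (wdiv Omega q) phi = 0.
  rewrite (@ae_eq_ip _ _ _ leb Omega mO _ (fun=> 0) _ Lw (L2_0 leb Omega) Hphi.1 w0).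
  by rewrite /ip; under eq_Rintegral do rewrite mul0r; rewrite Rintegral_cst// mul0r.
by rewrite addr0.
Qed.

(** The minus sign in front of [xi] turns the difference in [aform] into the sum for which
    [reciprocity] holds. After the exchange of the two pairs, [adj2] with [psi] removes the electric
    term, and [adj1] with [u] evaluates the elastic one. The abstract [l] stands for the
    acceleration at a fixed time. *)
Lemma state_adjoint_identity z (l : (V -> V) -> R) u psi f p xi ddp :
  L2 surf Gamma z -> L2mx leb Omega f ->
  member (H1D_space P) u -> member (H1G_space P) psi ->
  (forall w phi, member (H1D_space P) w -> member (H1G_space P) phi ->
     l w + aform P u psi w phi = - ip_Gamma P z (Defs.trace P phi)) ->
  member (H1D_space P) p -> member (H1G_space P) xi ->
  (forall w, member (H1D_space P) w ->
     ip_rho P ddp w + ipmx leb Omega (stress p xi) (strain Omega w) = ip_rho P f w) ->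
  (forall phi, H1 Omega phi -> ipmx leb Omega (elec_disp p xi) (grad Omega phi) = 0) ->
  ip_rho P f u = ip_Gamma P (Defs.trace P xi) z + (ip_rho P ddp u - l p).
Proof.
move=> Lz Lf Du Gpsi eqs Dp Gxi adj1 adj2.
have [Hu _] := Du; have [Hp _] := Dp; have [Hpsi _] := Gpsi; have [Hxi _] := Gxi.
have H0 := H1_0 oO.
(* The test function [- xi] is written in the shape [-1 *: xi + 0], to which the linearity rules for
   members, gradients and traces apply directly. *)
have Gxi' : member (H1G_space P) (-1 *: xi + 0).
  exact: (member_lin sG (-1) Gxi (member0 sG)).
have := eqs _ _ Dp Gxi'; rewrite /aform.
have Le := L2mx_elec oO (material_ok hP) Hu Hpsi.
(* Even the gradient of [- xi] equals minus the gradient of [xi] only almost everywhere, so the sign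
   is extracted under the integral. *)
pose D phi := ipmx leb Omega (grad Omega phi) (elec_disp u psi).
have D_lin (a : R) f1 f2 : H1 Omega f1 -> H1 Omega f2 -> D (a *: f1 + f2) = a * D f1 + D f2.
  move=> H1f H2f; have L1 := L2mx_grad H1f; have L2' := L2mx_grad H2f.
  exact: (eq_trans (ae_eq_ipmx mO (L2mx_grad (H1_lin oO bO a H1f H2f))
    (L2mx_lin mO a L1 L2') Le (grad_lin oO bO a H1f H2f)) (ipmx_lin mO a L1 L2' Le)).
have D0 : D 0 = 0.
  have := D_lin 1 0 0 H0 H0; rewrite scaler0 addr0 mul1r => /eqP.
  by rewrite addrC -subr_eq subrr eq_sym => /eqP.
rewrite (@ipmxC _ _ _ leb Omega _ _ (elec_disp u psi) (grad Omega (-1 *: xi + 0))).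
rewrite -/(D _) D_lin// D0 addr0 mulN1r opprK /D.
rewrite (@ipmxC _ _ _ leb Omega _ _ (grad Omega xi) (elec_disp u psi)).
rewrite (reciprocity oO (material_ok hP) Hu Hpsi Hp Hxi).
rewrite (adj2 _ Hpsi) addr0.
have -> : ip_Gamma P z (Defs.trace P (-1 *: xi + 0)) = - ip_Gamma P (Defs.trace P xi) z.
  have Lt := L2_trace hP Hxi; have L0 := L2_0 surf Gamma.
  rewrite /ip_Gamma ipC.
  have L := L2_lin mG (-1) Lt L0.
  rewrite (ae_eq_ip mG (L2_trace hP (H1_lin oO bO (-1) Hxi H0)) L Lz).
    rewrite (ip_lin mG (-1) Lt L0 Lz) mulN1r /ip.
    by under [X in _ + X]eq_Rintegral do rewrite mul0r; rewrite Rintegral_cst// mul0r addr0.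
  apply: aeS2 (trace_lin hP (-1) Hxi H0) (trace0 hP) => x h h0 Gx.
  by rewrite (h Gx) (h0 Gx).
rewrite opprK => E; have := adj1 u Du; move: E.
move: (ip_rho P ddp u) (ipmx _ _ _ _) (ip_rho P f u) (ip_Gamma _ _ _) (l p) => a b c d e.
by move=> <- <-; ring.
Qed.

End optimal_control.

(** * Duality and the quadratic cost *)

(** [Q f t] is specified only up to null sets of the boundary. Its measurability comes from the
    completeness of a measure given by Caratheodory's construction. *)
Lemma complete_ae_measurable {R : realType} {disp : measure_display} {T : measurableType disp}
    (mu : {measure set T -> \bar R}) (D : set T) (f g : T -> R) :
  measure_is_complete mu -> measurable D -> measurable_fun D f ->
  {ae mu, forall x, D x -> f x = g x} -> measurable_fun D g.
Proof.
move=> cmu mD mf [N [mN N0 sN]] _ Y mY.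
have fg x : ~ N x -> D x -> f x = g x.
  by move=> nN Dx; apply: contrapT => h; apply: nN; apply: sN => /(_ Dx).
have -> : D `&` g @^-1` Y = ((D `&` f @^-1` Y) `\` N) `|` (D `&` g @^-1` Y `&` N).
  apply/seteqP; split=> x.
    move=> [Dx Yg]; have [Nx|Nx] := pselect (N x); first by right.
    by left; split => //; split => //; rewrite /preimage/= fg.
  by case=> [[[Dx Yf] Nx]|[]//]; split => //; rewrite /preimage/= -fg.
apply: measurableU; first by apply: measurableD => //; exact: mf.
by apply: cmu; exists N; split => //; exact: subIsetr.
Qed.

(** In the application [g] is the boundary product of [Q f] with the direction, for which no
    regularity in time is at hand; its integral is reached as that of the difference of two
    integrable functions. *)
Lemma Rintegral_null_diff {R : realType} {disp : measure_display}
    {T : measurableType disp} (mu : {measure set T -> \bar R}) (D : set T)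
    (f g h : T -> R) : measurable D ->
  mu.-integrable D (EFin \o f) -> mu.-integrable D (EFin \o h) ->
  \int[mu]_(x in D) h x = 0 -> (forall x, D x -> f x = g x + h x) ->
  \int[mu]_(x in D) f x = \int[mu]_(x in D) g x.
Proof.
move=> mD intf inth h0 fE; rewrite -[LHS]subr0 -h0 -RintegralB//.
by apply: eq_Rintegral => x /set_mem Dx; rewrite fE// addrK.
Qed.

Lemma integrable_quad {R : realType} {disp : measure_display}
    {T : measurableType disp} (mu : {measure set T -> \bar R}) (D : set T)
    (c : R) (f g h : T -> R) : measurable D ->
  mu.-integrable D (EFin \o f) -> mu.-integrable D (EFin \o g) ->
  mu.-integrable D (EFin \o h) ->
  mu.-integrable D (EFin \o (fun x => c ^+ 2 * f x + 2 * c * g x + h x)).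
Proof.
move=> mD intf intg inth.
exact: (intgD mD (intgD mD (intgZ mD _ intf) (intgZ mD _ intg)) inth).
Qed.

Lemma Rintegral_quad {R : realType} {disp : measure_display}
    {T : measurableType disp} (mu : {measure set T -> \bar R}) (D : set T)
    (c : R) (f g h : T -> R) : measurable D ->
  mu.-integrable D (EFin \o f) -> mu.-integrable D (EFin \o g) ->
  mu.-integrable D (EFin \o h) ->
  \int[mu]_(x in D) (c ^+ 2 * f x + 2 * c * g x + h x) =
  c ^+ 2 * (\int[mu]_(x in D) f x) + 2 * c * (\int[mu]_(x in D) g x) +
  \int[mu]_(x in D) h x.
Proof.
move=> mD intf intg inth.
have i1 := intgZ mD (c ^+ 2) intf; have i2 := intgZ mD (2 * c) intg.
rewrite (RintegralD mD (intgD mD i1 i2) inth) (RintegralD mD i1 i2).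
by rewrite !RintegralZl.
Qed.

Lemma is_derive_quad0 {R : realType} (f : R -> R) (a b c : R) :
  (forall h, f h = h ^+ 2 * a + h * b + c) -> is_derive (0 : R) (1 : R) f b.
Proof.
move=> fE; have -> : f = (fun h => h ^+ 2 * a + h * b + c) by exact/funext.
have h : is_derive (0 : R) (1 : R) (fun h : R => h ^+ 2 * a + h * b + c)
    (2 * 0 ^+ 1 * a + b + 0).
  apply: is_derive_eq; rewrite /GRing.scale/=; ring.
by apply: (is_derive_eq h); ring.
Qed.

(** * Duality in time and expansion of the cost *)

Section reduced_gradient.
Context {R : realType} {n : nat}.
Local Notation V := 'rV[R]_n.+1.
Variable P : Defs.data R n.
Hypothesis hP : standing_assumptions P.
Local Notation Omega := (domain P).
Local Notation Gamma := (bdry Omega).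
Local Notation T := (horizon P).
Local Notation I := (`[0, T]%classic : set R).
Local Notation surf := (@hausdorff R n.+1 n).
Local Notation lam := (@lebesgue_measure R).

Let mG : measurable (Gamma : set (caratheodory_type (@hausdorff_outer_measure R n.+1 n))) :=
  measurable_bdry Omega.
Let bZ := L20_inner_product P.
Let bL := L2rho_inner_product hP.
Let bD := H1D_inner_product hP.
Let sZ := inner_seminormed bZ.
Let sL := inner_seminormed bL.
Let sD := inner_seminormed bD.
Let sH := HDdual_seminormed hP.

Lemma ae_eq_ip_Gamma f g v : L2 surf Gamma f -> L2 surf Gamma v ->
  {ae surf, forall x, Gamma x -> g x = f x} -> ip_Gamma P g v = ip_Gamma P f v.
Proof.
move=> Lf Lv gf; have fg : {ae surf, forall x, Gamma x -> f x = g x}.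
  by apply: aeS gf => x /[apply].
have mg := complete_ae_measurable
  (@measure_is_complete_caratheodory R _ (@hausdorff_outer_measure R n.+1 n)) mG Lf.1 fg.
exact: (ae_eq_ip mG (L2_ae_measurable mG mg Lf fg) Lf Lv gf).
Qed.

(** [q] stands for [Q f], which at each time is prescribed only almost everywhere on the
    boundary. *)
Lemma adjoint_duality y u psi f q p xi :
  Zspace P y -> state_solution P y u psi -> Uspace P f -> adjoint_solution P f p xi ->
  (forall t, I t -> {ae surf, forall x, Gamma x -> q t x = Defs.trace P (xi t) x}) ->
  lam.-integrable I (EFin \o (fun t => ip_rho P (f t) (u t))) /\
  \int[lam]_(t in I) ip_rho P (f t) (u t) = \int[lam]_(t in I) ip_Gamma P (q t) (y t).
Proof.
move=> Zy [du [ddu [Cu [C1u [C2u [Cpsi [u0 [du0 eqy]]]]]]]] Uf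
  [dp [ddp [dxi [C2p [C1p [C1xi [pT [dpT adj]]]]]]]] qxi.
have T0 := horizon_gt0 hP.
have [Lu Ldu d_u] := C1u; have [[Lp Ldp d_p] [_ Lddp d_dp]] := C2p.
have [_ [Hdu Hddu d_du]] := C2u; have [Dp Ddp dD_p] := C1p; have [Hxi _ _] := C1xi.
have Lf := Uspace_L2rho hP Uf.
pose k t := ip_rho P (ddp t) (u t) - ddu t (p t).
pose g t := ip_rho P (dp t) (u t) - ip_rho P (du t) (p t).
have ck : {within I, continuous k}.
  exact: (within_continuousB (pairing_continuous sL sL (inner_pairing bL) Lddp Lu)
    (pairing_continuous sH sD (dual_pairing hP) Hddu Dp)).
have cg : {within I, continuous g}.
  exact: (within_continuousB (pairing_continuous sL sL (inner_pairing bL) Ldp Lu)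
    (pairing_continuous sL sL (inner_pairing bL) Ldu Lp)).
have gk t : I t -> (s - t)^-1 * (g s - g t) @[s --> within I t^'] --> k t.
  move=> It.
  have h1 := pairing_derivative sL sL (inner_pairing bL) Ldp.1 Lddp.1 Ldu.1 Lu d_dp d_u It.
  (* Here the velocity [u'] is read as a functional, its derivative [ddu] being one, and is paired
     with [p], which is differentiable in [H^1_D]. The product rule leaves [(p', u')_rho] in [h1]
     and in [h2]; the two cancel in the difference. *)
  have h2 := pairing_derivative sH sD (dual_pairing hP) Hdu.1 Hddu.1 Ddp.1 Dp d_du dD_p It.
  have E : k t = (ip_rho P (ddp t) (u t) + ip_rho P (dp t) (du t)) -
                 (ddu t (p t) + rho_embed P (du t) (dp t)).
    by rewrite /k /rho_embed (ip_rhoC P (du t) (dp t)); ring.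
  rewrite E; have -> : (fun s => (s - t)^-1 * (g s - g t)) =
      (fun s => (s - t)^-1 * (ip_rho P (dp s) (u s) - ip_rho P (dp t) (u t)) -
        (s - t)^-1 * (rho_embed P (du s) (p s) - rho_embed P (du t) (p t))).
    by apply/funext => s; rewrite /g /rho_embed; ring.
  exact: cvgB h1 h2.
have ik : \int[lam]_(t in I) k t = 0.
  rewrite (FTC_within T0 cg ck gk) /g.
  have I0 : I 0 by rewrite /= in_itv/= lexx ltW.
  have IT : I T by rewrite /= in_itv/= lexx ltW.
  rewrite (ip_rho_zero hP (Ldp.1 _ IT) (Lu.1 _ IT) dpT).
  rewrite (ip_rhoC P (du T) (p T)) (ip_rho_zero hP (Lp.1 _ IT) (Ldu.1 _ IT) pT).
  rewrite (ip_rhoC P (dp 0) (u 0)) (ip_rho_zero hP (Lu.1 _ I0) (Ldp.1 _ I0) u0).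
  rewrite (ip_rho_zero hP (Ldu.1 _ I0) (Lp.1 _ I0) du0).
  by rewrite !subr0.
have id t : I t -> ip_rho P (f t) (u t) = ip_Gamma P (q t) (y t) + k t.
  move=> It; have [dS [dE [eq1 [w0 [_ [nt [gxi nd]]]]]]] := adj t It.
  have Hxit : H1 Omega (xi t) := Hxi.1 t It.
  have [Ly _ _] := Zy.1.1.1 t It.
  rewrite (ae_eq_ip_Gamma (L2_trace hP Hxit) Ly (qxi t It)).
  apply: (state_adjoint_identity hP Ly (Lf.1 t It) (Cu.1 t It) (Cpsi.1 t It) (eqy t It)
    (Dp.1 t It) (conj Hxit gxi)).
  - move=> w Dw.
    exact: (adjoint_weak hP (Lf.1 t It) (Lddp.1 t It) Dw dS eq1 (nt w Dw)).
  - by move=> phi Hphi; exact: (ntrace_weak hP Hphi dE w0 (nd phi Hphi)).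
have intf : lam.-integrable I (EFin \o (fun t => ip_rho P (f t) (u t))).
  apply: within_continuous_integrable.
  exact: (pairing_continuous sL sL (inner_pairing bL) Lf Lu).
have intk := within_continuous_integrable ck.
split => //; exact: (Rintegral_null_diff _ intf intk ik id).
Qed.

Variable S : (R -> V -> R) -> R -> V -> V.
Hypothesis hS : state_operator P S.

Lemma state_Uspace z : Zspace P z -> Uspace P (S z).
Proof. by move=> /hS[psi [[du [ddu [Cu _]]] _]]. Qed.

Lemma state_operator_lin (h : R) z y : Zspace P z -> Zspace P y -> forall t, I t ->
  {ae leb, forall x, Omega x -> S (z + h *: y) t x = h *: S y t x + S z t x}.
Proof.
move=> Zz Zy t It; rewrite [z + _]addrC.
have [psi [sz _]] := hS Zz; have [phi [sy _]] := hS Zy.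
have [chi [_ uniq]] := hS (Zspace_lin h Zy Zz).
have [+ _] := uniq _ _ (state_solution_lin hP h Zy Zz sy sz) t It.
apply: aeS => x /[apply] /eqP; rewrite subr_eq0 => /eqP <-; exact: erefl.
Qed.

Lemma tracking_quad (h : R) z y ud t : Zspace P z -> Zspace P y -> Uspace P ud -> I t ->
  norm_rho P (S (z + h *: y) t - ud t) ^+ 2 =
  h ^+ 2 * ip_rho P (S y t) (S y t) + 2 * h * ip_rho P (S z t - ud t) (S y t) +
  ip_rho P (S z t - ud t) (S z t - ud t).
Proof.
move=> Zz Zy Uud It.
have Zzy : Zspace P (z + h *: y) by rewrite addrC; exact: Zspace_lin.
have Lzy := (Uspace_L2rho hP (state_Uspace Zzy)).1 t It.
have Lz := (Uspace_L2rho hP (state_Uspace Zz)).1 t It.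
have Ly := (Uspace_L2rho hP (state_Uspace Zy)).1 t It.
have Lud := (Uspace_L2rho hP Uud).1 t It.
have Lf := memberB sL Lz Lud.
have Lg := memberB sL Lzy Lud.
have Lyf := member_lin sL h Ly Lf.
have E : {ae leb, forall x, Omega x ->
    (S (z + h *: y) t - ud t) x = (h *: S y t + (S z t - ud t)) x}.
  apply: aeS (state_operator_lin h Zz Zy It) => x hx Ox.
  change (S (z + h *: y) t x - ud t x = h *: S y t x + (S z t x - ud t x)).
  by rewrite hx// addrA.
rewrite [LHS](inner_nrm2 bL Lg) (ae_eq_ip_rho hP Lg Lyf Lg E).
by rewrite ip_rhoC (ae_eq_ip_rho hP Lg Lyf Lyf E) (inner_quad bL h Ly Lf).
Qed.

Lemma tracking_integral (h : R) z y ud : Zspace P z -> Zspace P y -> Uspace P ud ->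
  \int[lam]_(t in I) norm_rho P (S (z + h *: y) t - ud t) ^+ 2 =
  h ^+ 2 * (\int[lam]_(t in I) ip_rho P (S y t) (S y t)) +
  2 * h * (\int[lam]_(t in I) ip_rho P (S z t - ud t) (S y t)) +
  \int[lam]_(t in I) ip_rho P (S z t - ud t) (S z t - ud t).
Proof.
move=> Zz Zy Uud.
have Cy := Uspace_L2rho hP (state_Uspace Zy).
have Cf : C0T T (L2rho_space P) (-1 *: ud + S z).
  exact: (C0T_lin sL (-1) (Uspace_L2rho hP Uud) (Uspace_L2rho hP (state_Uspace Zz))).
have {}Cf : C0T T (L2rho_space P) (fun t => S z t - ud t).
  by move: Cf; congr C0T; rewrite scaleN1r addrC.
have int (f g : R -> V -> V) : C0T T (L2rho_space P) f -> C0T T (L2rho_space P) g ->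
    lam.-integrable I (EFin \o (fun t => ip_rho P (f t) (g t))).
  move=> Cf' Cg; apply: within_continuous_integrable.
  exact: (pairing_continuous sL sL (inner_pairing bL) Cf' Cg).
rewrite -(Rintegral_quad h _ (int _ _ Cy Cy) (int _ _ Cf Cy) (int _ _ Cf Cf)); last first.
  exact: measurable_itv.
by apply: eq_Rintegral => t /set_mem It; exact: tracking_quad.
Qed.

(** Linearity of [zdot] is available for almost every time and up to seminorm zero, which is enough
    under the integral. *)
Lemma control_integral (h : R) z y : Zspace P z -> Zspace P y ->
  \int[lam]_(t in I) norm_Gamma P (zdot P (z + h *: y) t) ^+ 2 =
  h ^+ 2 * (\int[lam]_(t in I) ip_Gamma P (zdot P y t) (zdot P y t)) +
  2 * h * (\int[lam]_(t in I) ip_Gamma P (zdot P z t) (zdot P y t)) +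
  \int[lam]_(t in I) ip_Gamma P (zdot P z t) (zdot P z t).
Proof.
move=> Zz Zy; rewrite [z + _]addrC; have Zzy := Zspace_lin h Zy Zz.
have [Lz _] := zdotP Zz; have [Ly _] := zdotP Zy; have [Lzy _] := zdotP Zzy.
have iyy := L2T_pair bZ Ly Ly; have izy := L2T_pair bZ Lz Ly.
have izz := L2T_pair bZ Lz Lz.
rewrite -(Rintegral_quad h _ iyy izy izz); last exact: measurable_itv.
apply: ae_eq_Rintegral => //.
- by apply: measurable_funX; exact: (measurable_nrm bZ Lzy.1).
- apply/measurable_EFinP; apply: (measurable_int lam).
  by apply: (integrable_quad h _ iyy izy izz); exact: measurable_itv.
apply: aeS (zdot_lin hP h Zy Zz) => t E It; have {}E := E It.
have My := Ly.1.1 t It; have Mz := Lz.1.1 t It; have Mzy := Lzy.1.1 t It.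
have Mq := member_lin sZ h My Mz.
(* Vectors at seminorm distance zero have equal seminorms, by the reverse triangle inequality. *)
have -> : norm_Gamma P (zdot P (h *: y + z) t) =
    @nrm _ (L20_Gamma P) (h *: zdot P y t + zdot P z t).
  apply/eqP; rewrite -subr_eq0 -normr_le0 -[leRHS]E.
  exact: (ler_dist_nrm sZ Mzy Mq).
by rewrite (inner_nrm2 bZ Mq) (inner_quad bZ h My Mz).
Qed.

End reduced_gradient.

Theorem proposition3p4 (R : realType) (n : nat) (P : data R n)
    (hP : standing_assumptions P)
    (S : (R -> 'rV[R]_n.+1 -> R) -> R -> 'rV[R]_n.+1 -> 'rV[R]_n.+1)
    (Q : (R -> 'rV[R]_n.+1 -> 'rV[R]_n.+1) -> R -> 'rV[R]_n.+1 -> R)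
    (hS : state_operator P S) (hQ : adjoint_operator P Q)
    (ud : R -> 'rV[R]_n.+1 -> 'rV[R]_n.+1) (hud : Uspace P ud)
    (hud0 : zero_in_Omega P (ud 0))
    (alpha : R) (halpha : 0 < alpha)
    (z y : R -> 'rV[R]_n.+1 -> R) (hz : Zspace P z) (hy : Zspace P y) :
  is_derive (0 : R) (1 : R) (fun h : R => cost P S ud alpha (z + h *: y))
    (\int[lebesgue_measure]_(t in `[0, horizon P])
        ip_Gamma P (Q (fun s => S z s - ud s) t) (y t)
     + alpha * \int[lebesgue_measure]_(t in `[0, horizon P])
        ip_Gamma P (zdot P z t) (zdot P y t)).
Proof.
pose f s := S z s - ud s.
have Uf : Uspace P f.
  have sD := inner_seminormed (H1D_inner_product hP).
  have := C0T_lin sD (-1) hud (state_Uspace hS hz).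
  by congr C0T; rewrite scaleN1r addrC.
have [psi [sy _]] := hS _ hy.
have [p [xi [adj [qxi _]]]] := hQ _ Uf.
(* Read from right to left, the duality replaces the adjoint integral in the claimed derivative by
   that of [(S z - ud, S y)_rho], the coefficient produced by the expansion of the tracking term. *)
have [_ <-] := adjoint_duality hP hy sy Uf adj qxi.
apply: is_derive_quad0 => h; rewrite /cost.
rewrite (tracking_integral hP hS h hz hy hud) (control_integral hP h hz hy).
have combine (x0 x1 x2 y0 y1 y2 : R) :
    2^-1 * (h ^+ 2 * x2 + 2 * h * x1 + x0) + alpha / 2 * (h ^+ 2 * y2 + 2 * h * y1 + y0) =
    h ^+ 2 * (2^-1 * x2 + alpha / 2 * y2) + h * (x1 + alpha * y1) +
    (2^-1 * x0 + alpha / 2 * y0) by field.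
exact: combine.
Qed.
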